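(* Suppose $n$ is sufficiently large and $A\subseteq A_n$ is product-free with $\mu(A)\ge n^{-0.66}$. Then there exist $x\in[n]$ and $I\subseteq[n]$ such that $\mu(A\setminus F_I^x)<n^{-0.66}$ or $\mu(A^{-1}\setminus F_I^x)<n^{-0.66}$, where $F_I^x:=\{\pi\in A_n:\ \pi(x)\in I,\ \pi(I)\cap I=\emptyset\}$.
   Context: $\mu$ denotes the uniform probability measure on the alternating group $A_n$, i.e. $\mu(S)=|S|/|A_n|$. A subset $A$ of a group is product-free if there are no $a,b,c\in A$ with $ab=c$. $A^{-1}=\{a^{-1}:a\in A\}$. *)

(* Defs.v *)
From mathcomp Require Import all_boot all_order all_algebra all_fingroup.
From mathcomp Require Import all_solvable.
From mathcomp Require Import reals exp.

Set Implicit Arguments.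
Unset Strict Implicit.
Unset Printing Implicit Defensive.

Import Order.TTheory GRing.Theory Num.Theory.
Local Open Scope ring_scope.

(* The points of [n] are the elements 0, ..., n-1 of 'I_n, and subsets of A_n
   are sets of permutations S \subset 'Alt_('I_n). *)

Definition mu (R : realType) (n : nat) (S : {set 'S_n}) : R :=
  #|S|%:R / #|('Alt_('I_n))%g|%:R.

(* a, b and c need not be distinct. Since a and b play symmetric roles, the
   notion is the same for a group and for its opposite; in particular it does
   not matter that permutations are multiplied by (s * t) x = t (s x). *)
Definition product_free (gT : finGroupType) (A : {set gT}) : Prop :=
  ~ exists a b c : gT, [/\ a \in A, b \in A, c \in A & (a * b)%g = c].

Definition Fset (n : nat) (x : 'I_n) (I : {set 'I_n}) : {set 'S_n} :=
  [set p : 'S_n in ('Alt_('I_n))%g | (p x \in I) && [disjoint p @: I & I]].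

(* Main.v *)
(* Write y = n^(1/1000). For S in A_n let the density of S at (i, j) be
   n #|{p in S : p i = j}| / #|S|, and the excess be the density minus 1.

   If S1, S2, S3 have measure at least y^-661 and S1 S2 misses S3, then
   sum_(i,j,k) e1(i,j) e2(j,k) e3(i,k) is close to -n^2, where e1, e2, e3 are the excesses:
   this is Gowers' quasirandomness argument, applied after projecting away the trivial and
   the standard representation, so that the relevant multiplicity is of order n^2. The
   dimension bound is obtained by hand, from orthogonal translates of a joint eigenvector
   of commuting double transpositions. The excess is also controlled by a level-1
   inequality, which comes from moments of sum_i s(i, p i), bounded with exchangeable pairs.
   Hence the mass of -n^2 must come from a few positions of large density. For S inside
   the given product-free set A, these positions can be refined to lie in a single row x or
   a single column, and by passing to A^-1 we may assume that it is a row. The large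
   densities in row x then determine I, and any non-negligible part of A outside F_I^x would
   contain a set of the same structure, whose interaction with the row star is impossible. *)

Require Import Defs.
From mathcomp Require Import all_boot all_order all_algebra all_fingroup.
From mathcomp Require Import all_solvable all_field.
From mathcomp Require Import reals exp.
From mathcomp Require Import zify ring lra.

Set Implicit Arguments.
Unset Strict Implicit.
Unset Printing Implicit Defensive.

Import Order.TTheory GRing.Theory Num.Theory.
Local Open Scope ring_scope.

(** The exponent enters through [3 * 66 < 200]: three densities of about [n ^ -0.66] still beat a
    multiplicity of order [n ^ 2], whereas the dimension [n - 1] of the standard representation
    would be far too small. This is why the trivial and the standard parts are split off and counted
    explicitly, through fixed points. The multiplicity is quadratic for the following reason. A
    nonzero space of functions orthogonal to those parts cannot consist of sums of functions of one
    value, so some mixed second difference along two disjoint double transpositions is nonzero. It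
    carries two independent signs -1, and each can be transported to about [n / 8] other blocks of
    four points. The margin between [3 * 661] and 2000 is thin, so constants are never tracked: each
    is paid by a power of [y]. The level-1 inequality also loses a single power, as moments of one
    fixed order are bounded uniformly in [n]. It then controls every interaction in the trilinear
    form except that of two star entries with a small one. Since an excess is at least -1, these
    exceptions reduce to products of row and column sums, where the combinatorial structure becomes
    visible. *)

Ltac neqs :=
  repeat match goal with
  | H : is_true (?x != ?y) |- context [?x == ?y] => rewrite (negPf H)
  | H : is_true (?x != ?y) |- context [?y == ?x] => rewrite [y == x]eq_sym (negPf H)
  end.

(** * Spectral tools *)

Section Spectral.
Local Open Scope sesquilinear_scope.

(** The spectral theorem diagonalises the Hermitian matrix [X *m X^t*], and the largest eigenvalue
    dominates the quadratic form. The eigenvector is kept along with the bound, because the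
    multiplicity of its eigenspace is what will make [l] small. *)
Lemma top_eigenvector_mx (C : numClosedFieldType) (N : nat) (X : 'M[C]_N.+1) :
  exists (l : C) (w : 'rV[C]_N.+1),
    [/\ w != 0, w *m (X *m X^t*) = l *: w &
    forall u : 'rV[C]_N.+1, dotmx (u *m X) (u *m X) <= l * dotmx u u].
Proof.
set M := X *m X^t*.
have Mh : M^t* = M by rewrite /M trmx_mul map_mxM trmxCK.
have Mn : M \is normalmx by apply/normalmxP; rewrite Mh.
have /orthomx_spectralP Me := Mn.
set U := spectralmx M in Me; set d := spectral_diag M in Me.
have Uu : U \is unitarymx := spectral_unitarymx M.
have Uunit : U \in unitmx := spectral_unit M.
have UM : U *m M = diag_mx d *m U by rewrite Me !mulmxA mulmxV // mul1mx.
have dE u : dotmx (u *m X) (u *m X) = (u *m M *m u^t*) 0 0.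
  by rewrite dotmxE trmx_mul map_mxM /M !mulmxA.
have rowUM i : row i U *m M = d 0 i *: row i U.
  by rewrite -row_mul UM; apply/rowP => k; rewrite mul_diag_mx !mxE.
have rowU1 i : dotmx (row i U) (row i U) = 1.
  by move/row_unitarymxP: Uu => ->; rewrite eqxx.
have d_ge0 i : 0 <= d 0 i.
  have := dE (row i U); rewrite rowUM -scalemxAl mxE -dotmxE rowU1 mulr1 => <-.
  by rewrite dotmxE mxE; apply: sumr_ge0 => k _; rewrite !mxE mul_conjC_ge0.
pose j := [arg max_(i > ord0) d 0 i]%O.
have jmax i : d 0 i <= d 0 j.
  rewrite /j; case: real_arg_maxP => //; last by move=> k _; apply.
  by move=> k _; apply: ger0_real.
exists (d 0 j), (row j U); split.
- apply/eqP => /(congr1 (fun v => dotmx v v)); rewrite rowU1 linear0l => /eqP.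
  by rewrite oner_eq0.
- exact: rowUM.
move=> u; rewrite dE.
pose w := u *m U^t*.
have uE : u = w *m U by rewrite /w mulmxKtV.
have -> : u *m M *m u^t* = w *m diag_mx d *m w^t*.
  rewrite uE trmx_mul map_mxM -[w *m U *m M]mulmxA UM !mulmxA.
  by rewrite mulmxtVK.
have -> : dotmx u u = dotmx w w.
  rewrite !dotmxE {1 2}uE trmx_mul map_mxM !mulmxA.
  by rewrite mulmxtVK.
rewrite dotmxE !mxE mulr_sumr; apply: ler_sum => i _.
rewrite mul_mx_diag !mxE mulrAC [X in _ <= X]mulrC.
by apply: ler_wpM2l => //; rewrite mul_conjC_ge0.
Qed.

Lemma top_eigenvector (C : numClosedFieldType) (I : finType) (i0 : I)
    (X : I -> I -> C) :
  exists (l : C) (w : I -> C),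
    [/\ exists i, w i != 0,
    forall c, \sum_b w b * (\sum_d X b d * (X c d)^*) = l * w c &
    forall u : I -> C, \sum_d `|\sum_b u b * X b d| ^+ 2
        <= l * \sum_b `|u b| ^+ 2].
Proof.
have [N NE] : {N | #|I| = N.+1}.
  by exists #|I|.-1; rewrite prednK //; apply/card_gt0P; exists i0.
pose ev (k : 'I_N.+1) : I := enum_val (cast_ord (esym NE) k).
pose rk (i : I) : 'I_N.+1 := cast_ord NE (enum_rank i).
have evK : cancel ev rk by move=> k; rewrite /ev /rk enum_valK cast_ordKV.
have rkK : cancel rk ev by move=> k; rewrite /ev /rk cast_ordK enum_rankK.
have sumE (F : I -> C) : \sum_i F i = \sum_k F (ev k).
  by apply: reindex; exists rk => x _; [exact: evK | exact: rkK].
have [l [w [w0 wM wmax]]] :=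
  top_eigenvector_mx (\matrix_(i, j) X (ev i) (ev j)).
exists l, (fun i => w 0 (rk i)); split.
- case/rV0Pn: w0 => k wk; exists (ev k); by rewrite evK.
- move=> c; move/rowP/(_ (rk c)): wM; rewrite !mxE => <-.
  rewrite sumE; apply: eq_bigr => k _; rewrite evK; congr (_ * _).
  rewrite !mxE sumE; apply: eq_bigr => k' _; rewrite !mxE rkK //.
move=> u; have := wmax (\row_k u (ev k)).
rewrite !dotmxE !mxE.
under eq_bigr do rewrite !mxE -normCK.
under [X in _ <= _ * X -> _]eq_bigr do rewrite !mxE -normCK.
rewrite !sumE; congr (_ <= _); apply: eq_bigr => k _.
by congr (`|_| ^+ _); rewrite sumE; apply: eq_bigr => k' _; rewrite !mxE.
Qed.

(** Pythagoras for the residue [r] of [t] after projection on the conjugates of the [w a]; the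
    conjugates appear because the pairing in the statement is bilinear. *)
Lemma bessel (C : numClosedFieldType) (I K : finType) (w : K -> I -> C) (nu : C)
    (t : I -> C) :
  0 < nu -> (forall a b, \sum_i w a i * (w b i)^* = nu *+ (a == b)) ->
  \sum_a `|\sum_i w a i * t i| ^+ 2 <= nu * \sum_i `|t i| ^+ 2.
Proof.
move=> nu0 worth.
pose c a := \sum_i w a i * t i.
pose r i := t i - \sum_a c a / nu * (w a i)^*.
have : 0 <= nu * \sum_i `|r i| ^+ 2.
  by apply: mulr_ge0; [exact: ltW | apply: sumr_ge0 => i _; exact: exprn_ge0].
have nur : nu^* = nu by apply/CrealP; apply: ger0_real; exact: ltW.
suff -> : \sum_i `|r i| ^+ 2 = \sum_i `|t i| ^+ 2 - \sum_a `|c a| ^+ 2 / nu.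
  rewrite mulrBr subr_ge0 mulr_sumr => h; apply: le_trans h.
  by apply: ler_sum => a _; rewrite mulrCA divff ?gt_eqF // mulr1.
have E1 : \sum_i t i * (\sum_a c a / nu * (w a i)^*)^* = \sum_a `|c a| ^+ 2 / nu.
  under eq_bigr do rewrite rmorph_sum /= mulr_sumr.
  rewrite exchange_big; apply: eq_bigr => a _ /=.
  rewrite (eq_bigr (fun i => (c a)^* / nu * (w a i * t i))); last first.
    by move=> i _; rewrite !rmorphM fmorphV /= conjCK nur; ring.
  by rewrite -mulr_sumr normCK -/(c a); ring.
have E3 : \sum_i (\sum_a c a / nu * (w a i)^*) * (\sum_a c a / nu * (w a i)^*)^*
   = \sum_a `|c a| ^+ 2 / nu.
  under eq_bigr do rewrite mulr_suml.
  rewrite exchange_big; apply: eq_bigr => a _ /=.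
  under eq_bigr do rewrite rmorph_sum /= mulr_sumr.
  rewrite exchange_big /= (bigD1 a) //= [X in _ + X]big1 ?addr0 => [|b ba].
    rewrite (eq_bigr (fun i => (c a * (c a)^* / nu / nu) * (w a i * (w a i)^*))); last first.
      by move=> i _; rewrite !rmorphM fmorphV /= conjCK nur; ring.
    rewrite -mulr_sumr worth eqxx mulr1n normCK -!mulrA mulVf ?mulr1 ?gt_eqF //.
  rewrite (eq_bigr (fun i => (c a * (c b)^* / nu / nu) * (w b i * (w a i)^*))); last first.
    by move=> i _; rewrite !rmorphM fmorphV /= conjCK nur; ring.
  by rewrite -mulr_sumr worth (negPf ba) mulr0.
have E2 : \sum_i (\sum_a c a / nu * (w a i)^*) * (t i)^* = \sum_a `|c a| ^+ 2 / nu.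
  under eq_bigr do rewrite mulr_suml.
  rewrite exchange_big; apply: eq_bigr => a _ /=.
  under eq_bigr do rewrite -mulrA -rmorphM /=.
  rewrite -mulr_sumr -rmorph_sum /= normCK -/(c a); ring.
under eq_bigr => i _ do rewrite normCK /r rmorphB /= mulrBl !mulrBr -normCK.
rewrite !big_split /= !sumrN big_split /= sumrN E1 E2 E3; ring.
Qed.
End Spectral.

(** * Functions on the symmetric group *)

Section DoubleTranspositions.
Variable T : finType.
Implicit Types (a b c d e f : T) (X : {set T}).
Local Open Scope group_scope.

Definition dtperm a b c d : {perm T} := tperm a b * tperm c d.

Lemma exists_two_notin X (s : seq T) : (size s + 1 < #|X|)%N ->
  exists e f, [/\ e \in X, f \in X, e != f, e \notin s & f \notin s].
Proof.
move=> sX; have : (1 < #|X :\: [set x in s]|)%N.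
  have := cardsID [set x in s] X; have : (#|X :&: [set x in s]| <= size s)%N.
    apply: leq_trans (card_size s); apply: subset_leq_card.
    by apply/subsetP => x; rewrite !inE => /andP[].
  lia.
case/card_gt1P => e [f [eX fX ef]]; exists e, f.
by move: eX fX; rewrite !inE => /andP[-> ->] /andP[-> ->].
Qed.

(** If the two transpositions overlap, a transposition of fresh points is inserted: (a b)(c d) is
    the product of (a b)(e f) and (e f)(c d). An overlap leaves at most three points to avoid, so
    five points suffice. *)
Lemma mul_tperm_in X (H : {group {perm T}}) a b c d :
  (4 < #|X|)%N ->
  (forall a b c d, a \in X -> b \in X -> c \in X -> d \in X ->
     uniq [:: a; b; c; d] -> dtperm a b c d \in H) ->
  a \in X -> b \in X -> c \in X -> d \in X -> a != b -> c != d ->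
  tperm a b * tperm c d \in H.
Proof.
move=> X4 HX aX bX cX dX ab cd.
have [abcd|abcd] := boolP (uniq [:: a; b; c; d]); first exact: HX.
have sz : (size (undup [:: a; b; c; d]) + 1 < #|X|)%N.
  apply: leq_ltn_trans X4; rewrite addn1.
  rewrite ltn_neqAle size_undup andbT.
  by move: abcd; rewrite -ltn_size_undup ltn_neqAle => /andP[].
have [e [f [eX fX ef eN fN]]] := exists_two_notin sz.
rewrite -[tperm a b](mulgK (tperm e f)) tpermV -mulgA groupM //; apply: HX => //.
all: move: eN fN; rewrite !mem_undup.
all: rewrite !inE !negb_or => /and4P[ea eb ec ed] /and4P[fa fb fc fd].
all: by rewrite /= !inE; neqs.
Qed.

Lemma even_perm_on_in X (H : {group {perm T}}) :
  (4 < #|X|)%N ->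
  (forall a b c d, a \in X -> b \in X -> c \in X -> d \in X ->
     uniq [:: a; b; c; d] -> dtperm a b c d \in H) ->
  forall s : {perm T}, perm_on X s -> ~~ odd_perm s -> s \in H.
Proof.
move=> X4 HX s Xs.
have [|p [q [pX qX pq _ _]]] := @exists_two_notin X [::]; first by apply: ltn_trans X4.
(* The induction removes one transposition [tperm a (s a)] at a time and so alternates parity; odd
   permutations are included after correction by a fixed transposition. *)
suff : if odd_perm s then s * tperm p q \in H else s \in H by case: odd_perm.
have [k] := ubnP #|[set x | s x != x]|.
elim: k s Xs => // k IH s Xs; rewrite ltnS => sk.
have [s1|[a]] := set_0Vmem [set x | s x != x].
  have -> : s = 1.
    apply/permP => x; rewrite perm1; apply/eqP; apply: contraTT isT => sx.
    by have := in_set0 x; rewrite -s1 inE sx.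
  by rewrite odd_perm1 group1.
rewrite inE => sa.
have aX : a \in X by apply: contraNT sa => aX; rewrite (out_perm Xs).
have saX : s a \in X by rewrite (perm_closed _ Xs).
pose s' := s * tperm a (s a).
have sE : s = s' * tperm a (s a) by rewrite /s' -mulgA tperm2 mulg1.
have s'a : s' a = a by rewrite permM tpermR.
have s'fix x : s x = x -> s' x = x.
  move=> sx; rewrite permM sx tpermD //; last first.
    by apply: contra_neq sa => sax; apply: (@perm_inj _ s); rewrite sax.
  by apply: contra_neq sa => ->.
have Xs' : perm_on X s'.
  apply/subsetP => x; rewrite inE; apply: contraNT => xX; apply/eqP/s'fix.
  exact: out_perm Xs xX.
have lt : (#|[set x | s' x != x]| < k)%N.
  apply: leq_trans sk; apply: proper_card; apply/properP; split.
    by apply/subsetP => x; rewrite !inE; apply: contraNN => /eqP/s'fix ->.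
  by exists a; rewrite inE ?s'a ?eqxx.
have := IH s' Xs' lt; rewrite {1}/s' odd_permM odd_tperm eq_sym sa addbT.
case: odd_perm => /= Hs'.
  rewrite sE -mulgA groupM //; apply: (mul_tperm_in X4 HX) => //.
  by rewrite eq_sym.
rewrite sE -(mulgK (tperm p q) s') -mulgA groupM // tpermV.
by apply: (mul_tperm_in X4 HX) => //; rewrite eq_sym.
Qed.
End DoubleTranspositions.

(** * Functions with vanishing sums over cosets of point stabilizers *)

Section InvariantFunctions.
Variables (T : finType) (C : numClosedFieldType).
Implicit Types (a b c d e f : T) (X : {set T}) (w v : {ffun {perm T} -> C}).

Lemma perm_eq_preim (s : {perm T}) a b c : s b = c -> (s a == c) = (a == b).
Proof. by move=> <-; rewrite (inj_eq perm_inj). Qed.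

Lemma invariant_even_perm_on X (w : {ffun {perm T} -> C}) :
  (4 < #|X|)%N ->
  (forall a b c d, a \in X -> b \in X -> c \in X -> d \in X ->
     uniq [:: a; b; c; d] -> forall h, w (h * dtperm a b c d)%g = w h) ->
  forall s : {perm T}, perm_on X s -> ~~ odd_perm s ->
  forall h, w (h * s)%g = w h.
Proof.
move=> X4 wX s Xs s_even h.
pose H : {set {perm T}} := [set g | [forall h, w (h * g)%g == w h]].
have Hg : group_set H.
  apply/group_setP; split=> [|x y].
    by rewrite inE; apply/forallP => k; rewrite mulg1.
  rewrite !inE => /forallP Hx /forallP Hy; apply/forallP => k.
  by rewrite mulgA (eqP (Hy _)) Hx.
have : s \in Group Hg.
  apply: (even_perm_on_in X4) Xs s_even => a b c d aX bX cX dX abcd.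
  by rewrite inE; apply/forallP => k; apply/eqP/wX.
by rewrite inE => /forallP/(_ h)/eqP.
Qed.

(** The products [h * g] run through the permutations of the parity of [h] that send a given point
    to [j]. The condition is orthogonality, on each coset of the alternating group, to the
    indicators of [p i = j], which span the trivial and the standard part. *)
Definition zero_on_stabilizers w := forall h j,
  \sum_(g : {perm T} | ~~ odd_perm g && (g j == j)) w (h * g)%g = 0.

Lemma even_dtperm a b c d : a != b -> c != d -> odd_perm (dtperm a b c d) = false.
Proof. by move=> ab cd; rewrite odd_permM !odd_tperm ab cd. Qed.

(** The sum over the stabilizer of [b] is split by the image of [e]. The images other than [b] and
    [e] are exchanged by even permutations fixing [b] and [e], under which [D] is invariant, so all
    [#|T| - 2] of them contribute as much as [e']. *)
Lemma sum_stabilizer2 (D : {perm T} -> C) b e e' h :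
  (6 < #|T|)%N -> uniq [:: b; e; e'] ->
  (forall h s, ~~ odd_perm s -> s b = b -> s e = e -> D (h * s)%g = D h) ->
  \sum_(g : {perm T} | ~~ odd_perm g && (g b == b)) D (h * g)%g = 0 ->
  #|[set g : {perm T} | [&& ~~ odd_perm g, g b == b & g e == e]]|%:R * D h
   + (#|T| - 2)%:R * \sum_(g : {perm T} | [&& ~~ odd_perm g, g b == b & g e == e'])
       D (h * g)%g = 0.
Proof.
move=> T6 bee Dinv; move: (bee); rewrite /= !inE negb_or andbT => /andP[/andP[be be'] ee'] sum0.
rewrite -[RHS]sum0.
rewrite [RHS](partition_big (fun g : {perm T} => g e) predT) //=.
rewrite [RHS](bigD1 e) //=; congr (_ + _).
  rewrite mulr_natl -sumr_const; apply: eq_big => [g|g]; first by rewrite inE andbA.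
  by rewrite inE => /and3P[g0 /eqP gb /eqP ge]; rewrite Dinv.
rewrite [RHS](bigD1 b) //= [X in X + _]big1 ?add0r; last first.
  move=> g /andP[/andP[_ /eqP gb] /eqP geb].
  by case/eqP: be; apply: (@perm_inj _ g); rewrite gb geb.
rewrite [RHS](eq_bigr (fun=> \sum_(g : {perm T} | [&& ~~ odd_perm g, g b == b & g e == e'])
       D (h * g)%g)); last first.
  move=> e2 /andP[e2e e2b].
  have [->|e'e2] := eqVneq e2 e'; first by apply: eq_bigl => g; rewrite andbA.
  have [|u [v [_ _ uv]]] := @exists_two_notin _ [set: T] [:: b; e; e'; e2].
    by rewrite cardsT ltnW.
  rewrite !inE !negb_or => /and4P[ub ue ue' ue2] /and4P[vb ve ve' ve2].
  pose t := dtperm e' e2 u v.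
  have t_even : odd_perm t = false by rewrite even_dtperm // eq_sym.
  have tb : t b = b by rewrite permM !tpermD // eq_sym.
  have te : t e = e by rewrite permM !tpermD // eq_sym.
  have te' : t e' = e2 by rewrite permM tpermL tpermD // eq_sym.
  rewrite (reindex_inj (mulIg t)); apply: eq_big => [g|g _] /=.
    by rewrite odd_permM t_even addbF !(permM g) (perm_eq_preim _ tb) (perm_eq_preim _ te') andbA.
  by rewrite mulgA; apply: Dinv => //; rewrite t_even.
rewrite sumr_const mulr_natl; congr (_ *+ _).
have -> : #|[pred i | i != e & i != b]| = #|~: [set e; b]|.
  by apply: eq_card => i; rewrite !inE negb_or.
have := cardsC [set e; b]; rewrite cards2 eq_sym be /=; lia.
Qed.

(* [D h] depends only on [h b] and [h e]; read as a function of these two points it is an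
   additive cocycle whose row and column sums vanish, hence it is 0. *)
Lemma cocycle_eq0 (D : {perm T} -> C) b e e' f f' :
  (6 < #|T|)%N -> uniq [:: b; e; e'; f; f'] ->
  (forall h s, ~~ odd_perm s -> s b = b -> s e = e -> D (h * s)%g = D h) ->
  (forall h j, \sum_(g : {perm T} | ~~ odd_perm g && (g j == j)) D (h * g)%g = 0) ->
  (forall h, D (h * dtperm e e' f f')%g + D (h * dtperm b e' f f')%g = D h) ->
  forall h, D h = 0.
Proof.
move=> T6 /= /and5P[]; rewrite !inE !negb_or => /and4P[be be' bf bf'].
move=> /and3P[ee' ef ef'] /andP[e'f e'f'] ff' _ Dinv Dz Dco h.
set K := [set g : {perm T} | [&& ~~ odd_perm g, g b == b & g e == e]].
have H1 : _ = 0 := @sum_stabilizer2 D b e e' h T6 ltac:(by rewrite /= !inE; neqs)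
  Dinv (Dz _ _).
have H2 : _ = 0 := @sum_stabilizer2 D e b e' h T6 ltac:(by rewrite /= !inE; neqs)
  (fun h s s0 sb se => Dinv h s s0 se sb) (Dz _ _).
set k1 := dtperm e e' f f' in Dco; set k2 := dtperm b e' f f' in Dco.
have k1_even : odd_perm k1 = false by rewrite even_dtperm.
have k2_even : odd_perm k2 = false by rewrite even_dtperm.
have A1 : \sum_(g : {perm T} | [&& ~~ odd_perm g, g b == b & g e == e'])
    D (h * g)%g = \sum_(g in K) D (h * g * k1)%g.
  rewrite (reindex_inj (mulIg k1)); apply: eq_big => [g|g _] /=; last by rewrite mulgA.
  rewrite inE odd_permM k1_even addbF !(permM g).
  have k1b : k1 b = b by rewrite permM !tpermD // eq_sym.
  have k1e : k1 e = e' by rewrite permM tpermL tpermD // eq_sym.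
  by rewrite (perm_eq_preim _ k1b) (perm_eq_preim _ k1e).
have A2 : \sum_(g : {perm T} | [&& ~~ odd_perm g, g e == e & g b == e'])
    D (h * g)%g = \sum_(g in K) D (h * g * k2)%g.
  rewrite (reindex_inj (mulIg k2)); apply: eq_big => [g|g _] /=; last by rewrite mulgA.
  rewrite inE odd_permM k2_even addbF !(permM g).
  have k2e : k2 e = e by rewrite permM !tpermD // eq_sym.
  have k2b : k2 b = e' by rewrite permM tpermL tpermD // eq_sym.
  by rewrite (perm_eq_preim _ k2b) (perm_eq_preim _ k2e) [X in _ && X]andbC.
have A3 : \sum_(g in K) D (h * g * k1)%g + \sum_(g in K) D (h * g * k2)%g
   = #|K|%:R * D h.
  rewrite -big_split /= mulr_natl -sumr_const; apply: eq_bigr => g.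
  by rewrite inE Dco => /and3P[g0 /eqP gb /eqP ge]; rewrite Dinv.
have K2 : [set g : {perm T} | [&& ~~ odd_perm g, g e == e & g b == b]] = K.
  by apply/setP => g; rewrite !inE [X in _ && X]andbC.
rewrite K2 A2 in H2; rewrite A1 in H1.
have K0 : (0 < #|K|)%N.
  by apply/card_gt0P; exists 1%g; rewrite inE odd_perm1 !perm1 !eqxx.
(* The two stabilizer relations are added: each brings one term [#|K| * D h], and by the cocycle
   identity [A3] their sums together bring [#|T| - 2] more. *)
have : #|T|%:R * #|K|%:R * D h = 0.
  rewrite -[X in X%:R * _ * _](@subnKC 2) ?natrD; last by apply: ltn_trans T6.
  rewrite -mulrA mulrDl -{2}A3 mulrDr; move: H1 H2.
  set x := _ * D h; set s1 := _ * \sum_(i in K) _; set s2 := _ * \sum_(i in K) _.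
  by move=> H1 H2; rewrite -[RHS](addr0 0) -{1}H1 -H2; ring.
move/eqP; rewrite !mulf_eq0 !pnatr_eq0 => /orP[/orP[/eqP T0|/eqP K00]|/eqP //].
  by rewrite T0 in T6.
by rewrite K00 in K0.
Qed.

End InvariantFunctions.

(** * Mixed second differences along double transpositions *)

Section SecondDifferences.
Variables (T : finType) (C : numClosedFieldType).
Implicit Types (a b c d e f : T) (h g s : {perm T}) (w v : {ffun {perm T} -> C}).

Definition translate s w : {ffun {perm T} -> C} := [ffun h => w (h * s)%g].

Lemma dtpermJ a b c d s :
  (dtperm a b c d ^ s = dtperm (s a) (s b) (s c) (s d))%g.
Proof. by rewrite conjMg !tpermJ. Qed.

Lemma dtperm_fix a b c d e : e \notin [:: a; b; c; d] -> dtperm a b c d e = e.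
Proof.
by rewrite !inE !negb_or => /and4P[? ? ? ?]; rewrite permM !tpermD // eq_sym.
Qed.

Lemma dtpermE a b c d : uniq [:: a; b; c; d] ->
  [/\ dtperm a b c d a = b, dtperm a b c d b = a,
      dtperm a b c d c = d & dtperm a b c d d = c].
Proof.
move=> /= /and4P[]; rewrite !inE !negb_or => /and3P[ab ac ad] /andP[bc bd] cd _.
by rewrite !permM; split; [rewrite tpermL tpermD|rewrite tpermR tpermD|
  rewrite (tpermD ac bc) tpermL|rewrite (tpermD ad bd) tpermR] => //; rewrite eq_sym.
Qed.

Lemma dtperm_comm a b c d s :
  [/\ s a = a, s b = b, s c = c & s d = d] -> commute (dtperm a b c d) s.
Proof. by case=> sa sb sc sd; apply/commgP/conjg_fixP; rewrite dtpermJ sa sb sc sd. Qed.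

Lemma dtperm_sq a b c d : uniq [:: a; b; c; d] ->
  (dtperm a b c d * dtperm a b c d = 1)%g.
Proof.
move=> abcd; have [ga gb gc gd] := dtpermE abcd.
set g := dtperm a b c d in ga gb gc gd *.
apply/permP => x; rewrite perm1 permM.
have [|xN] := boolP (x \in [:: a; b; c; d]); last by rewrite !dtperm_fix.
by rewrite !inE => /or4P[] /eqP ->; rewrite ?(ga, gb, gc, gd).
Qed.

(** A function of degree one, that is a sum of functions of single values [h i], has this property,
    because no value is moved by both factors; [stable_space_eq0] is a converse. *)
Definition second_difference_free w := forall a b c d a' b' c' d',
  uniq [:: a; b; c; d; a'; b'; c'; d'] -> forall h,
  w (h * dtperm a b c d * dtperm a' b' c' d')%g - w (h * dtperm a b c d)%g
    - w (h * dtperm a' b' c' d')%g + w h = 0.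

(** The increment [D] of [v] does not depend on the auxiliary pair [f, f'], which can be replaced by
    fresh points ([Dswap]). Vanishing second differences then make [D] invariant under even
    permutations fixing [b] and [e], and [cocycle_eq0] applies. *)
Lemma invariant_swap (B : {set T}) v b e e' f f' :
  (16 < #|T|)%N -> (#|B| <= 4)%N -> uniq [:: b; e; e'; f; f'] -> b \in B ->
  e \notin B -> e' \notin B -> f \notin B -> f' \notin B ->
  second_difference_free v ->
  (forall a b c d, a \notin B -> b \notin B -> c \notin B -> d \notin B ->
     uniq [:: a; b; c; d] -> forall h, v (h * dtperm a b c d)%g = v h) ->
  zero_on_stabilizers (translate (dtperm b e f f') v - v) ->
  forall h, v (h * dtperm b e f f')%g = v h.
Proof.
move=> T16 B4 bee bB eB e'B fB f'B v2 vB vz h.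
pose D g := v (g * dtperm b e f f')%g - v g.
suff /(_ h) : forall h, D h = 0 by move/eqP; rewrite subr_eq0 => /eqP.
move: (bee) => /= /and5P[]; rewrite !inE !negb_or => /and4P[be be' bf bf'].
move=> /and3P[ee' ef ef'] /andP[e'f e'f'] ff' _.
set k := dtperm b e f f' in vz D *.
have kU : uniq [:: b; e; f; f'] by rewrite /= !inE; neqs.
have [kb ke kf kf'] := dtpermE kU; rewrite -/k in kb ke kf kf'.
have ke' : k e' = e' by apply: dtperm_fix; rewrite !inE; neqs.
have Dswap g u u' : u \notin B -> u' \notin B -> u != u' -> u \notin [:: e; e'; f; f'] ->
    u' \notin [:: e; e'; f; f'] -> D g = v (g * dtperm b e u u')%g - v g.
  move=> uB u'B uu'; rewrite !inE !negb_or => /and4P[ue ue' uf uf'] /and4P[u'e u'e' u'f u'f'].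
  rewrite /D; congr (_ - _); rewrite -(vB f f' u u') //; last by rewrite /= !inE; neqs.
  have bu : b != u by apply: contraNneq uB => <-.
  have bu' : b != u' by apply: contraNneq u'B => <-.
  congr (v _); rewrite -[LHS]mulgA; congr (_ * _)%g.
  rewrite /k /dtperm -[LHS]mulgA; congr (_ * _)%g.
  by rewrite mulgA tperm2 mul1g.
apply: (@cocycle_eq0 T C D b e e' f f') => //.
- by apply: leq_trans T16.
- move=> {}h s s_even sb se.
  have Dff : forall s, perm_on (~: [set b; e]) s -> ~~ odd_perm s ->
      forall h, [ffun h => D h] (h * s)%g = [ffun h => D h] h.
    apply: invariant_even_perm_on.
      by have := cardsC [set b; e]; rewrite cards2 be -(ltn_add2l 2) => ->; apply: leq_trans T16.
    move=> a1 b1 c1 d1; rewrite !inE !negb_or => /andP[a1b a1e] /andP[b1b b1e].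
    move=> /andP[c1b c1e] /andP[d1b d1e] g1U g; rewrite !ffunE.
    have [|u [u' [_ _ uu' uN u'N]]] :=
      @exists_two_notin _ [set: T] ([:: a1; b1; c1; d1; e; e'; f; f'] ++ enum B).
      rewrite cardsT size_cat -cardE /=.
      apply: leq_trans T16; rewrite addn1.
      by apply: (@leq_trans (10 + 4)) => //; rewrite -[_.+2]/(10 + _)%N leq_add2l.
    have memP x : x \notin [:: a1; b1; c1; d1; e; e'; f; f'] ++ enum B ->
      [/\ x \notin B, x \notin [:: e; e'; f; f'] & [&& x != a1, x != b1, x != c1 & x != d1]].
      rewrite mem_cat !inE mem_enum !negb_or => /andP[].
      by case/and5P => -> -> -> -> -> ->.
    have [uB uE /and4P[ua1 ub1 uc1 ud1]] := memP _ uN.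
    have [u'B u'E /and4P[u'a1 u'b1 u'c1 u'd1]] := memP _ u'N.
    rewrite !(Dswap _ u u') //.
    have bu : b != u by apply: contraNneq uB => <-.
    have bu' : b != u' by apply: contraNneq u'B => <-.
    have eu : e != u by move: uE; rewrite !inE !negb_or eq_sym => /andP[].
    have eu' : e != u' by move: u'E; rewrite !inE !negb_or eq_sym => /andP[].
    have := v2 a1 b1 c1 d1 b e u u' _ g.
    move: g1U; rewrite /= !inE !negb_or => /and4P[/and3P[? ? ?] /andP[? ?] ? _].
    neqs => /(_ isT).
    by move=> E; apply/eqP; rewrite -subr_eq0 -[X in _ == X]E; apply/eqP; ring.
  have := Dff s _ s_even h; rewrite !ffunE; apply.
  apply/subsetP => x; rewrite !inE negb_or; apply: contraNT; rewrite negb_and !negbK.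
  by case/orP => /eqP ->; rewrite ?sb ?se.
- by move=> {}h j; have := vz h j; under eq_bigr do rewrite !ffunE.
- move=> {}h; rewrite /D.
  set k1 := dtperm e e' f f'; set k2 := dtperm b e' f f'.
  have k1B g : v (g * k1)%g = v g by apply: vB => //; rewrite /= !inE; neqs.
  have Uk2 : uniq [:: b; e'; f; f'] by rewrite /= !inE; neqs.
  have [k2b k2e' k2f k2f'] := dtpermE Uk2; rewrite -/k2 in k2b k2e' k2f k2f'.
  have k2e : k2 e = e by apply: dtperm_fix; rewrite !inE; neqs.
  (* These conjugation relations bring [k1], under which [v] is invariant, to the right end of each
     product; the values of [v] at [h * k2] then cancel in the cocycle identity. *)
  have E1 : (k2 * k = k * k1)%g.
    rewrite [LHS]conjgC dtpermJ kb ke' kf kf'; congr (_ * _)%g.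
    by rewrite /k1 /dtperm (tpermC f').
  have E2 : (k1 * k = k2 * k1)%g.
    have -> : (k1 * k = k * k2)%g.
      rewrite [LHS]conjgC dtpermJ ke ke' kf kf'; congr (_ * _)%g.
      by rewrite /k2 /dtperm (tpermC f').
    rewrite [LHS]conjgC dtpermJ k2b k2e k2f k2f'; congr (_ * _)%g.
    by rewrite /k1 /dtperm (tpermC f') (tpermC e').
  rewrite -(mulgA h k1 k) E2 -(mulgA h k2 k) E1 (mulgA h k2 k1) (mulgA h k k1) !k1B; ring.
Qed.

End SecondDifferences.

(** * Translation-stable spaces and joint eigenvectors *)

Section StableSpaces.
Variables (T : finType) (C : numClosedFieldType).
Implicit Types (a b c d e f : T) (h g s : {perm T}) (u w v : {ffun {perm T} -> C}).

Definition stable_space (W : {ffun {perm T} -> C} -> Prop) :=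
  (forall u v, W u -> W v -> W (u - v)) /\
  (forall s u, ~~ odd_perm s -> W u -> W (translate s u)).

(** For a double transposition [g1], the increment [v] of [w] along [g1] is invariant under double
    transpositions disjoint from [g1], then under those that meet it, hence under [g1]. As [g1] is
    an involution it also negates [v], so [v = 0]. Thus [w] is invariant under all even
    permutations, and its vanishing stabilizer sums make it 0. *)
Lemma stable_space_eq0 (W : {ffun {perm T} -> C} -> Prop) :
  (16 < #|T|)%N -> stable_space W ->
  (forall w, W w -> zero_on_stabilizers w) ->
  (forall w, W w -> second_difference_free w) ->
  forall w, W w -> w = 0.
Proof.
move=> T16 [WB Wt] Wz W2.
have Wdt w (Ww : W w) b1 b2 b3 b4 : uniq [:: b1; b2; b3; b4] ->
    forall h, w (h * dtperm b1 b2 b3 b4)%g = w h.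
  move=> bU h; set g1 := dtperm b1 b2 b3 b4.
  pose B := [set x in [:: b1; b2; b3; b4]].
  have B4 : (#|B| <= 4)%N by rewrite cardsE; apply: (card_size [:: b1; b2; b3; b4]).
  move: (bU) => /= /and4P[]; rewrite !inE !negb_or.
  move=> /and3P[b12 b13 b14] /andP[b23 b24] b34 _.
  have g1_even : ~~ odd_perm g1 by rewrite even_dtperm.
  pose v := translate g1 w - w.
  have Wv : W v by apply: WB => //; apply: Wt.
  have vE x : v x = w (x * g1)%g - w x by rewrite !ffunE.
  have vB a b c d : a \notin B -> b \notin B -> c \notin B -> d \notin B ->
      uniq [:: a; b; c; d] -> forall h, v (h * dtperm a b c d)%g = v h.
    rewrite !inE !negb_or => /and4P[? ? ? ?] /and4P[? ? ? ?] /and4P[? ? ? ?] /and4P[? ? ? ?].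
    rewrite /= !inE !negb_or => /and4P[/and3P[? ? ?] /andP[? ?] ? _] h'.
    have := W2 w Ww a b c d b1 b2 b3 b4 _ h'; rewrite /= !inE; neqs => /(_ isT) E.
    by apply/eqP; rewrite -subr_eq0 -[X in _ == X]E !vE; apply/eqP; ring.
  have [|e [e' [_ _ ee' eB e'B]]] := @exists_two_notin _ [set: T] (enum B).
    by rewrite cardsT -cardE addn1; apply: leq_trans T16; rewrite !ltnS (leq_trans B4).
  have [|f [f' [_ _ ff' fB f'B]]] := @exists_two_notin _ [set: T] ([:: e; e'] ++ enum B).
    by rewrite cardsT size_cat -cardE addn1; apply: leq_trans T16; rewrite !ltnS (leq_trans B4).
  move: eB e'B fB f'B; rewrite !mem_cat !inE !mem_enum !negb_or => eB e'B.
  move=> /andP[/andP[fe fe'] fB] /andP[/andP[f'e f'e'] f'B].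
  have vb b : b \in B -> forall h, v (h * dtperm b e f f')%g = v h.
    move=> bB; have := @invariant_swap T C B v b e e' f f' T16 B4.
    apply => //; last 2 first.
    - exact: W2.
    - by apply: Wz; apply: WB => //; apply: Wt => //; rewrite even_dtperm //;
        apply: contraNneq eB => <-.
    have ? : b != e by apply: contraNneq eB => <-.
    have ? : b != e' by apply: contraNneq e'B => <-.
    have ? : b != f by apply: contraNneq fB => <-.
    have ? : b != f' by apply: contraNneq f'B => <-.
    by rewrite /= !inE; neqs.
  have vbb b b' : b \in B -> b' \in B -> b != b' ->
      forall h, v (h * dtperm b b' f f')%g = v h.
    move=> bB b'B bb' h'.
    have ? : b != e by apply: contraNneq eB => <-.
    have ? : b != f by apply: contraNneq fB => <-.
    have ? : b != f' by apply: contraNneq f'B => <-.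
    have ? : b' != e by apply: contraNneq eB => <-.
    have ? : b' != f by apply: contraNneq fB => <-.
    have ? : b' != f' by apply: contraNneq f'B => <-.
    have kU : uniq [:: b; e; f; f'] by rewrite /= !inE; neqs.
    have [kb ke kf kf'] := dtpermE kU; have k2 := dtperm_sq kU.
    set k := dtperm b e f f' in kb ke kf kf' k2.
    have kb' : k b' = b' by apply: dtperm_fix; rewrite !inE; neqs.
    (* Conjugation by [k] carries [e] to [b], so an exchange inside [B] is a product of three double
       transpositions that meet [B] in one point. *)
    have E : (k * dtperm b' e f f' * k = dtperm b b' f f')%g.
      have kV : (k = k^-1)%g by apply: (mulgI k); rewrite k2 mulgV.
      rewrite {1}kV -mulgA -conjgE dtpermJ kb' ke kf kf'.
      by rewrite /dtperm (tpermC b') (tpermC f').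
    by rewrite -E (mulgA h' (k * _)%g k) vb // (mulgA h' k) vb // vb.
  have fU : uniq [:: b1; b2; f; f'].
    have ? : b1 != f by apply: contraNneq fB => <-; rewrite inE mem_head.
    have ? : b1 != f' by apply: contraNneq f'B => <-; rewrite inE mem_head.
    have ? : b2 != f by apply: contraNneq fB => <-; rewrite !inE eqxx orbT.
    have ? : b2 != f' by apply: contraNneq f'B => <-; rewrite !inE eqxx orbT.
    by rewrite /= !inE; neqs.
  have : v (h * g1)%g = v h.
    have -> : g1 = (dtperm b1 b2 f f' * dtperm b3 b4 f f')%g.
      have C34 : commute (tperm f f') (tperm b3 b4).
        have ? : b3 != f by apply: contraNneq fB => <-; rewrite !inE eqxx !orbT.
        have ? : b3 != f' by apply: contraNneq f'B => <-; rewrite !inE eqxx !orbT.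
        have ? : b4 != f by apply: contraNneq fB => <-; rewrite !inE eqxx !orbT.
        have ? : b4 != f' by apply: contraNneq f'B => <-; rewrite !inE eqxx !orbT.
        by apply/commgP/conjg_fixP; rewrite tpermJ !tpermD // eq_sym.
      rewrite /g1 /dtperm -[RHS]mulgA; congr (_ * _)%g.
      by rewrite mulgA C34 -mulgA tperm2 mulg1.
    rewrite mulgA vbb ?vbb // ?inE ?eqxx ?orbT //.
  rewrite !vE -mulgA dtperm_sq // mulg1 => E.
  apply/eqP; rewrite -subr_eq0; have : (w (h * g1)%g - w h) *+ 2 = 0.
    by rewrite mulr2n -{1}E; ring.
  by move/eqP; rewrite mulrn_eq0.
move=> w Ww; have winv : forall s, ~~ odd_perm s -> forall h, w (h * s)%g = w h.
  move=> s s_even; apply: (@invariant_even_perm_on T C [set: T]) => //.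
  - by rewrite cardsT; apply: leq_trans T16.
  - by move=> a b c d _ _ _ _; apply: Wdt.
  - by apply/subsetP => x _; rewrite inE.
apply/ffunP => h; rewrite ffunE.
have [j _] : exists j : T, j \in T by apply/card_gt0P; apply: leq_trans T16.
have := Wz w Ww h j; rewrite (eq_bigr (fun=> w h)); last first.
  by move=> g /andP[g_even _]; rewrite winv.
rewrite sumr_const => /eqP; rewrite mulrn_eq0 => /orP[/eqP K0|/eqP //].
have : (0 < #|[pred g : {perm T} | ~~ odd_perm g && (g j == j)]|)%N.
  by apply/card_gt0P; exists 1%g; rewrite inE odd_perm1 perm1 eqxx.
by rewrite K0.
Qed.

Definition eigen u g (s : bool) := forall h, u (h * g)%g = (-1) ^+ s * u h.

Lemma eigen_conj u t g (s : bool) : eigen u (g ^ t)%g s -> eigen (translate t u) g s.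
Proof.
by move=> ug h; rewrite !ffunE -ug -mulgA [(g * t)%g]conjgC mulgA.
Qed.

Lemma eigenM u g g' (s s' : bool) : eigen u g s -> eigen u g' s' -> eigen u (g * g')%g (s (+) s').
Proof. by move=> ug ug' h; rewrite mulgA ug' ug mulrA signr_addb [_ * (-1) ^+ s]mulrC. Qed.

Lemma eigen_orthogonal u v g (s s' : bool) : eigen u g s -> eigen v g s' -> s != s' ->
  \sum_h u h * (v h)^* = 0.
Proof.
move=> ug vg ss'; set S := LHS; suff : S *+ 2 = 0 by move/eqP; rewrite mulrn_eq0 => /eqP.
rewrite mulr2n {1}/S (reindex_inj (mulIg g)) -big_split big1 //= => h _.
rewrite ug vg rmorphM /= rmorphXn rmorphN1 mulrACA -signr_addb.
have -> : s (+) s' = true by move: ss'; case: (s); case: (s').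
by rewrite expr1 mulN1r addNr.
Qed.

(** The involutions of [L] are diagonalised one at a time: [u] plus and [u] minus its translate by
    [e] cannot both vanish. The signs already known on [G] survive because [e] commutes with [G]. *)
Lemma simultaneous_eigen (W : {ffun {perm T} -> C} -> Prop) (L G : seq {perm T}) u :
  stable_space W -> W u -> u != 0 ->
  (forall g, g \in L -> ~~ odd_perm g /\ (g * g = 1)%g) ->
  (forall (e g : {perm T}), e \in L -> g \in L ++ G -> commute e g) ->
  (forall g, g \in G -> exists s : bool, eigen u g s) ->
  exists v, [/\ W v, v != 0,
    forall g, g \in L ++ G -> exists s : bool, eigen v g s &
    forall g (s : bool), g \in G -> eigen u g s -> eigen v g s].
Proof.
move=> [WB Wt]; elim: L G u => [|e L IH] G u Wu u0 LP Lc uG; first by exists u.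
have [e_even ee] := LP e (mem_head _ _).
have W0 : W 0 by rewrite -(subrr u); apply: WB.
have WN x : W x -> W (- x) by move=> Wx; rewrite -[- x]add0r; apply: WB.
have [s [v [Wv v0 ve vG]]] : exists (s : bool) v,
    [/\ W v, v != 0, eigen v e s & forall g (s : bool), g \in G -> eigen u g s -> eigen v g s].
  pose v (s : bool) := if s then u - - translate e u else u - translate e u.
  have Wv (s : bool) : W (v s).
    by case: s; apply: WB => //; [apply: WN|]; apply: Wt.
  have vh (s : bool) h : v s h = u h - (-1) ^+ s * u (h * e)%g.
    by case: s; rewrite /v !ffunE ?expr1 ?expr0; ring.
  have vE (s : bool) : eigen (v s) e (~~ s).
    by move=> h; rewrite !vh -mulgA ee mulg1; case: s; rewrite /= ?expr1 ?expr0; ring.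
  have vG (s : bool) g (s' : bool) : g \in G -> eigen u g s' -> eigen (v s) g s'.
    move=> gG ug h; rewrite !vh -mulgA -(Lc e g) ?mem_head ?mem_cat ?gG ?orbT //.
    by rewrite mulgA !ug; ring.
  have [v0|v0] := eqVneq (v true) 0; last by exists (~~ true), (v true); split=> // g s; apply: vG.
  exists (~~ false), (v false); split=> //; last by move=> g s; apply: vG.
  apply: contra_neq u0 => v1; apply/ffunP => h.
  have /ffunP/(_ h) := v0; have /ffunP/(_ h) := v1.
  rewrite !vh !ffunE expr0 expr1 mulN1r mul1r opprK => e1 e2.
  have : u h *+ 2 = 0 by rewrite mulr2n -[RHS]addr0 -{1}e1 -e2; ring.
  by move/eqP; rewrite mulrn_eq0 => /eqP.
have [|||v' [Wv' v'0 v'L v'G]] := IH (e :: G) v Wv v0.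
- by move=> g gL; apply: LP; rewrite inE gL orbT.
- move=> e' g e'L; rewrite mem_cat inE => gLG; apply: Lc; first by rewrite inE e'L orbT.
  by rewrite !(inE, mem_cat); case/or3P: gLG => ->; rewrite ?orbT.
- move=> g; rewrite inE => /orP[/eqP->|gG]; first by exists s.
  by have [s' us'] := uG g gG; exists s'; apply: vG.
exists v'; split=> // [g|g s' gG ug].
  by move=> gL; apply: v'L; move: gL; rewrite !(inE, mem_cat) orbCA.
by apply: v'G; [rewrite inE gG orbT|apply: vG].
Qed.
End StableSpaces.

(** * Blocks of four points and a quadratic family of orthogonal translates *)

Section Blocks.
Variables (T : finType) (C : numClosedFieldType) (m : nat) (P : nat -> nat -> T).
Hypothesis P_inj : forall p q i j, (p < m)%N -> (q < m)%N -> (i < 4)%N -> (j < 4)%N ->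
  P p i = P q j -> p = q /\ i = j.
Implicit Types (p q r : nat) (g t : {perm T}) (u w v : {ffun {perm T} -> C}).

Definition fixes_block t p := forall i, (i < 4)%N -> t (P p i) = P p i.

(** [block_x p] and [block_y p] generate the Klein four-group of block [p], whose characters are
    pairs of signs. [block_rot p] is a 3-cycle permuting its three involutions cyclically;
    [block_swap] exchanges two blocks pointwise and is even, being a product of four
    transpositions. *)
Definition block_x p := dtperm (P p 0) (P p 1) (P p 2) (P p 3).
Definition block_y p := dtperm (P p 0) (P p 2) (P p 1) (P p 3).
Definition block_rot p := (tperm (P p 1) (P p 2) * tperm (P p 1) (P p 3))%g.
Definition block_swap p q := (tperm (P p 0) (P q 0) * tperm (P p 1) (P q 1)
  * (tperm (P p 2) (P q 2) * tperm (P p 3) (P q 3)))%g.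

Lemma P_neq p q i j : (p < m)%N -> (q < m)%N -> (i < 4)%N -> (j < 4)%N ->
  (p != q) || (i != j) -> P p i != P q j.
Proof.
move=> pm qm i4 j4; apply: contraTneq => /P_inj[] // -> ->.
by rewrite !eqxx.
Qed.

Lemma block_xU p : (p < m)%N -> uniq [:: P p 0; P p 1; P p 2; P p 3].
Proof. by move=> pm; rewrite /= !inE !negb_or !P_neq ?orbT. Qed.

Lemma block_yU p : (p < m)%N -> uniq [:: P p 0; P p 2; P p 1; P p 3].
Proof. by move=> pm; rewrite /= !inE !negb_or !P_neq ?orbT. Qed.

Lemma even_block_x p : (p < m)%N -> ~~ odd_perm (block_x p).
Proof. by move=> pm; rewrite even_dtperm // P_neq ?orbT. Qed.

Lemma even_block_y p : (p < m)%N -> ~~ odd_perm (block_y p).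
Proof. by move=> pm; rewrite even_dtperm // P_neq ?orbT. Qed.

Lemma block_x_conj p t : fixes_block t p -> (block_x p ^ t = block_x p)%g.
Proof. by move=> tp; rewrite dtpermJ !tp. Qed.

Lemma block_y_conj p t : fixes_block t p -> (block_y p ^ t = block_y p)%g.
Proof. by move=> tp; rewrite dtpermJ !tp. Qed.

Lemma fixes_blockM p t t' : fixes_block t p -> fixes_block t' p -> fixes_block (t * t')%g p.
Proof. by move=> tp t'p i i4; rewrite permM tp ?t'p. Qed.

Lemma fixes_block_tperm p q r i j k : (p < m)%N -> (q < m)%N -> (r < m)%N ->
  p != r -> q != r -> (i < 4)%N -> (j < 4)%N -> (k < 4)%N ->
  tperm (P p i) (P q j) (P r k) = P r k.
Proof. by move=> pm qm rm pr qr i4 j4 k4; rewrite tpermD // P_neq ?pr ?qr. Qed.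

Lemma block_x_fixes p q : (p < m)%N -> (q < m)%N -> p != q -> fixes_block (block_x p) q.
Proof. by move=> pm qm pq i i4; rewrite permM !fixes_block_tperm. Qed.

Lemma block_y_fixes p q : (p < m)%N -> (q < m)%N -> p != q -> fixes_block (block_y p) q.
Proof. by move=> pm qm pq i i4; rewrite permM !fixes_block_tperm. Qed.

Lemma block_rot_fixes p q : (p < m)%N -> (q < m)%N -> p != q -> fixes_block (block_rot p) q.
Proof. by move=> pm qm pq i i4; rewrite permM !fixes_block_tperm. Qed.

Lemma block_swap_fixes p q r : (p < m)%N -> (q < m)%N -> (r < m)%N -> p != r -> q != r ->
  fixes_block (block_swap p q) r.
Proof. by move=> pm qm rm pr qr i i4; rewrite !permM !fixes_block_tperm. Qed.

Lemma even_block_rot p : (p < m)%N -> ~~ odd_perm (block_rot p).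
Proof. by move=> pm; rewrite odd_permM !odd_tperm !P_neq ?orbT. Qed.

Lemma even_block_swap p q : (p < m)%N -> (q < m)%N -> p != q -> ~~ odd_perm (block_swap p q).
Proof. by move=> pm qm pq; rewrite !odd_permM !odd_tperm !P_neq ?pq. Qed.

Lemma block_rotE p : (p < m)%N -> [/\ block_rot p (P p 0) = P p 0,
  block_rot p (P p 1) = P p 2, block_rot p (P p 2) = P p 3 &
  block_rot p (P p 3) = P p 1].
Proof.
move=> pm; rewrite /block_rot !permM; split.
- by rewrite !tpermD // P_neq ?orbT.
- by rewrite tpermL tpermD // P_neq ?orbT.
- by rewrite tpermR tpermL.
- by rewrite [X in tperm _ _ X]tpermD ?P_neq ?orbT // tpermR.
Qed.

Lemma block_x_rot p : (p < m)%N -> (block_x p ^ block_rot p = block_y p)%g.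
Proof.
move=> pm; have [r0 r1 r2 r3] := block_rotE pm.
by rewrite dtpermJ r0 r1 r2 r3 /block_y /dtperm (tpermC (P p 3)).
Qed.

Lemma block_y_rot p : (p < m)%N -> (block_y p ^ block_rot p = block_x p * block_y p)%g.
Proof.
move=> pm; have [xa xb xc xd] := dtpermE (block_xU pm).
have [ya yb yc yd] := dtpermE (block_yU pm).
have E : (block_y p ^ block_rot p = dtperm (P p 0) (P p 3) (P p 2) (P p 1))%g.
  by have [r0 r1 r2 r3] := block_rotE pm; rewrite dtpermJ r0 r1 r2 r3.
have zU : uniq [:: P p 0; P p 3; P p 2; P p 1].
  by rewrite /= !inE !negb_or !P_neq ?orbT.
have [za zd zc zb] := dtpermE zU.
rewrite E; apply/permP => z; rewrite permM.
have [|zN] := boolP (z \in [:: P p 0; P p 1; P p 2; P p 3]).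
  by rewrite !inE => /or4P[] /eqP ->; rewrite /block_x /block_y
    ?(xa, xb, xc, xd) ?(ya, yb, yc, yd) ?(za, zb, zc, zd).
have zNy : z \notin [:: P p 0; P p 2; P p 1; P p 3].
  by apply: contra zN; rewrite !inE => /or4P[] ->; rewrite ?orbT.
have zNz : z \notin [:: P p 0; P p 3; P p 2; P p 1].
  by apply: contra zN; rewrite !inE => /or4P[] ->; rewrite ?orbT.
by rewrite /block_x /block_y !dtperm_fix.
Qed.

Lemma block_x_swap p q : (p < m)%N -> (q < m)%N -> p != q ->
  (block_x q ^ block_swap p q = block_x p)%g.
Proof.
move=> pm qm pq.
have sE i : (i < 4)%N -> block_swap p q (P q i) = P p i.
  case: i => [|[|[|[|]]]] // _; rewrite /block_swap !permM.
  - by rewrite tpermR !tpermD // P_neq ?orbT.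
  - by rewrite [X in tperm _ _ (tperm _ _ (tperm _ _ X))]tpermD ?P_neq ?orbT // tpermR !tpermD // P_neq ?orbT.
  - rewrite [X in tperm _ _ (tperm _ _ (tperm _ _ X))]tpermD ?P_neq ?orbT //.
    by rewrite [X in tperm _ _ (tperm _ _ X)]tpermD ?P_neq ?orbT // tpermR !tpermD // P_neq ?orbT.
  - rewrite [X in tperm _ _ (tperm _ _ (tperm _ _ X))]tpermD ?P_neq ?orbT //.
    rewrite [X in tperm _ _ (tperm _ _ X)]tpermD ?P_neq ?orbT //.
    by rewrite [X in tperm _ _ X]tpermD ?P_neq ?orbT // tpermR.
by rewrite dtpermJ !sE.
Qed.

Section Family.
Variables (u : {ffun {perm T} -> C}) (sx sy : nat -> bool).
Hypothesis ux : forall p, (p < m)%N -> eigen u (block_x p) (sx p).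
Hypothesis uy : forall p, (p < m)%N -> eigen u (block_y p) (sy p).

(* Moves block [q] to a different character: a nontrivial character is rotated
   inside the block, a trivial one is exchanged with the one of block [z]. *)
Definition block_move z q := if sx q || sy q then block_rot q else block_swap z q.

Lemma even_block_move z q : (z < m)%N -> (q < m)%N -> z != q -> ~~ odd_perm (block_move z q).
Proof.
by move=> zm qm zq; rewrite /block_move; case: ifP => _; [apply: even_block_rot|apply: even_block_swap].
Qed.

Lemma block_move_fixes z q r : (z < m)%N -> (q < m)%N -> (r < m)%N -> z != r -> q != r ->
  fixes_block (block_move z q) r.
Proof.
move=> zm qm rm zr qr; rewrite /block_move; case: ifP => _.
  exact: block_rot_fixes.
exact: block_swap_fixes.
Qed.

(** The involution [e] tests whether block [q] has been moved: its sign is [s] on translates that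
    fix the block, but on a translate by the move it takes the sign of [g], which is opposite. For a
    trivial character the opposite sign is borrowed from block [z]. *)
Lemma block_move_eigen z q : (z < m)%N -> (q < m)%N -> z != q -> sx z ->
  exists (e g : {perm T}) (s : bool),
  [/\ (e ^ block_move z q = g)%g, eigen u e s, eigen u g (~~ s),
    forall t, fixes_block t q -> (e ^ t = e)%g &
    forall t, fixes_block t q -> fixes_block t z -> (g ^ t = g)%g].
Proof.
move=> zm qm zq sz; have := ux qm; have := uy qm; rewrite /block_move.
case sxq: (sx q); case syq: (sy q) => /= uyq uxq.
- exists (block_y q), (block_x q * block_y q)%g, true; split=> //.
  + exact: block_y_rot.
  + exact: (eigenM uxq uyq).
  + by move=> t tq; apply: block_y_conj.
  + by move=> t tq _; rewrite conjMg block_x_conj // block_y_conj.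
- exists (block_x q), (block_y q), true; split=> //.
  + exact: block_x_rot.
  + by move=> t tq; apply: block_x_conj.
  + by move=> t tq _; apply: block_y_conj.
- exists (block_x q), (block_y q), false; split=> //.
  + exact: block_x_rot.
  + by move=> t tq; apply: block_x_conj.
  + by move=> t tq _; apply: block_y_conj.
- exists (block_x q), (block_x z), false; split=> //.
  + exact: block_x_swap.
  + by have := ux zm; rewrite sz.
  + by move=> t tq; apply: block_x_conj.
  + by move=> t _ tz; apply: block_x_conj.
Qed.

Variable k : nat.
Hypothesis mk : m = (2 * k + 2)%N.
Hypothesis sx0 : sx 0%N.
Hypothesis sx1 : sx 1%N.

(** Blocks 0 and 1 serve as separate reservoirs of the sign -1, and the two coordinates act on
    disjoint ranges of blocks. Hence a difference in either coordinate is detected without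
    interference from the other. *)
Definition block_family (a : 'I_k * 'I_k) : {perm T} :=
  (block_move 0 (2 + a.1) * block_move 1 (2 + k + a.2))%g.

Lemma even_block_family a : ~~ odd_perm (block_family a).
Proof.
case: a => i j; have := ltn_ord i; have := ltn_ord j => jk ik.
have h1 : ~~ odd_perm (block_move 0 (2 + i)) by apply: even_block_move; lia.
have h2 : ~~ odd_perm (block_move 1 (2 + k + j)) by apply: even_block_move; lia.
by rewrite odd_permM (negPf h1) (negPf h2).
Qed.

Lemma block_family_orthogonal a b : a != b ->
  \sum_h translate (block_family a) u h * (translate (block_family b) u h)^* = 0.
Proof.
case: a => i j; case: b => i' j'; rewrite xpair_eqE negb_and.
have := ltn_ord i; have := ltn_ord j; have := ltn_ord i'; have := ltn_ord j'.
move=> j'k i'k jk ik.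
have [ii'|ii' /= jj'] := boolP (i != i').
  move=> _; have ii'n : i != i' :> nat by [].
  have [|||e [g [s [eg es gs ef gf]]]] := @block_move_eigen 0 (2 + i) _ _ _ sx0; try lia.
  apply: (@eigen_orthogonal _ _ _ _ e (~~ s) s); last by case: (s).
    apply: eigen_conj; rewrite /block_family /= conjgM eg gf //.
      by apply: block_move_fixes; lia.
    by apply: block_move_fixes; lia.
  apply: eigen_conj; rewrite /block_family /= ef //; apply: fixes_blockM.
    by apply: block_move_fixes; lia.
  by apply: block_move_fixes; lia.
have jj'n : j != j' :> nat by [].
have [|||e [g [s [eg es gs ef gf]]]] := @block_move_eigen 1 (2 + k + j) _ _ _ sx1; try lia.
apply: (@eigen_orthogonal _ _ _ _ e (~~ s) s); last by case: (s).
  apply: eigen_conj; rewrite /block_family /= conjgM ef ?eg //.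
  by apply: block_move_fixes; lia.
apply: eigen_conj; rewrite /block_family /= ef //; apply: fixes_blockM.
  by apply: block_move_fixes; lia.
by apply: block_move_fixes; lia.
Qed.

End Family.
End Blocks.

Lemma exists_blocks (T : finType) m (a b c d a' b' c' d' : T) :
  (4 * m <= #|T|)%N -> (1 < m)%N -> uniq [:: a; b; c; d; a'; b'; c'; d'] ->
  exists P : nat -> nat -> T,
  [/\ forall p q i j, (p < m)%N -> (q < m)%N -> (i < 4)%N -> (j < 4)%N ->
    P p i = P q j -> p = q /\ i = j,
    block_x P 0 = dtperm a b c d & block_x P 1 = dtperm a' b' c' d'].
Proof.
move=> mT m1 U; set s8 := [:: _; _; _; _; _; _; _; _] in U.
pose s := s8 ++ [seq x <- enum T | x \notin s8].
have sU : uniq s.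
  rewrite cat_uniq U filter_uniq ?enum_uniq // andbT.
  by apply/hasPn => x; rewrite mem_filter => /andP[].
have sT : (#|T| <= size s)%N.
  rewrite cardE; apply: uniq_leq_size (enum_uniq _) _ => x _.
  by rewrite mem_cat mem_filter mem_enum; case: (x \in s8).
have lt p i : (p < m)%N -> (i < 4)%N -> (4 * p + i < size s)%N.
  by move=> pm i4; apply: leq_trans sT; apply: leq_trans mT; clear -pm i4; lia.
exists (fun p i => nth a s (4 * p + i)); split=> //.
move=> p q i j pm qm i4 j4 /eqP; rewrite nth_uniq ?lt //.
by clear -i4 j4 => /eqP; lia.
Qed.

(** By [stable_space_eq0] some element of [W] has a nonzero mixed second difference. That difference
    [u0] is negated by the first two [block_x], and refining it to a joint eigenvector keeps these
    two signs, which the family requires. The [2 * k + 2] blocks account for [8 * k + 8] points. *)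
Lemma orthogonal_translates (T : finType) (C : numClosedFieldType) (k : nat)
    (W : {ffun {perm T} -> C} -> Prop) (w : {ffun {perm T} -> C}) :
  (8 * k + 8 <= #|T|)%N -> (16 < #|T|)%N -> stable_space W ->
  (forall w, W w -> zero_on_stabilizers w) -> W w -> w != 0 ->
  exists (u : {ffun {perm T} -> C}) (F : 'I_k * 'I_k -> {perm T}),
  [/\ W u, u != 0, forall a, ~~ odd_perm (F a) &
   forall a b, a != b ->
     \sum_h translate (F a) u h * (translate (F b) u h)^* = 0].
Proof.
move=> kT T16 Wst Wz Ww w0; have [WB Wt] := Wst.
have [a [b [c [d [a' [b' [c' [d' [U [w1 [h0 [Ww1 w1h]]]]]]]]]]]] :
    exists a b c d a' b' c' d' : T, uniq [:: a; b; c; d; a'; b'; c'; d'] /\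
    exists w1 h, W w1 /\
      w1 (h * dtperm a b c d * dtperm a' b' c' d')%g - w1 (h * dtperm a b c d)%g
    - w1 (h * dtperm a' b' c' d')%g + w1 h != 0.
  apply: boolp.contrapT => H; case/eqP: w0.
  apply: (@stable_space_eq0 T C W) => // {Ww} {}w Ww a b c d a' b' c' d' U h.
  apply/eqP/negPn/negP => E; apply: H.
  by exists a, b, c, d, a', b', c', d'; split=> //; exists w, h.
have mT : (4 * (2 * k + 2) <= #|T|)%N by rewrite mulnDr mulnA.
have m1 : (1 < 2 * k + 2)%N by rewrite addn2.
have [P [P_inj x0E x1E]] := exists_blocks mT m1 U.
set m := (2 * k + 2)%N in mT m1 P_inj.
pose u0 := translate (block_x P 0 * block_x P 1) w1 - translate (block_x P 0) w1
  - (translate (block_x P 1) w1 - w1).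
have u0E h : u0 h = w1 (h * block_x P 0 * block_x P 1)%g - w1 (h * block_x P 0)%g
    - w1 (h * block_x P 1)%g + w1 h.
  by rewrite !ffunE mulgA; ring.
have xx p : (p < m)%N -> (block_x P p * block_x P p = 1)%g.
  by move=> pm; apply/dtperm_sq/(block_xU P_inj).
have yy p : (p < m)%N -> (block_y P p * block_y P p = 1)%g.
  by move=> pm; apply/dtperm_sq/(block_yU P_inj).
have m0 : (0 < m)%N by apply: ltn_trans m1.
have x01 : commute (block_x P 0) (block_x P 1).
  by apply: dtperm_comm; split; apply: (block_x_fixes P_inj).
have ux0 : eigen u0 (block_x P 0) true.
  move=> h; rewrite !u0E -(mulgA h (block_x P 0) (block_x P 0)) xx // mulg1.
  by rewrite expr1; ring.
have ux1 : eigen u0 (block_x P 1) true.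
  move=> h; rewrite !u0E -(mulgA h (block_x P 1) (block_x P 0)) -x01.
  rewrite (mulgA h) -(mulgA _ (block_x P 1) (block_x P 1)) xx // mulg1.
  by rewrite -(mulgA h (block_x P 1) (block_x P 1)) xx // mulg1 expr1; ring.
have Wu0 : W u0.
  apply: (WB); apply: (WB) => //; apply: (Wt) => //; first rewrite odd_permM.
  - by rewrite (negPf (even_block_x P_inj _)) ?(negPf (even_block_x P_inj _)).
  - exact: (even_block_x P_inj).
  - exact: (even_block_x P_inj).
have u00 : u0 != 0.
  by apply: contraNneq w1h => /ffunP/(_ h0); rewrite u0E x0E x1E ffunE => ->.
pose L := [seq block_x P p | p <- iota 0 m] ++ [seq block_y P p | p <- iota 0 m].
have LP g : g \in L -> exists2 p, (p < m)%N & g = block_x P p \/ g = block_y P p.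
  rewrite mem_cat => /orP[] /mapP[p]; rewrite mem_iota add0n => pm ->; exists p => //.
    by left.
  by right.
have Lc e g : e \in L -> g \in L -> commute e g.
  move=> /LP[p pm ep] /LP[q qm gq].
  have [pq|pq] := eqVneq p q.
    move: gq; rewrite -pq => gq.
    have [xa xb xc xd] := dtpermE (block_xU P_inj pm).
    have xyC : commute (block_x P p) (block_y P p).
      apply/commgP/conjg_fixP; rewrite dtpermJ.
      have [ya yb yc yd] := dtpermE (block_yU P_inj pm).
      rewrite ya yb yc yd; apply/commgP/conjg_fixP.
      by rewrite tpermJ !tpermD // (P_neq P_inj) // orbT.
    by case: ep gq => -> [] ->.
  by case: ep gq => -> [] ->; apply: dtperm_comm; split;
    (apply: (block_x_fixes P_inj) || apply: (block_y_fixes P_inj)); rewrite // eq_sym.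
have xL p : (p < m)%N -> block_x P p \in L.
  by move=> pm; rewrite mem_cat map_f ?mem_iota.
have yL p : (p < m)%N -> block_y P p \in L.
  by move=> pm; rewrite mem_cat [_ \in map (block_y P) _]map_f ?mem_iota ?orbT.
have [|||u [Wu un0 uL uG]] := @simultaneous_eigen T C W L [:: block_x P 0; block_x P 1] u0 Wst Wu0 u00.
- by move=> g /LP[p pm [] ->]; split; rewrite ?xx ?yy ?(even_block_x P_inj) ?(even_block_y P_inj).
- move=> e g eL; rewrite mem_cat !inE => /or3P[gL|/eqP->|/eqP->]; apply: Lc => //; exact: xL.
- by move=> g; rewrite !inE => /orP[] /eqP ->; exists true.
pose sg g := [forall h, u (h * g)%g == - u h].
have sgP g : g \in L -> eigen u g (sg g).
  move=> gL; have [|s us] := uL g; first by rewrite mem_cat gL.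
  rewrite /sg; case: (boolP [forall h, _]) => [/forallP H|nH] h.
    by rewrite expr1 mulN1r; apply/eqP.
  case: s us => us; last exact: us.
  case/forallP: nH => h'; by rewrite us expr1 mulN1r.
exists u, (block_family P (fun p => sg (block_x P p)) (fun p => sg (block_y P p)) (k := k)).
have sgx p : (p < m)%N -> eigen u (block_x P p) (sg (block_x P p)) by move/xL/sgP.
have sgy p : (p < m)%N -> eigen u (block_y P p) (sg (block_y P p)) by move/yL/sgP.
have sgt g : eigen u g true -> sg g.
  by move=> ug; apply/forallP => h; rewrite ug expr1 mulN1r.
have s0 : sg (block_x P 0) by apply: sgt; apply: uG => //; rewrite inE eqxx.
have s1 : sg (block_x P 1) by apply: sgt; apply: uG => //; rewrite !inE eqxx orbT.
split=> //; first by move=> a1; apply: (even_block_family P_inj).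
by move=> a1 b1; apply: (block_family_orthogonal P_inj).
Qed.

(** * Mixing *)

Section Counting.
Variable T : finType.
Implicit Types (i j k l : T) (g s t : {perm T}).

Lemma exists_even_perm1 j k : (3 < #|T|)%N ->
  exists2 t : {perm T}, ~~ odd_perm t & t j = k.
Proof.
move=> T3; have [->|jk] := eqVneq j k; first by exists 1%g; rewrite ?odd_perm1 ?perm1.
have [|a [b [_ _ ab aN bN]]] := @exists_two_notin _ [set: T] [:: j; k].
  by rewrite cardsT.
exists (dtperm j k a b); first by rewrite even_dtperm.
move: aN bN; rewrite !inE !negb_or => /andP[aj ak] /andP[bj bk].
by rewrite permM tpermL tpermD.
Qed.

Lemma exists_even_perm2 i k l : (4 < #|T|)%N -> k != i -> l != i ->
  exists t : {perm T}, [/\ ~~ odd_perm t, t i = i & t k = l].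
Proof.
move=> T4 ki li; have [->|kl] := eqVneq k l.
  by exists 1%g; rewrite odd_perm1 !perm1.
have [|a [b [_ _ ab aN bN]]] := @exists_two_notin _ [set: T] [:: i; k; l].
  by rewrite cardsT.
move: aN bN; rewrite !inE !negb_or => /and3P[ai ak al] /and3P[bi bk bl].
exists (dtperm k l a b); split; first by rewrite even_dtperm.
  by rewrite permM !tpermD.
by rewrite permM tpermL tpermD.
Qed.

Lemma card_even_perm1 i j : (3 < #|T|)%N ->
  (#|[set g : {perm T} | ~~ odd_perm g & g i == j]| * #|T| = #|('Alt_T)%g|)%N.
Proof.
move=> T3.
have E j' : #|[set g : {perm T} | ~~ odd_perm g & g i == j]| =
    #|[set g : {perm T} | ~~ odd_perm g & g i == j']|.
  have [t t_even tj] := exists_even_perm1 j' j T3.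
  rewrite -!sum1dep_card (reindex_inj (mulIg t)); apply: eq_bigl => g.
  by rewrite odd_permM (negPf t_even) addbF permM (perm_eq_preim _ tj).
rewrite mulnC -sum_nat_const (eq_bigr _ (fun j' _ => E j')).
rewrite -sum1_card (partition_big (fun g : {perm T} => g i) predT) //=.
apply: eq_bigr => j' _; rewrite -sum1dep_card; apply: eq_bigl => g.
by rewrite Alt_even.
Qed.

Lemma card_even_perm2 i j k l : (4 < #|T|)%N -> i != k -> j != l ->
  (#|[set g : {perm T} | [&& ~~ odd_perm g, g i == j & g k == l]]| * (#|T| * #|T|.-1)
    = #|('Alt_T)%g|)%N.
Proof.
move=> T4 ik jl; rewrite mulnCA -(card_even_perm1 i j (ltnW T4)) mulnC; congr (_ * _)%N.
have E l' : l' != j -> #|[set g : {perm T} | [&& ~~ odd_perm g, g i == j & g k == l]]| =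
    #|[set g : {perm T} | [&& ~~ odd_perm g, g i == j & g k == l']]|.
  move=> l'j; rewrite eq_sym in jl.
  have [t [t_even tj tl]] := exists_even_perm2 T4 l'j jl.
  rewrite -!sum1dep_card (reindex_inj (mulIg t)); apply: eq_bigl => g.
  rewrite odd_permM (negPf t_even) addbF !(permM g).
  by rewrite (perm_eq_preim _ tj) (perm_eq_preim _ tl).
rewrite mulnC -(cardC1 j) -sum_nat_const (eq_bigr _ (fun l' l'j => E l' l'j)).
rewrite -sum1dep_card (partition_big (fun g : {perm T} => g k) (predC1 j)) /=; last first.
  move=> g /andP[_ /eqP gi]; rewrite -gi; apply: contraNneq ik.
  by move/perm_inj ->.
apply: eq_bigr => l' _; rewrite -sum1dep_card; apply: eq_bigl => g.
by rewrite andbA.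
Qed.

End Counting.

Lemma sum_natr_bool (R : pzSemiRingType) (I : finType) (A B : pred I) :
  \sum_(i | A i) (B i)%:R = #|[set i | A i & B i]|%:R :> R.
Proof.
rewrite -sum1dep_card natr_sum big_mkcondr; apply: eq_bigr => i _.
by case: (B i).
Qed.

(** * Projection away from the trivial and the standard representation *)

Section Mixing.
Variables (n : nat) (C : numClosedFieldType).
Hypothesis n_gt16 : (16 < n)%N.
Local Notation T := 'I_n.
Local Notation N := #|('Alt_T)%g|.
Implicit Types (i j k l : T) (g s t h b c d e : {perm T}).

Definition nfix g : nat := \sum_(i : T) (g i == i).

(* Kernel of the projection that removes the trivial and the standard representation of
   A_n: [1 + (n - 1) * (nfix g - 1) = (n - 1) * nfix g - (n - 2)]. *)
Definition proj_kernel g : C :=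
  (g == 1%g)%:R - (~~ odd_perm g)%:R * ((n%:R - 1) * (nfix g)%:R - (n%:R - 2)) / N%:R.

Lemma Alt_gt0 : (0 < N)%N.
Proof. by apply/card_gt0P; exists 1%g; apply: group1. Qed.

Lemma N_neq0 : (N%:R : C) != 0.
Proof. by rewrite pnatr_eq0 -lt0n Alt_gt0. Qed.

Lemma n_neq0 : (n%:R : C) != 0.
Proof. by rewrite pnatr_eq0 -lt0n (leq_trans _ n_gt16). Qed.

Lemma n1_neq0 : (n%:R - 1 : C) != 0.
Proof. by rewrite subr_eq0 (eqr_nat _ n 1); move: n_gt16; case: n => [|[]]. Qed.

Lemma card_even1E i j :
  (#|[set g : {perm T} | ~~ odd_perm g & g i == j]|%:R : C) = N%:R / n%:R.
Proof.
have n3 : (3 < #|T|)%N by rewrite card_ord; apply: leq_trans n_gt16.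
rewrite -(card_even_perm1 i j n3) card_ord natrM mulfK //; exact: n_neq0.
Qed.

Lemma card_even2E i j k l : i != k -> j != l ->
  (#|[set g : {perm T} | [&& ~~ odd_perm g, g i == j & g k == l]]|%:R : C)
   = N%:R / (n%:R * (n%:R - 1)).
Proof.
move=> ik jl; have n4 : (4 < #|T|)%N by rewrite card_ord; apply: leq_trans n_gt16.
rewrite -(card_even_perm2 n4 ik jl) card_ord natrM -subn1 natrM natrB; last exact: leq_trans n_gt16.
by rewrite mulfK // mulf_neq0 ?n_neq0 ?n1_neq0.
Qed.

(** Linearity over the even [g] with [g i = l]: if [i = l], this point counts fully and each other
    point is fixed with frequency [1 / (n - 1)]; otherwise only the [n - 2] points different from
    [i] and [l] can be fixed. *)
Lemma sum_nfix i l : \sum_(g : {perm T} | ~~ odd_perm g && (g i == l)) (nfix g)%:R =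
  N%:R / n%:R * (if i == l then 2 else (n%:R - 2) / (n%:R - 1)) :> C.
Proof.
under eq_bigr do rewrite natr_sum.
rewrite exchange_big /=.
have E k : \sum_(g : {perm T} | ~~ odd_perm g && (g i == l)) (g k == k)%:R =
   #|[set g : {perm T} | [&& ~~ odd_perm g, g i == l & g k == k]]|%:R :> C.
  by rewrite sum_natr_bool; congr (_%:R); apply: eq_card => g; rewrite !inE andbA.
rewrite (eq_bigr _ (fun k _ => E k)) (bigD1 i) //=.
have n0 := n_neq0; have n1 := n1_neq0.
have cardi : (\sum_(k | k != i) (1 : C)) = n%:R - 1.
  rewrite sumr_const cardC1 card_ord -subn1 natrB //; exact: leq_trans n_gt16.
case: eqVneq => [<-|il].
  rewrite (_ : [set g : {perm T} | _] = [set g : {perm T} | ~~ odd_perm g & g i == i]); last first.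
    by apply/setP => g; rewrite !inE andbb.
  rewrite card_even1E (eq_bigr (fun=> N%:R / (n%:R * (n%:R - 1)) * 1)); last first.
    by move=> k ki; rewrite mulr1 card_even2E // eq_sym.
  by rewrite -mulr_sumr cardi; field; rewrite n0 n1.
rewrite (_ : [set g : {perm T} | _] = set0) ?cards0 ?add0r; last first.
  apply/setP => g; rewrite !inE; apply/negP => /and3P[_ /eqP -> /eqP]; apply/eqP.
  by rewrite eq_sym.
rewrite (bigD1 l) 1?eq_sym //=.
rewrite (_ : [set g : {perm T} | _] = set0) ?cards0 ?add0r; last first.
  apply/setP => g; rewrite !inE; apply/negP => /and3P[_ /eqP gi /eqP gl].
  by case/eqP: il; apply: (@perm_inj _ g); rewrite gi gl.
rewrite (eq_bigr (fun=> N%:R / (n%:R * (n%:R - 1)) * 1)); last first.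
  by move=> k /andP[ki kl]; rewrite mulr1 card_even2E // eq_sym.
rewrite -mulr_sumr.
have -> : \sum_(k | (k != i) && (k != l)) (1 : C) = n%:R - 2.
  move: cardi; rewrite (bigD1 l) 1?eq_sym //= => E1.
  by apply: (addrI 1); rewrite E1; ring.
by field; rewrite n0 n1.
Qed.

Lemma sum_proj_kernel i l : \sum_(g : {perm T} | g i == l) proj_kernel g = 0.
Proof.
rewrite sumrB.
have -> : \sum_(g : {perm T} | g i == l) (g == 1%g)%:R = (i == l)%:R :> C.
  rewrite sum_natr_bool; congr (_%:R).
  case: eqVneq => [<-|il].
    rewrite -[RHS]/1%N -(cards1 (1%g : {perm T})); apply: eq_card => g; rewrite !inE.
    by case: (g =P 1%g) => [->|]; rewrite ?perm1 ?eqxx ?andbF.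
  rewrite -[RHS]/0%N; apply/eqP; rewrite cards_eq0; apply/eqP/setP => g; rewrite !inE.
  by apply/negP => /andP[/eqP gi /eqP g1]; move: il; rewrite -gi g1 perm1 eqxx.
have n0 := n_neq0; have n1 := n1_neq0; have N0 := N_neq0.
rewrite -mulr_suml.
rewrite (eq_bigr (fun g => if ~~ odd_perm g then (n%:R - 1) * (nfix g)%:R - (n%:R - 2) * 1 else 0));
  last by move=> g _; case: odd_perm; rewrite /= ?mul0r // mul1r mulr1.
rewrite -big_mkcondr /= (eq_bigl (fun g => ~~ odd_perm g && (g i == l))); last first.
  by move=> g; rewrite andbC.
rewrite sumrB -!mulr_sumr sum_nfix sumr_const.
have := card_even1E i l; rewrite cardsE => ->.
by case: eqP => _ /=; field; rewrite ?n0 ?n1 ?N0.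
Qed.

End Mixing.

Section MixingOperator.
Variables (n : nat) (C : numClosedFieldType) (A1 : {set 'S_n}).
Hypothesis n_gt16 : (16 < n)%N.
Local Notation T := 'I_n.
Local Notation N := #|('Alt_T)%g|.
Implicit Types (i j k l : T) (g s t h b c d e : {perm T}).
Local Notation pk := (@proj_kernel n C).

Lemma proj_kernel_odd g : odd_perm g -> pk g = 0.
Proof.
move=> g_odd; rewrite /proj_kernel g_odd mul0r mul0r subr0.
by case: eqP g_odd => // ->; rewrite odd_perm1.
Qed.

(** The matrix of left multiplication, [d = a * e] with [a] in [A1]; [mix_kernel] composes it with
    the projection. The group acts on the left here so that right translations commute with the
    operator and preserve its eigenspaces. *)
Definition mul_kernel e d : C := (d * e^-1 \in A1)%g%:R.
Definition mix_kernel b d : C := \sum_e pk (b * e^-1)%g * mul_kernel e d.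

Lemma mix_kernel_translate s b d : mix_kernel (b * s)%g d = mix_kernel b (d * s^-1)%g.
Proof.
rewrite /mix_kernel (reindex_inj (mulIg s)); apply: eq_bigr => e _.
by rewrite /mul_kernel !invMg !mulgA mulgK.
Qed.

Lemma mix_kernel_real b d : (mix_kernel b d)^* = mix_kernel b d.
Proof.
rewrite rmorph_sum; apply: eq_bigr => e _; rewrite rmorphM /= rmorph_nat; congr (_ * _).
rewrite /proj_kernel rmorphB !rmorphM /= fmorphV !rmorph_nat rmorphB rmorphM !rmorphB /=.
by rewrite !rmorph1 !rmorph_nat.
Qed.

Lemma sum_mix_kernel h j d :
  \sum_(g : {perm T} | ~~ odd_perm g && (g j == j)) mix_kernel (h * g)%g d = 0.
Proof.
rewrite exchange_big big1 //= => e _; rewrite -mulr_suml.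
suff -> : \sum_(g : {perm T} | ~~ odd_perm g && (g j == j)) pk (h * g * e^-1)%g = 0.
  by rewrite mul0r.
rewrite (reindex_inj (mulIg e)) (reindex_inj (mulgI h^-1%g)) /=.
under eq_bigr do rewrite mulgA mulgK mulKVg.
have cond g : (h^-1 * g * e)%g j == j = (g ((h^-1)%g j) == (e^-1)%g j).
  by rewrite !permM -{2}(permKV e j) (inj_eq perm_inj).
have odd g : odd_perm (h^-1 * g * e)%g = odd_perm (h * e)%g (+) odd_perm g.
  by rewrite !odd_permM odd_permV; do 3!case: odd_perm.
under eq_bigl do rewrite odd cond.
case he: (odd_perm (h * e)%g) => /=.
  by rewrite big1 // => g /andP[/negPn g_odd _]; rewrite proj_kernel_odd // -[odd_perm g]negbK.
rewrite -[RHS](sum_proj_kernel C n_gt16 ((h^-1)%g j) ((e^-1)%g j)).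
rewrite [LHS]big_mkcond [RHS]big_mkcond /=; apply: eq_bigr => g _.
by case g_odd: (odd_perm g); rewrite //= proj_kernel_odd //; case: ifP.
Qed.

(** Only the term at 1 survives: both the [nfix] term and the constant term expand into sums of [w]
    over cosets of stabilizers. The kernel is a class function, which allows [c] to be conjugated
    away. *)
Lemma proj_kernel_id (w : {ffun {perm T} -> C}) c : zero_on_stabilizers w ->
  \sum_b w b * pk (b * c^-1)%g = w c.
Proof.
move=> wz.
have n3 : (3 < #|T|)%N by rewrite card_ord; apply: leq_trans n_gt16.
have j0 : T by exists 0%N; apply: leq_trans n_gt16.
rewrite (reindex_inj (mulgI c)) /=.
have sum_even : \sum_(g : {perm T} | ~~ odd_perm g) w (c * g)%g = 0.
  rewrite (partition_big (fun g : {perm T} => g j0) predT) //= big1 // => k _.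
  have [t t_even tj] := exists_even_perm1 j0 k n3.
  rewrite -[RHS](wz (c * t)%g k) (reindex_inj (mulgI t)) /=.
  apply: eq_big => [g|g _]; last by rewrite mulgA.
  by rewrite odd_permM (negPf t_even) permM tj.
have sum_fix : \sum_(g : {perm T} | ~~ odd_perm g) w (c * g)%g * (nfix g)%:R = 0.
  under eq_bigr do rewrite natr_sum mulr_sumr.
  rewrite exchange_big big1 //= => j _.
  rewrite -[RHS](wz c j) big_mkcondr /=; apply: eq_bigr => g _.
  by case: (g j == j); rewrite ?mulr1 ?mulr0.
have nfixJ g : nfix (c * g * c^-1)%g = nfix g.
  rewrite /nfix (reindex_inj (@perm_inj _ c^-1%g)) /=; apply: eq_bigr => i _.
  by rewrite !permM permKV (inj_eq perm_inj).
have pkJ g : pk (c * g * c^-1)%g = pk g.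
  rewrite /proj_kernel nfixJ !odd_permM odd_permV addbC addbA addbb addFb.
  suff -> : (c * g * c^-1 == 1)%g = (g == 1%g) by [].
  apply/eqP/eqP => [E|->]; last by rewrite mulg1 mulgV.
  by apply: (mulgI c); apply: (mulIg c^-1%g); rewrite E mulg1 mulgV.
under eq_bigr do rewrite pkJ /proj_kernel mulrBr.
rewrite sumrB (bigD1 1%g) //= eqxx mulg1 mulr1 big1 ?addr0; last first.
  by move=> g /negPf ->; rewrite mulr0.
rewrite (eq_bigr (fun g => if ~~ odd_perm g then
  (w (c * g)%g * (nfix g)%:R * ((n%:R - 1) / N%:R) - w (c * g)%g * ((n%:R - 2) / N%:R)) else 0)).
  by rewrite -big_mkcond sumrB -!mulr_suml sum_fix sum_even !mul0r !subr0.
by move=> g _; case: odd_perm; rewrite /= ?mul0r ?mulr0 // mul1r; ring.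
Qed.

End MixingOperator.

Section MixingBound.
Variables (n : nat) (C : numClosedFieldType) (A1 : {set 'S_n}) (k : nat).
Hypothesis n_gt16 : (16 < n)%N.
Hypothesis kn : (8 * k + 8 <= n)%N.
Local Notation T := 'I_n.
Local Notation X := (@mix_kernel n C A1).
Local Notation mk := (@mul_kernel n C A1).

Lemma sum_mul_kernel : \sum_(d : {perm T}) \sum_(e : {perm T}) `|mk e d| ^+ 2
  = (#|{perm T}| * #|A1|)%:R.
Proof.
rewrite natrM mulr_natl -sumr_const; apply: eq_bigr => d _.
rewrite (eq_bigr (fun e => (d * e^-1 \in A1)%g%:R)); last first.
  by move=> e _; rewrite /mul_kernel; case: (_ \in _); rewrite ?normr1 ?normr0 ?expr1n ?expr0n.
have inj : injective (fun a : {perm T} => (a^-1 * d)%g) by move=> a b /mulIg/invg_inj.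
rewrite (reindex_inj inj) /= (sum_natr_bool C predT); congr (_%:R).
by apply: eq_card => a; rewrite !inE invMg invgK mulKVg.
Qed.

Lemma mix_kernel_norm : exists l : C,
  [/\ 0 <= l, forall u : {perm T} -> C,
    \sum_d `|\sum_b u b * X b d| ^+ 2 <= l * \sum_b `|u b| ^+ 2 &
  l * (k ^ 2)%:R <= (#|{perm T}| * #|A1|)%:R].
Proof.
have [l [w [[h0 wh0] wl lmax]]] := top_eigenvector (1%g : {perm T}) X.
exists l.
have normX (u : {perm T} -> C) : \sum_d `|\sum_b u b * X b d| ^+ 2 =
   \sum_c (\sum_b u b * (\sum_d X b d * (X c d)^*)) * (u c)^*.
  under eq_bigr do rewrite normCK rmorph_sum /= mulr_suml.
  rewrite exchange_big /=.
  under [RHS]eq_bigr do rewrite mulr_suml.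
  rewrite [RHS]exchange_big /=; apply: eq_bigr => b _.
  under eq_bigr do rewrite mulr_sumr.
  rewrite exchange_big; apply: eq_bigr => c _ /=.
  rewrite mulr_sumr mulr_suml; apply: eq_bigr => d _.
  by rewrite rmorphM; ring.
have eigX (u : {perm T} -> C) : (forall c, \sum_b u b * (\sum_d X b d * (X c d)^*) = l * u c) ->
    \sum_d `|\sum_b u b * X b d| ^+ 2 = l * \sum_c `|u c| ^+ 2.
  move=> ul; rewrite normX mulr_sumr; apply: eq_bigr => c _.
  by rewrite ul normCK mulrA.
have sq_gt0 (u : {perm T} -> C) h : u h != 0 -> 0 < \sum_c `|u c| ^+ 2.
  move=> uh; rewrite (bigD1 h) //= ltr_wpDr ?exprn_gt0 ?normr_gt0 //.
  by apply: sumr_ge0 => c _; apply: exprn_ge0.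
have l_ge0 : 0 <= l.
  rewrite -(pmulr_lge0 _ (sq_gt0 w h0 wh0)) -eigX //.
  by apply: sumr_ge0 => c _; apply: exprn_ge0.
split=> //.
have [->|l0] := eqVneq l 0; first by rewrite mul0r ler0n.
pose W (v : {ffun {perm T} -> C}) := forall c,
  \sum_b v b * (\sum_d X b d * (X c d)^*) = l * v c.
have Wst : stable_space W.
  split=> [u v Wu Wv c|s u s_even Wu c].
    rewrite !ffunE mulrBr -Wu -Wv -sumrB; apply: eq_bigr => b _.
    by rewrite !ffunE mulrBl.
  rewrite ffunE -Wu (reindex_inj (mulIg s^-1%g)) /=; apply: eq_bigr => b _.
  rewrite ffunE mulgKV; congr (_ * _).
  rewrite (reindex_inj (mulIg s^-1%g)) /=; apply: eq_bigr => d _.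
  by rewrite !mix_kernel_translate invgK mulgKV.
(* For [l != 0] an eigenvector is a combination of columns of [X], which have vanishing stabilizer
   sums. *)
have Wz v : W v -> zero_on_stabilizers v.
  move=> Wv h j; apply: (mulfI l0); rewrite mulr0 mulr_sumr.
  under eq_bigr do rewrite -Wv.
  rewrite exchange_big big1 //= => b _.
  rewrite -mulr_sumr exchange_big /= [X in _ * X]big1 ?mulr0 // => d _.
  by rewrite -mulr_sumr -rmorph_sum /= sum_mix_kernel // rmorph0 mulr0.
have Ww : W [ffun b => w b].
  by move=> c; rewrite ffunE -wl; apply: eq_bigr => b _; rewrite ffunE.
have w0 : [ffun b => w b] != 0.
  by apply: contraNneq wh0 => /ffunP/(_ h0); rewrite !ffunE => ->.
have [||u [F [Wu u0 Feven Forth]]] := @orthogonal_translates T C k W _ _ _ Wst Wz Ww w0;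
  rewrite ?card_ord //.
pose nu := \sum_c `|u c| ^+ 2.
have nu_gt0 : 0 < nu.
  have [h uh] : exists h, u h != 0.
    apply/existsP; apply: contraNT u0; rewrite negb_exists => /forallP uz.
    by apply/eqP/ffunP => h; rewrite ffunE; apply/eqP/negPn.
  exact: sq_gt0 uh.
pose v a := translate (F a) u.
have vnu a : \sum_c `|v a c| ^+ 2 = nu.
  by rewrite /nu [RHS](reindex_inj (mulIg (F a))); apply: eq_bigr => c _; rewrite ffunE.
have vorth a b : \sum_i v a i * (v b i)^* = nu *+ (a == b).
  case: eqVneq => [->|ab]; last exact: Forth.
  by rewrite mulr1n -(vnu b); apply: eq_bigr => c _; rewrite normCK.
have Wv a : W (v a) by apply: (proj2 Wst).
have vX a d : \sum_b v a b * X b d = \sum_e v a e * mk e d.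
  under eq_bigr do rewrite mulr_sumr.
  rewrite exchange_big /=; apply: eq_bigr => e _.
  under eq_bigr do rewrite mulrA.
  by rewrite -mulr_suml proj_kernel_id //; apply: Wz.
rewrite -(ler_pM2r nu_gt0).
have -> : l * (k ^ 2)%:R * nu = \sum_a \sum_d `|\sum_b v a b * X b d| ^+ 2.
  rewrite (eq_bigr (fun=> l * nu)); last by move=> a _; rewrite eigX ?vnu //; apply: Wv.
  by rewrite sumr_const card_prod card_ord mulnn -[RHS]mulr_natr mulrAC.
rewrite exchange_big /= -sum_mul_kernel mulr_suml; apply: ler_sum => d _.
under eq_bigr do rewrite vX.
by rewrite mulrC; apply: bessel.
Qed.

End MixingBound.

(** * The mixing inequality in terms of hit counts *)

Definition hits n (A : {set 'S_n}) (i j : 'I_n) : nat := #|[set p in A | p i == j]|.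

Lemma hitsE (R : pzSemiRingType) n (A : {set 'S_n}) i j :
  (hits A i j)%:R = \sum_(p in A) (p i == j)%:R :> R.
Proof. by rewrite sum_natr_bool; congr (_%:R); apply: eq_card => p; rewrite !inE. Qed.

(** The fixed points of [b * d^-1 * a] are the [a i] with [b (a i) = d i]; the triple sum classifies
    them by [j = a i] and [k = d i]. *)
Lemma sum_nfix_hits (R : comPzRingType) n (A1 A2 A3 : {set 'S_n}) :
  \sum_(a in A1) \sum_(b in A2) \sum_(d in A3) (nfix (b * d^-1 * a)%g)%:R =
  \sum_i \sum_j \sum_k (hits A1 i j)%:R * (hits A2 j k)%:R * (hits A3 i k)%:R :> R.
Proof.
have sumE (F : 'S_n -> 'I_n -> R) (A : {set 'S_n}) : \sum_(p in A) \sum_i F p i = \sum_i \sum_(p in A) F p i.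
  exact: exchange_big.
have E a b d : (nfix (b * d^-1 * a)%g)%:R =
    \sum_i \sum_j \sum_k (a i == j)%:R * (b j == k)%:R * (d i == k)%:R :> R.
  rewrite natr_sum (reindex_inj (@perm_inj _ a)) /=; apply: eq_bigr => l _.
  rewrite (bigD1 (a l)) //= [X in _ + X]big1 ?addr0 => [|j jal]; last first.
    by rewrite big1 // => k _; rewrite eq_sym (negPf jal) !mul0r.
  rewrite (bigD1 (b (a l))) //= [X in _ + X]big1 ?addr0 => [|k kb]; last first.
    by rewrite [b _ == k]eq_sym (negPf kb) mulr0 mul0r.
  rewrite !eqxx !mul1r; congr (_%:R); rewrite !permM (inj_eq perm_inj).
  by rewrite -(inj_eq (@perm_inj _ d)) permKV eq_sym.
under eq_bigr do under eq_bigr do under eq_bigr do rewrite E.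
under eq_bigr do under eq_bigr do rewrite sumE.
under eq_bigr do rewrite sumE.
rewrite sumE; apply: eq_bigr => i _.
under eq_bigr do under eq_bigr do rewrite sumE.
under eq_bigr do rewrite sumE.
rewrite sumE; apply: eq_bigr => j _.
under eq_bigr do under eq_bigr do rewrite sumE.
under eq_bigr do rewrite sumE.
rewrite sumE; apply: eq_bigr => k _.
rewrite !hitsE mulr_suml mulr_suml; apply: eq_bigr => a _.
rewrite -mulrA mulr_suml mulr_sumr; apply: eq_bigr => b _.
by rewrite !mulr_sumr; apply: eq_bigr => d _; rewrite mulrA.
Qed.

(** The inequality is put in integers to carry it from [algC], where the spectral argument takes
    place, to the real field used later. Since no product [a * b] lies in [A3], the delta at 1 in
    the projection kernel never contributes, and [F] reduces to fixed-point counts. *)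
Lemma mixing_int n k (A1 A2 A3 : {set 'S_n}) : (16 < n)%N -> (8 * k + 8 <= n)%N ->
  A1 \subset ('Alt_('I_n))%g -> A2 \subset ('Alt_('I_n))%g -> A3 \subset ('Alt_('I_n))%g ->
  (forall a b, a \in A1 -> b \in A2 -> (a * b)%g \notin A3) ->
  ((n%:Z - 1) * (\sum_i \sum_j \sum_k (hits A1 i j)%:Z * (hits A2 j k)%:Z * (hits A3 i k)%:Z)
    - (n%:Z - 2) * (#|A1| * #|A2| * #|A3|)%:Z) ^+ 2 * (k ^ 2)%:Z
  <= (#|('Alt_('I_n))%g| ^ 2 * (#|{perm 'I_n}| * #|A1| * #|A2| * #|A3|))%:Z.
Proof.
move=> n16 kn A1s A2s A3s A123.
rewrite -(ler_int algC); set Z := (X in X ^+ 2).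
have [l [l0 lmax lk]] := @mix_kernel_norm n algC A1 k n16 kn.
pose X := @mix_kernel n algC A1.
pose F := \sum_(d in A3) \sum_(b in A2) X b d.
have N0 := @N_neq0 n algC.
have ZF : Z%:~R = - (#|('Alt_('I_n))%g|%:R * F).
  have Alt_even' (A : {set 'S_n}) p : A \subset ('Alt_('I_n))%g -> p \in A -> ~~ odd_perm p.
    by move=> /subsetP AA /AA; rewrite Alt_even.
  have FE : F = \sum_(a in A1) \sum_(b in A2) \sum_(d in A3)
      - (((n%:R - 1) * (nfix (b * d^-1 * a)%g)%:R - (n%:R - 2)) / #|('Alt_('I_n))%g|%:R).
    rewrite /F [RHS]exchange_big /=; under [RHS]eq_bigr do rewrite exchange_big /=.
    rewrite [LHS]exchange_big; apply: eq_bigr => b bA /=; apply: eq_bigr => d dA.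
    have inj : injective (fun a : 'S_n => (a^-1 * d)%g) by move=> x y /mulIg/invg_inj.
    rewrite /X /mix_kernel (reindex_inj inj) /= [RHS]big_mkcond /=; apply: eq_bigr => a _.
    rewrite /mul_kernel invMg invgK mulKVg mulgA; case: ifP => aA; last by rewrite mulr0.
    rewrite mulr1 /proj_kernel !odd_permM odd_permV.
    rewrite (negPf (Alt_even' _ _ A2s bA)) (negPf (Alt_even' _ _ A3s dA)) (negPf (Alt_even' _ _ A1s aA)) mul1r.
    suff -> : ((b * d^-1 * a)%g == 1%g) = false by rewrite sub0r.
    apply/eqP => E; have := A123 a b aA bA; suff -> : (a * b)%g = d by rewrite dA.
    apply: (mulIg d^-1%g); apply: (mulgI a^-1%g); rewrite mulgV mulg1 -!mulgA mulKg.
    by apply: (mulIg a); rewrite E mulVg.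
  rewrite FE.
  have -> : \sum_(a in A1) \sum_(b in A2) \sum_(d in A3)
      - (((n%:R - 1) * (nfix (b * d^-1 * a)%g)%:R - (n%:R - 2)) / #|('Alt_('I_n))%g|%:R)
    = - (((n%:R - 1) * (\sum_(a in A1) \sum_(b in A2) \sum_(d in A3) (nfix (b * d^-1 * a)%g)%:R)
       - (n%:R - 2) * (#|A1| * #|A2| * #|A3|)%:R) / #|('Alt_('I_n))%g|%:R) :> algC.
    have -> : (#|A1| * #|A2| * #|A3|)%:R = \sum_(a in A1) \sum_(b in A2) \sum_(d in A3) 1 :> algC.
      by rewrite !sumr_const -!mulrnA mulnC (mulnC #|A1|) mulnA.
    rewrite !mulr_sumr -sumrB mulr_suml -sumrN; apply: eq_bigr => a _.
    rewrite !mulr_sumr -sumrB mulr_suml -sumrN; apply: eq_bigr => b _.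
    rewrite !mulr_sumr -sumrB mulr_suml -sumrN; apply: eq_bigr => d _.
    by rewrite mulr1.
  rewrite sum_nfix_hits mulrN opprK mulrCA divff // mulr1 /Z.
  rewrite rmorphB !rmorphM !rmorphB /= !rmorph1; congr (_ * _ - _ * _).
  do 3 (rewrite rmorph_sum; apply: eq_bigr => ? _).
  by rewrite !rmorphM.
have FX : `|F| ^+ 2 <= #|A3|%:R * (l * #|A2|%:R).
  have [A30|A30] := posnP #|A3|.
    by rewrite /F A30 mul0r big_pred0 ?normr0 ?expr0n //= => d; rewrite (cards0_eq A30) inE.
  pose u (b : 'S_n) : algC := (b \in A2)%:R.
  (* For a family indexed by [unit], Bessel's inequality is the Cauchy-Schwarz inequality. *)
  have := @bessel algC {perm 'I_n} unit (fun _ d => (d \in A3)%:R) #|A3|%:R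
    (fun d => \sum_b u b * X b d).
  rewrite ltr0n A30 => /(_ isT); rewrite (bigD1 tt) //= [X in _ + X]big1 ?addr0; last by case.
  have uF : \sum_d (d \in A3)%:R * (\sum_b u b * X b d) = F.
    rewrite /F [RHS]big_mkcond; apply: eq_bigr => d _; case: ifP => dA; rewrite ?mul0r // mul1r.
    rewrite [RHS]big_mkcond; apply: eq_bigr => b _; rewrite /u.
    by case: ifP => _; rewrite ?mul0r ?mul1r.
  rewrite uF => H; apply: le_trans (H _) _ => [[] []|].
    rewrite mulr1n (eq_bigr (fun d => (d \in A3)%:R)).
      by rewrite (sum_natr_bool _ predT) cardsE; congr (_%:R); apply: eq_card => d; rewrite inE.
    by move=> d _; case: (d \in A3); rewrite ?mul1r ?mul0r ?rmorph1.
  rewrite ler_wpM2l ?ler0n //; apply: le_trans (lmax _) _; rewrite ler_wpM2l //.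
  rewrite (eq_bigr (fun d => (d \in A2)%:R)).
    by rewrite (sum_natr_bool _ predT) cardsE ler_nat; apply/subset_leq_card/subsetP => d.
  by move=> d _; rewrite /u; case: (d \in A2); rewrite ?normr1 ?normr0 ?expr1n ?expr0n.
rewrite rmorphM rmorphXn /= ZF sqrrN exprMn.
have Fr : F ^+ 2 = `|F| ^+ 2.
  rewrite normCK expr2; congr (_ * _); rewrite rmorph_sum; apply: eq_bigr => d _.
  by rewrite rmorph_sum; apply: eq_bigr => b _; rewrite /X /= mix_kernel_real.
rewrite -[X in _ <= X]/((_ * _)%:R) natrM natrX -mulrA ler_wpM2l ?exprn_ge0 ?ler0n //.
rewrite Fr; apply: (@le_trans _ _ (#|A3|%:R * (l * #|A2|%:R) * (k ^ 2)%:R)).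
  by rewrite ler_wpM2r ?ler0n.
rewrite (_ : _ * _ = (l * (k ^ 2)%:R) * (#|A2|%:R * #|A3|%:R)); last by ring.
rewrite -natrM -mulnA [X in _ <= X]natrM ler_wpM2r ?ler0n //.
Qed.

(** * Moments and the level-1 inequality *)

Section Moments.
Variable R : realFieldType.

Lemma even_expr_norm (x : R) k : ~~ odd k -> x ^+ k = `|x| ^+ k.
Proof. by move=> ke; rewrite -normrX ger0_norm // exprn_even_ge0. Qed.

Lemma even_mixed_le (x y : R) a b : ~~ odd (a + b) ->
  x ^+ a * y ^+ b <= x ^+ (a + b) + y ^+ (a + b).
Proof.
move=> abe; apply: le_trans (ler_norm _) _.
rewrite normrM !normrX (even_expr_norm x abe) (even_expr_norm y abe) !exprD.
have x0 := normr_ge0 x; have y0 := normr_ge0 y.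
case: (leP `|x| `|y|) => xy.
  apply: (@le_trans _ _ (`|y| ^+ a * `|y| ^+ b)).
    by rewrite ler_wpM2r ?exprn_ge0 // lerXn2r.
  by rewrite lerDr mulr_ge0 ?exprn_ge0.
apply: (@le_trans _ _ (`|x| ^+ a * `|x| ^+ b)).
  by rewrite ler_wpM2l ?exprn_ge0 // lerXn2r // ltW.
by rewrite lerDl mulr_ge0 ?exprn_ge0.
Qed.

Lemma even_exprD_le (x y : R) k : ~~ odd k -> (x + y) ^+ k <= 2 ^+ k * (x ^+ k + y ^+ k).
Proof.
move=> ke; rewrite (even_expr_norm _ ke) (even_expr_norm x ke) (even_expr_norm y ke).
have x0 := normr_ge0 x; have y0 := normr_ge0 y.
apply: (@le_trans _ _ ((`|x| + `|y|) ^+ k)).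
  by rewrite lerXn2r ?nnegrE ?addr_ge0 ?ler_normD.
case: (leP `|x| `|y|) => xy.
  apply: (@le_trans _ _ ((2 * `|y|) ^+ k)).
    by rewrite lerXn2r ?nnegrE ?addr_ge0 ?mulr_ge0 // mulr_natl mulr2n lerD2r.
  by rewrite exprMn ler_wpM2l ?exprn_ge0 // lerDr exprn_ge0.
apply: (@le_trans _ _ ((2 * `|x|) ^+ k)).
  by rewrite lerXn2r ?nnegrE ?addr_ge0 ?mulr_ge0 // mulr_natl mulr2n lerD2l ltW.
by rewrite exprMn ler_wpM2l ?exprn_ge0 // lerDl exprn_ge0.
Qed.

Lemma subrX_mul_le (x y : R) q : ~~ odd q ->
  (x - y) * (x ^+ q.+1 - y ^+ q.+1) <= q.+1%:R * ((x - y) ^+ 2 * (x ^+ q + y ^+ q)).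
Proof.
move=> qe; rewrite subrXX [X in _ <= X]mulrCA.
set S := \sum_(i < _) _; have -> : (x - y) * ((x - y) * S) = (x - y) ^+ 2 * S by ring.
rewrite ler_wpM2l ?sqr_ge0 // /S.
rewrite mulr_natl -[X in _ *+ X](card_ord q.+1) -sumr_const; apply: ler_sum => i _.
have E : (q.+1.-1 - i + i)%N = q by rewrite subnK // -ltnS.
by have := @even_mixed_le x y (q.+1.-1 - i) i; rewrite E; apply.
Qed.

(** Whichever of [M * x] and [y ^+ 2] is larger replaces the other factor, so that no real exponent
    occurs. *)
Lemma young (M x y : R) k : 0 < M -> 0 <= x ->
  x * y ^+ (2 * k) <= y ^+ (2 * k.+1) / M + M ^+ k * x ^+ k.+1.
Proof.
move=> M0 x0; rewrite !exprM.
have z0 : 0 <= y ^+ 2 by apply: sqr_ge0.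
move: (y ^+ 2) z0 => z z0.
case: (leP (M * x) z) => zx.
  apply: (@le_trans _ _ (z ^+ k.+1 / M)).
    by rewrite exprS mulrAC ler_wpM2r ?exprn_ge0 // ler_pdivlMr // mulrC.
  by rewrite lerDl mulr_ge0 ?exprn_ge0 // ltW.
apply: (@le_trans _ _ (M ^+ k * x ^+ k.+1)).
  rewrite exprS mulrCA -exprMn ler_wpM2l // lerXn2r ?nnegrE ?mulr_ge0 // ltW //.
by rewrite lerDr divr_ge0 ?exprn_ge0 // ltW.
Qed.

Variable n : nat.
Implicit Types (s : 'I_n -> 'I_n -> R) (p : 'S_n).

(** Hoeffding's combinatorial statistic; [perm_mean] is its average over all permutations. *)
Definition perm_sum s p : R := \sum_i s i (p i).
Definition perm_mean s : R := (\sum_i \sum_j s i j) / n%:R.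
Definition perm_dev s p : R := perm_sum s p - perm_mean s.

Lemma perm_dev_swap s p i i' : perm_dev s p - perm_dev s (tperm i i' * p)%g =
  s i (p i) + s i' (p i') - s i (p i') - s i' (p i).
Proof.
rewrite /perm_dev opprB addrA subrK /perm_sum.
have [<-|ii'] := eqVneq i i'.
  by rewrite tperm1 mul1g; ring.
rewrite (bigD1 i) //= (bigD1 i') 1?eq_sym //=.
rewrite [X in _ - X](bigD1 i) //= [X in _ - (_ + X)](bigD1 i') 1?eq_sym //=.
rewrite !permM tpermL tpermR.
rewrite [X in _ - (_ + (_ + X))](eq_bigr (fun k => s k (p k))); first by ring.
by move=> k /andP[ki ki']; rewrite permM tpermD // eq_sym.
Qed.

Lemma sum_swap_entries s p : (0 < n)%N ->
  [/\ \sum_i \sum_(i' : 'I_n) s i (p i) = n%:R * perm_sum s p,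
      \sum_(i : 'I_n) \sum_i' s i' (p i') = n%:R * perm_sum s p,
      \sum_i \sum_i' s i (p i') = n%:R * perm_mean s &
      \sum_i \sum_i' s i' (p i) = n%:R * perm_mean s].
Proof.
move=> n0; have n0' : n%:R != 0 :> R by rewrite pnatr_eq0 -lt0n.
have E3 : \sum_i \sum_i' s i (p i') = n%:R * perm_mean s.
  rewrite /perm_mean mulrCA divff // mulr1; apply: eq_bigr => i _.
  by rewrite [RHS](reindex_inj (@perm_inj _ p)).
split=> //; last by rewrite exchange_big E3.
  rewrite mulr_sumr; apply: eq_bigr => i _.
  by rewrite sumr_const card_ord mulr_natl.
by rewrite sumr_const card_ord mulr_natl.
Qed.

Lemma sum_perm_dev_swap s p : (0 < n)%N ->
  \sum_i \sum_i' (perm_dev s p - perm_dev s (tperm i i' * p)%g) = 2 * n%:R * perm_dev s p.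
Proof.
move=> n0; have [E1 E2 E3 E4] := sum_swap_entries s p n0.
under eq_bigr do under eq_bigr do rewrite perm_dev_swap.
under eq_bigr do rewrite !sumrB big_split /=.
by rewrite !sumrB big_split /= E1 E2 E3 E4 /perm_dev; ring.
Qed.

Lemma sum_perm_swap (F : 'S_n -> 'S_n -> R) i i' :
  \sum_p F p (tperm i i' * p)%g = \sum_p F (tperm i i' * p)%g p.
Proof.
rewrite (reindex_inj (mulgI (tperm i i'))); apply: eq_bigr => p _ /=.
by rewrite mulgA tperm2 mul1g.
Qed.

Lemma sum_perm_dev s : (0 < n)%N -> \sum_p perm_dev s p = 0.
Proof.
move=> n0; apply: (@mulfI _ (2 * n%:R)); first by rewrite mulf_neq0 ?pnatr_eq0 // -lt0n.
rewrite mulr0 mulr_sumr.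
under eq_bigr do rewrite -sum_perm_dev_swap //.
rewrite exchange_big big1 //= => i _; rewrite exchange_big big1 //= => i' _.
rewrite sumrB; apply/eqP; rewrite subr_eq0; apply/eqP.
by rewrite [LHS](reindex_inj (mulgI (tperm i i'))).
Qed.

Lemma sum_perm_sum s : (0 < n)%N -> \sum_p perm_sum s p = #|{perm 'I_n}|%:R * perm_mean s.
Proof.
move=> n0; have := sum_perm_dev s n0; rewrite sumrB => /eqP.
by rewrite subr_eq0 sumr_const mulr_natl => /eqP.
Qed.

(* Exchangeable pair [(p, tperm i i' * p)]: averaging over [i, i'] moves [perm_dev s] towards
   0 by a factor [2 / n], and the squared step is at most [8 / n] times (Q + 1) where Q is
   the same sum for the squared coefficients. *)
Lemma moment_step s q : (0 < n)%N -> ~~ odd q -> \sum_i \sum_j s i j ^+ 2 <= n%:R ->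
  \sum_p perm_dev s p ^+ q.+2 <=
   4 * q.+1%:R * \sum_p (perm_sum (fun i j => s i j ^+ 2) p + 1) * perm_dev s p ^+ q.
Proof.
move=> n0 qe s2; set h := perm_dev s; set Q := perm_sum _.
have n0' : 0 < n%:R :> R by rewrite ltr0n.
pose t i i' p := (tperm i i' * p)%g.
have hq p : 0 <= h p ^+ q by rewrite exprn_even_ge0.
have sym i i' : \sum_p (h p - h (t i i' p)) * h p ^+ q.+1 <=
    q.+1%:R * \sum_p (h p - h (t i i' p)) ^+ 2 * h p ^+ q.
  have E1 : \sum_p (h p - h (t i i' p)) * h p ^+ q.+1 =
      \sum_p (h (t i i' p) - h p) * h (t i i' p) ^+ q.+1.
    exact: (sum_perm_swap (fun x y => (h x - h y) * h x ^+ q.+1)).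
  have E2 : \sum_p (h p - h (t i i' p)) ^+ 2 * h p ^+ q =
      \sum_p (h p - h (t i i' p)) ^+ 2 * h (t i i' p) ^+ q.
    rewrite [LHS](sum_perm_swap (fun x y => (h x - h y) ^+ 2 * h x ^+ q)).
    by apply: eq_bigr => p _; rewrite -sqrrN opprB.
  rewrite -(ler_pM2l (ltr0Sn _ 1)) mulrCA mulr_natl [X in _ <= _ * X]mulr_natl !mulr2n.
  rewrite {2}E1 {2}E2 -!big_split /= mulr_sumr; apply: ler_sum => p _.
  rewrite -mulrDr; have := subrX_mul_le (h p) (h (t i i' p)) qe.
  set A := (X in X <= _ -> _); set B := (X in _ -> X <= _).
  by have -> : A = B by rewrite /A /B; ring.
have V p : \sum_i \sum_i' (h p - h (t i i' p)) ^+ 2 <= 8 * n%:R * (Q p + 1).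
  have [E1 E2 E3 E4] := sum_swap_entries (fun i j => s i j ^+ 2) p n0.
  apply: (@le_trans _ _ (\sum_i \sum_i' (4 * (s i (p i) ^+ 2 + s i' (p i') ^+ 2
    + s i (p i') ^+ 2 + s i' (p i) ^+ 2)))).
    apply: ler_sum => i _; apply: ler_sum => i' _; rewrite /h perm_dev_swap.
    rewrite -subr_ge0; set a := s i _; set b := s i' _; set c := s i _; set d := s i' _.
    rewrite (_ : _ - _ = (a - b) ^+ 2 + (a + c) ^+ 2 + (a + d) ^+ 2 + (b + c) ^+ 2
      + (b + d) ^+ 2 + (c - d) ^+ 2); last by ring.
    by rewrite !addr_ge0 ?sqr_ge0.
  under eq_bigr do rewrite -mulr_sumr !big_split /=.
  rewrite -mulr_sumr !big_split /= E1 E2 E3 E4 -/(Q p).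
  have m1 : n%:R * perm_mean (fun i j => s i j ^+ 2) <= n%:R.
    by rewrite /perm_mean mulrC divfK ?gt_eqF.
  rewrite (_ : _ * _ = 8 * (n%:R * Q p + n%:R * perm_mean (fun i j => s i j ^+ 2))); last by ring.
  by rewrite -[X in _ <= X]mulrA [X in _ <= _ * X]mulrDr mulr1 ler_pM2l // lerD2l.
rewrite -(@ler_pM2l _ (2 * n%:R)) ?mulr_gt0 // [X in X <= _]mulr_sumr.
apply: (@le_trans _ _ (\sum_i \sum_i' (q.+1%:R * \sum_p (h p - h (t i i' p)) ^+ 2 * h p ^+ q))).
  apply: (@le_trans _ _ (\sum_i \sum_i' \sum_p (h p - h (t i i' p)) * h p ^+ q.+1)).
    rewrite le_eqVlt; apply/orP; left; apply/eqP.
    under [RHS]eq_bigr do rewrite exchange_big.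
    rewrite [RHS]exchange_big /=. apply: eq_bigr => p _ /=.
    rewrite exprS mulrA -sum_perm_dev_swap // mulr_suml. apply: eq_bigr => i _.
    by rewrite mulr_suml.
  by apply: ler_sum => i _; apply: ler_sum => i' _; apply: sym.
under eq_bigr do rewrite -mulr_sumr exchange_big.
rewrite -mulr_sumr exchange_big /=; set S := \sum_p (Q p + 1) * _.
have -> : 2 * n%:R * (4 * q.+1%:R * S) = q.+1%:R * (8 * n%:R * S) by ring.
rewrite ler_wpM2l // /S mulr_sumr; apply: ler_sum => p _.
under eq_bigr do rewrite -mulr_suml.
by rewrite -mulr_suml [X in _ <= X]mulrA ler_wpM2r.
Qed.

End Moments.

(** The squared coefficients satisfy the same hypotheses as [s], so the inductive bound controls the
    powers of [Q], and [young] separates [Q] from the deviation. The constant depends on the order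
    only, not on [n]. *)
Lemma moment_bound (R : realFieldType) r : exists2 K : R, 0 <= K &
  forall n (s : 'I_n -> 'I_n -> R), (0 < n)%N -> (forall i j, `|s i j| <= 1) ->
  \sum_i \sum_j s i j ^+ 2 <= n%:R ->
  \sum_p perm_dev s p ^+ (2 ^ r.+1) <= K * #|{perm 'I_n}|%:R.
Proof.
elim: r => [|r [K K0 IH]].
  exists 8 => // n s n0 s1 s2; apply: le_trans (moment_step n0 (isT : ~~ odd 0) s2) _.
  under eq_bigr do rewrite expr0 mulr1.
  rewrite big_split /= sum_perm_sum // sumr_const.
  have m1 : perm_mean (fun i j => s i j ^+ 2) <= 1 by rewrite ler_pdivrMr ?ltr0n // mul1r.
  rewrite [X in _ + X](_ : _ = #|{perm 'I_n}|%:R) // mulr1.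
  have : #|{perm 'I_n}|%:R * perm_mean (fun i j => s i j ^+ 2) <= #|{perm 'I_n}|%:R.
    by rewrite ler_piMr.
  lra.
pose k := (2 ^ r.+1)%N.
have k_even : ~~ odd k by rewrite /k expnS oddM.
have k0 : (0 < k)%N by rewrite expn_gt0.
pose q := (2 * k.-1)%N; have qE : (2 ^ r.+2 = q.+2)%N.
  by rewrite expnS -/k /q -{1}(prednK k0) mulnS.
have qe : ~~ odd q by rewrite /q oddM.
(* Against the factor [4 * q.+1%:R] of [moment_step], this choice leaves [G / 2] on the right, which
   the left side absorbs. *)
pose M : R := 8 * q.+1%:R.
have M0 : 0 < M by rewrite mulr_gt0 // ltr0Sn.
exists (8 * q.+1%:R * M ^+ k.-1 * (2 ^+ k * (K + 2 ^+ k))).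
  by rewrite !mulr_ge0 ?exprn_ge0 ?addr_ge0 ?exprn_ge0 // ltW.
move=> n s n0 s1 s2; rewrite qE; set G := (X in X <= _).
have := moment_step n0 qe s2; rewrite -/G.
set s2' := fun i j => s i j ^+ 2; set Q := perm_sum s2' => step.
have Q0 p : 0 <= Q p by apply: sumr_ge0 => i _; apply: sqr_ge0.
have m0 : 0 <= perm_mean s2'.
  by rewrite divr_ge0 ?ler0n //; do 2!(apply: sumr_ge0 => ? _); apply: sqr_ge0.
have m1 : perm_mean s2' <= 1 by rewrite ler_pdivrMr ?ltr0n // mul1r.
have s2'1 i j : `|s2' i j| <= 1 by rewrite /s2' normrX expr_le1.
have s2'2 : \sum_i \sum_j s2' i j ^+ 2 <= n%:R.
  apply: le_trans s2; apply: ler_sum => i _; apply: ler_sum => j _.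
  by rewrite expr2 ler_piMr ?sqr_ge0 //; apply: le_trans (ler_norm _) (s2'1 i j).
have Qk : \sum_p (Q p + 1) ^+ k <= 2 ^+ k * (K + 2 ^+ k) * #|{perm 'I_n}|%:R.
  apply: (@le_trans _ _ (\sum_p (2 ^+ k * (perm_dev s2' p ^+ k + 2 ^+ k)))).
    apply: ler_sum => p _.
    have -> : Q p + 1 = perm_dev s2' p + (perm_mean s2' + 1) by rewrite addrA subrK.
    apply: le_trans (even_exprD_le _ _ k_even) _; rewrite ler_pM2l ?exprn_gt0 // lerD2l.
    by rewrite lerXn2r ?nnegrE ?addr_ge0 // -[2%:R]/(1 + 1) lerD2r.
  rewrite -mulr_sumr -mulrA ler_pM2l ?exprn_gt0 // big_split /= mulrDl lerD //.
    exact: IH.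
  by rewrite sumr_const mulr_natr.
have Y : \sum_p (Q p + 1) * perm_dev s p ^+ q <= G / M + M ^+ k.-1 * \sum_p (Q p + 1) ^+ k.
  rewrite /G mulr_suml mulr_sumr -big_split; apply: ler_sum => p _ /=.
  have := @young R M (Q p + 1) (perm_dev s p) k.-1 M0.
  rewrite prednK // -/q -qE expnS -/k; apply.
  by rewrite addr_ge0.
have {Y Qk} Y : \sum_p (Q p + 1) * perm_dev s p ^+ q <=
    G / M + M ^+ k.-1 * (2 ^+ k * (K + 2 ^+ k) * #|{perm 'I_n}|%:R).
  apply: le_trans Y _; rewrite lerD2l ler_wpM2l // exprn_ge0 //; exact: ltW.
have q0 : 0 < q.+1%:R :> R by rewrite ltr0Sn.
have : G <= 4 * q.+1%:R * (G / M + M ^+ k.-1 * (2 ^+ k * (K + 2 ^+ k) * #|{perm 'I_n}|%:R)).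
  by apply: le_trans step _; rewrite ler_pM2l // mulr_gt0.
have -> : 4 * q.+1%:R * (G / M + M ^+ k.-1 * (2 ^+ k * (K + 2 ^+ k) * #|{perm 'I_n}|%:R)) =
   G / 2 + 4 * q.+1%:R * M ^+ k.-1 * (2 ^+ k * (K + 2 ^+ k)) * #|{perm 'I_n}|%:R.
  rewrite mulrDr !mulrA; congr (_ + _); rewrite /M.
  by move: q0; move: (q.+1%:R : R) => c c0; field; rewrite gt_eqF.
have -> : 8 * q.+1%:R * M ^+ k.-1 * (2 ^+ k * (K + 2 ^+ k)) * #|{perm 'I_n}|%:R =
  2 * (4 * q.+1%:R * M ^+ k.-1 * (2 ^+ k * (K + 2 ^+ k)) * #|{perm 'I_n}|%:R) by ring.
lra.
Qed.

(** * From moments over all permutations to averages over a subset *)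

Lemma cauchy_schwarz (R : realFieldType) (I : finType) (A : pred I) (x y : I -> R) :
  (\sum_(i | A i) x i * y i) ^+ 2 <= (\sum_(i | A i) x i ^+ 2) * (\sum_(i | A i) y i ^+ 2).
Proof.
have : 0 <= \sum_(i | A i) \sum_(j | A j) (x i * y j - x j * y i) ^+ 2.
  by do 2!(apply: sumr_ge0 => ? _); apply: sqr_ge0.
have -> : \sum_(i | A i) \sum_(j | A j) (x i * y j - x j * y i) ^+ 2 =
    \sum_(i | A i) (x i ^+ 2 * (\sum_(j | A j) y j ^+ 2) + y i ^+ 2 * (\sum_(j | A j) x j ^+ 2)
      - 2 * (x i * y i) * (\sum_(j | A j) x j * y j)).
  apply: eq_bigr => i _; rewrite !mulr_sumr -big_split -sumrB; apply: eq_bigr => j _ /=.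
  by ring.
rewrite sumrB big_split /= -!mulr_suml -mulr_sumr; lra.
Qed.

Lemma power_mean (R : realFieldType) (I : finType) (A : {set I}) r (x : I -> R) :
  (\sum_(i in A) x i) ^+ (2 ^ r) * #|A|%:R <= #|A|%:R ^+ (2 ^ r) * \sum_(i in A) x i ^+ (2 ^ r).
Proof.
elim: r x => [|r IH] x; first by rewrite !expr1 mulrC.
have cs : (\sum_(i in A) x i) ^+ 2 <= #|A|%:R * \sum_(i in A) x i ^+ 2.
  have := cauchy_schwarz (mem A) (fun=> 1) x.
  under eq_bigr do rewrite mul1r.
  by under [X in _ <= X * _]eq_bigr do rewrite expr1n; rewrite sumr_const.
rewrite expnS exprM.
apply: (@le_trans _ _ ((#|A|%:R * \sum_(i in A) x i ^+ 2) ^+ (2 ^ r) * #|A|%:R)).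
  rewrite ler_wpM2r ?ler0n // lerXn2r ?nnegrE ?sqr_ge0 //.
  by rewrite mulr_ge0 ?ler0n ?sumr_ge0 // => i _; apply: sqr_ge0.
rewrite exprMn -mulrA mul2n -addnn exprD -mulrA ler_wpM2l ?exprn_ge0 ?ler0n //.
apply: le_trans (IH _) _; rewrite ler_wpM2l ?exprn_ge0 ?ler0n // ler_sum // => i _.
by rewrite -exprM mul2n -addnn.
Qed.

Lemma sum_le_of_moment (R : realFieldType) (I : finType) (A : {set I}) r m (x : I -> R) y :
  (0 < #|A|)%N -> 1 <= y -> (m <= 2 ^ r)%N ->
  \sum_(i in A) x i ^+ (2 ^ r) <= #|A|%:R * y ^+ m -> \sum_(i in A) x i <= y * #|A|%:R.
Proof.
move=> A0 y1 mr Am; have A0' : 0 < #|A|%:R :> R by rewrite ltr0n.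
have y0 : 0 < y by apply: lt_le_trans y1.
set E := \sum_(i in A) x i.
have [E0|E0] := leP E 0; first by apply: le_trans E0 _; rewrite mulr_ge0 // ltW.
have yA : 0 <= y * #|A|%:R by apply: mulr_ge0; apply: ltW.
rewrite -(@ler_pXn2r _ (2 ^ r)) ?expn_gt0 ?nnegrE //; last exact: ltW.
rewrite -(ler_pM2r A0'); apply: le_trans (power_mean A r x) _.
rewrite exprMn [X in _ <= X * _]mulrC -[X in _ <= X]mulrA ler_pM2l ?exprn_gt0 //.
by apply: le_trans Am _; rewrite [X in _ <= X]mulrC ler_wpM2l ?ler0n // ler_weXn2l.
Qed.

Section Excess.
Variables (R : realFieldType) (n : nat).
Implicit Types (S : {set 'S_n}) (i j : 'I_n).

Definition density S i j : R := n%:R * (hits S i j)%:R / #|S|%:R.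
Definition excess S i j : R := density S i j - 1.

Lemma density_ge0 S i j : 0 <= density S i j.
Proof. by rewrite divr_ge0 ?mulr_ge0 ?ler0n. Qed.

Lemma excess_geN1 S i j : -1 <= excess S i j.
Proof. by rewrite lerBrDr addNr density_ge0. Qed.

Lemma sum_perm_dev_excess S (s : 'I_n -> 'I_n -> R) : (0 < n)%N -> (0 < #|S|)%N ->
  \sum_(p in S) perm_dev s p = #|S|%:R / n%:R * \sum_i \sum_j s i j * excess S i j.
Proof.
move=> n0 S0; have n0' : n%:R != 0 :> R by rewrite pnatr_eq0 -lt0n.
have S0' : #|S|%:R != 0 :> R by rewrite pnatr_eq0 -lt0n.
rewrite sumrB sumr_const.
have -> : \sum_(p in S) perm_sum s p = \sum_i \sum_j s i j * (hits S i j)%:R.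
  rewrite exchange_big; apply: eq_bigr => i _ /=.
  under [RHS]eq_bigr do rewrite hitsE mulr_sumr.
  rewrite [RHS]exchange_big; apply: eq_bigr => p _ /=.
  rewrite (bigD1 (p i)) //= eqxx mulr1 big1 ?addr0 // => j jp.
  by rewrite eq_sym (negPf jp) mulr0.
rewrite -[perm_mean s *+ _]mulr_natr /perm_mean -mulrA mulr_suml -sumrB mulr_sumr; apply: eq_bigr => i _.
rewrite mulr_suml -sumrB mulr_sumr; apply: eq_bigr => j _.
by rewrite /excess /density; field; rewrite n0' S0'.
Qed.

End Excess.

(* The exponent leaves a little room above the 661 of [dense]. *)
Definition level1 (R : realFieldType) n (y : R) := forall (S : {set 'S_n}) (s : 'I_n -> 'I_n -> R) W,
  (0 < #|S|)%N -> #|('Alt_('I_n))%g|%:R <= #|S|%:R * y ^+ 666 -> 0 < W ->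
  (forall i j, `|s i j| <= W) -> \sum_i \sum_j s i j ^+ 2 <= n%:R * W ^+ 2 ->
  \sum_i \sum_j s i j * excess R S i j <= n%:R * y * W.

(** Restricting to [S] inflates the moment by [2 * y ^+ 666], and one more power of [y] absorbs
    [2 * K]. The order [2 ^ 10] is the least power of two that is at least 667, so the corresponding
    root costs no more than one factor [y]. *)
Lemma level1_bound (R : realFieldType) : exists Y0 : R, forall n (y : R),
  (1 < n)%N -> 1 <= y -> Y0 <= y -> level1 n y.
Proof.
have [K K0 HK] := moment_bound R 9.
exists (2 * K) => n y n1 y1 yK S s W S0 Sy W0 sW s2.
have n0 : (0 < n)%N by apply: ltn_trans n1.
have n0' : 0 < n%:R :> R by rewrite ltr0n.
have S0' : 0 < #|S|%:R :> R by rewrite ltr0n.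
have y0 : 0 < y by apply: lt_le_trans y1.
pose s' i j := s i j / W.
have s'1 i j : `|s' i j| <= 1.
  by rewrite normrM normfV (gtr0_norm W0) ler_pdivrMr // mul1r.
have s'2 : \sum_i \sum_j s' i j ^+ 2 <= n%:R.
  under eq_bigr do under eq_bigr do rewrite exprMn.
  under eq_bigr do rewrite -mulr_suml.
  by rewrite -mulr_suml exprVn ler_pdivrMr // exprn_gt0.
have := HK n s' n0 s'1 s'2; set h := perm_dev s' => M.
have -> : \sum_i \sum_j s i j * excess R S i j = W * \sum_i \sum_j s' i j * excess R S i j.
  rewrite mulr_sumr; apply: eq_bigr => i _; rewrite mulr_sumr; apply: eq_bigr => j _.
  by rewrite /s'; field; rewrite gt_eqF.
rewrite mulrC ler_pM2r //.
have -> : \sum_i \sum_j s' i j * excess R S i j = n%:R / #|S|%:R * \sum_(p in S) h p.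
  by rewrite sum_perm_dev_excess //; field; rewrite !gt_eqF.
rewrite -mulrA ler_pM2l // mulrC ler_pdivrMr //.
have P : (#|{perm 'I_n}|%:R : R) = 2 * #|('Alt_('I_n))%g|%:R.
  by rewrite -natrM card_Alt ?card_ord // card_Sn.
have S2 : \sum_(p in S) h p ^+ (2 ^ 10) <= K * #|{perm 'I_n}|%:R.
  apply: le_trans M; rewrite [X in _ <= X](bigID (mem S)) /= lerDl sumr_ge0 // => p _.
  by rewrite exprn_even_ge0.
apply: (@sum_le_of_moment _ _ S 10 667) => //.
apply: le_trans S2 _; rewrite P mulrA [K * 2]mulrC exprS mulrA.
apply: (@le_trans _ _ (y * (#|S|%:R * y ^+ 666))).
  by apply: ler_pM => //; rewrite mulr_ge0.
by rewrite mulrCA mulrA.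
Qed.

(** * The trilinear form *)

Section Trilinear.
Variables (R : realFieldType) (n : nat).
Implicit Types (x y z : 'I_n -> 'I_n -> R).

(** The index pattern follows a product of permutations: the first sends [i] to [j], the second [j]
    to [k], and their product [i] to [k]. *)
Definition tri x y z : R := \sum_i \sum_j \sum_k x i j * y j k * z i k.
Definition sqnorm x : R := \sum_i \sum_j x i j ^+ 2.

Lemma sqnorm_ge0 x : 0 <= sqnorm x.
Proof. by do 2!(apply: sumr_ge0 => ? _); apply: sqr_ge0. Qed.

Lemma tri_sq_le x y z : tri x y z ^+ 2 <= sqnorm x * sqnorm y * sqnorm z.
Proof.
have -> : tri x y z = \sum_(u : 'I_n * 'I_n) z u.1 u.2 * (\sum_j x u.1 j * y j u.2).
  rewrite -(pair_bigA _ (fun i k => z i k * (\sum_j x i j * y j k))) /=.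
  apply: eq_bigr => i _; rewrite exchange_big; apply: eq_bigr => k _ /=.
  by rewrite mulr_sumr; apply: eq_bigr => j _; rewrite mulrC.
apply: le_trans (cauchy_schwarz _ _ _) _.
rewrite [X in _ <= X]mulrC (_ : \sum_(u : 'I_n * 'I_n) z u.1 u.2 ^+ 2 = sqnorm z); last first.
  by rewrite /sqnorm pair_bigA.
rewrite ler_wpM2l ?sqnorm_ge0 //.
apply: (@le_trans _ _ (\sum_(u : 'I_n * 'I_n) (\sum_j x u.1 j ^+ 2) * (\sum_j y j u.2 ^+ 2))).
  by apply: ler_sum => u _; apply: cauchy_schwarz.
rewrite -(pair_bigA _ (fun i k => (\sum_j x i j ^+ 2) * (\sum_j y j k ^+ 2))) /=.
under eq_bigr do rewrite -mulr_sumr.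
by rewrite -mulr_suml /sqnorm [X in _ * X <= _]exchange_big.
Qed.

Lemma triDl x x' y z : tri (fun i j => x i j + x' i j) y z = tri x y z + tri x' y z.
Proof.
by rewrite -big_split; do 3!(apply: eq_bigr => ? _; rewrite -?big_split /=); rewrite !mulrDl.
Qed.

Lemma triDm x y y' z : tri x (fun i j => y i j + y' i j) z = tri x y z + tri x y' z.
Proof.
by rewrite -big_split; do 3!(apply: eq_bigr => ? _; rewrite -?big_split /=); rewrite mulrDr mulrDl.
Qed.

Lemma triDr x y z z' : tri x y (fun i j => z i j + z' i j) = tri x y z + tri x y z'.
Proof.
by rewrite -big_split; do 3!(apply: eq_bigr => ? _; rewrite -?big_split /=); rewrite mulrDr.
Qed.

Lemma tri_ext x x' y y' z z' : (forall i j, x i j = x' i j) -> (forall i j, y i j = y' i j) ->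
  (forall i j, z i j = z' i j) -> tri x y z = tri x' y' z'.
Proof. by move=> xx yy zz; do 3!(apply: eq_bigr => ? _); rewrite xx yy zz. Qed.

End Trilinear.

Section ExcessSums.
Variables (R : realFieldType) (n : nat) (S : {set 'S_n}).
Hypothesis S0 : (0 < #|S|)%N.

Lemma sum_density_row i : \sum_j density R S i j = n%:R.
Proof.
rewrite /density -mulr_suml -mulr_sumr.
have -> : \sum_j (hits S i j)%:R = #|S|%:R :> R.
  under eq_bigr do rewrite hitsE.
  rewrite exchange_big /= -[RHS]sumr_const; apply: eq_bigr => p _.
  by rewrite (bigD1 (p i)) //= eqxx big1 ?addr0 // => j; rewrite eq_sym => /negPf ->.
by rewrite mulfK // pnatr_eq0 -lt0n.
Qed.

Lemma sum_density_col j : \sum_i density R S i j = n%:R.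
Proof.
rewrite /density -mulr_suml -mulr_sumr.
have -> : \sum_i (hits S i j)%:R = #|S|%:R :> R.
  under eq_bigr do rewrite hitsE.
  rewrite exchange_big /= -[RHS]sumr_const; apply: eq_bigr => p _.
  rewrite (bigD1 (p^-1%g j)) //= permKV eqxx big1 ?addr0 // => i ipj.
  by case: eqP => // pij; case/eqP: ipj; rewrite -pij permK.
by rewrite mulfK // pnatr_eq0 -lt0n.
Qed.

Lemma sum_excess_row i : \sum_j excess R S i j = 0.
Proof. by rewrite sumrB sum_density_row sumr_const card_ord subrr. Qed.

Lemma sum_excess_col j : \sum_i excess R S i j = 0.
Proof. by rewrite sumrB sum_density_col sumr_const card_ord subrr. Qed.

End ExcessSums.

(** All mixed terms vanish, since the rows and columns of an excess sum to 0. *)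
Lemma tri_density (R : realFieldType) n (A1 A2 A3 : {set 'S_n}) :
  (0 < #|A1|)%N -> (0 < #|A2|)%N -> (0 < #|A3|)%N ->
  tri (density R A1) (density R A2) (density R A3) =
  n%:R ^+ 3 + tri (excess R A1) (excess R A2) (excess R A3).
Proof.
move=> A10 A20 A30.
pose one (i j : 'I_n) : R := 1.
have D A i j : density R A i j = one i j + excess R A i j by rewrite addrC subrK.
rewrite (@tri_ext _ _ _ (fun i j => one i j + excess R A1 i j) _ (density R A2) _ (density R A3)) //.
rewrite triDl; congr (_ + _).
  rewrite /tri; under eq_bigr do under eq_bigr do under eq_bigr do rewrite mul1r.
  under eq_bigr do rewrite exchange_big /=.
  under eq_bigr do under eq_bigr do rewrite -mulr_suml sum_density_col //.
  under eq_bigr do rewrite -mulr_sumr sum_density_row //.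
  by rewrite sumr_const card_ord -mulr_natl; ring.
rewrite (@tri_ext _ _ _ (excess R A1) _ (fun i j => one i j + excess R A2 i j) _ (density R A3)) //.
rewrite triDm [X in X + _](_ : _ = 0) ?add0r.
  rewrite (@tri_ext _ _ _ (excess R A1) _ (excess R A2) _ (fun i j => one i j + excess R A3 i j)) //.
  rewrite triDr [X in X + _](_ : _ = 0) ?add0r //.
  rewrite /tri; under eq_bigr do under eq_bigr do under eq_bigr do rewrite mulr1.
  rewrite exchange_big big1 // => j _ /=.
  under eq_bigr do rewrite -mulr_sumr.
  by rewrite -mulr_suml sum_excess_col // mul0r.
rewrite /tri; under eq_bigr do under eq_bigr do under eq_bigr do rewrite mulr1.
rewrite big1 // => i _; under eq_bigr do rewrite -mulr_sumr.
by rewrite -mulr_suml sum_excess_row // mul0r.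
Qed.

Definition no_product n (A1 A2 A3 : {set 'S_n}) :=
  forall a b, a \in A1 -> b \in A2 -> (a * b)%g \notin A3.

(** One power of [y] is given up against the 660 of the theorem; it pays for the constant factors
    lost when passing to subsets. *)
Definition dense (R : realFieldType) n (y : R) (S : {set 'S_n}) :=
  S \subset ('Alt_('I_n))%g /\ #|('Alt_('I_n))%g|%:R <= #|S|%:R * y ^+ 661.

Lemma dense_gt0 (R : realFieldType) n (y : R) (S : {set 'S_n}) : dense y S -> (0 < #|S|)%N.
Proof.
case=> _; case: posnP => // ->.
by rewrite mul0r leNgt ltr0n Alt_gt0.
Qed.

Lemma mixing_excess (R : realFieldType) n k (A1 A2 A3 : {set 'S_n}) :
  (16 < n)%N -> (8 * k + 8 <= n)%N ->
  A1 \subset ('Alt_('I_n))%g -> A2 \subset ('Alt_('I_n))%g -> A3 \subset ('Alt_('I_n))%g ->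
  (0 < #|A1|)%N -> (0 < #|A2|)%N -> (0 < #|A3|)%N -> no_product A1 A2 A3 ->
  (1 + (n%:R - 1) / n%:R ^+ 3 * tri (excess R A1) (excess R A2) (excess R A3)) ^+ 2
   * (#|A1|%:R * #|A2|%:R * #|A3|%:R) * k%:R ^+ 2 <= 2 * #|('Alt_('I_n))%g|%:R ^+ 3 :> R.
Proof.
move=> n16 kn A1s A2s A3s A10 A20 A30 np.
have := mixing_int n16 kn A1s A2s A3s np.
rewrite -(ler_int R) !(rmorphM, rmorphXn, rmorphB) /= !rmorph1.
have n0 : 0 < n%:R :> R by rewrite ltr0n (ltn_trans _ n16).
have c1 : 0 < #|A1|%:R :> R by rewrite ltr0n.
have c2 : 0 < #|A2|%:R :> R by rewrite ltr0n.
have c3 : 0 < #|A3|%:R :> R by rewrite ltr0n.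
set a1 : R := #|A1|%:R in c1 *; set a2 : R := #|A2|%:R in c2 *; set a3 : R := #|A3|%:R in c3 *.
set N : R := #|('Alt_('I_n))%g|%:R.
have P : (#|{perm 'I_n}|%:R : R) = 2 * N.
  by rewrite -natrM card_Alt ?card_ord ?card_Sn // (ltn_trans _ n16).
have -> : (\sum_i \sum_j \sum_k (hits A1 i j)%:Z * (hits A2 j k)%:Z * (hits A3 i k)%:Z)%:~R
   = a1 * a2 * a3 / n%:R ^+ 3 * tri (density R A1) (density R A2) (density R A3).
  rewrite rmorph_sum mulr_sumr; apply: eq_bigr => i _.
  rewrite rmorph_sum mulr_sumr; apply: eq_bigr => j _.
  rewrite rmorph_sum mulr_sumr; apply: eq_bigr => l _.
  rewrite !rmorphM /= /density -/a1 -/a2 -/a3; field.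
  by rewrite !gt_eqF.
rewrite tri_density //; set t := tri _ _ _.
rewrite -!pmulrn P -/N -/a1 -/a2 -/a3.
have -> : (n%:R - 1) * (a1 * a2 * a3 / n%:R ^+ 3 * (n%:R ^+ 3 + t)) - (n%:R - 2) * (a1 * a2 * a3)
  = (a1 * a2 * a3) * (1 + (n%:R - 1) / n%:R ^+ 3 * t).
  by field; rewrite gt_eqF.
have a0 : 0 < a1 * a2 * a3 by rewrite !mulr_gt0.
move=> H; rewrite -(ler_pM2r a0); move: H.
set u := 1 + _; set L := (X in X <= _ -> _); set L' := (X in _ -> X <= _).
have -> : L' = L by rewrite /L /L'; ring.
move=> H; apply: le_trans H _; rewrite le_eqVlt; apply/orP; left; apply/eqP; ring.
Qed.

(** Three densities cost [y ^+ 1983], while [k ^ 2] is at least [y ^+ 2000 / 256]. One power of [y]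
    absorbs the constant [512 = 2 * 256], and the square root of the remaining [y ^- 16] is the
    error. *)
Lemma mixing_dense (R : realFieldType) n (y : R) (A1 A2 A3 : {set 'S_n}) :
  512 <= y -> n%:R = y ^+ 1000 -> dense y A1 -> dense y A2 -> dense y A3 ->
  no_product A1 A2 A3 ->
  tri (excess R A1) (excess R A2) (excess R A3) <= - (1 - y ^- 8) * n%:R ^+ 2.
Proof.
move=> y512 ny dA1 dA2 dA3 np.
have y1 : 1 <= y by apply: le_trans y512; rewrite ler1n.
have y0 : 0 < y by apply: lt_le_trans y1.
have n512 : (512 <= n)%N.
  rewrite -(ler_nat R) ny; apply: le_trans y512 _; rewrite exprS ler_peMr //.
    exact: ltW.
  exact: exprn_ege1.
have n0 : 0 < n%:R :> R by rewrite ltr0n (leq_trans _ n512).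
pose k := ((n - 8) %/ 8)%N.
have [kn kn'] : (8 * k + 8 <= n)%N /\ (n <= 16 * k)%N by rewrite /k; lia.
have A10 := dense_gt0 dA1; have A20 := dense_gt0 dA2; have A30 := dense_gt0 dA3.
case: dA1 => A1s c1; case: dA2 => A2s c2; case: dA3 => A3s c3.
have n16 : (16 < n)%N by apply: leq_trans n512.
have := mixing_excess R n16 kn A1s A2s A3s A10 A20 A30 np.
set t := tri _ _ _; set N : R := #|('Alt_('I_n))%g|%:R in c1 c2 c3 *.
have a1 : 0 < #|A1|%:R :> R by rewrite ltr0n.
have a2 : 0 < #|A2|%:R :> R by rewrite ltr0n.
have a3 : 0 < #|A3|%:R :> R by rewrite ltr0n.
move: (#|A1|%:R : R) (#|A2|%:R : R) (#|A3|%:R : R) a1 a2 a3 c1 c2 c3 => {}a1 {}a2 {}a3 p1 p2 p3 c1 c2 c3.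
have kR : y ^+ 1000 <= 16 * k%:R by rewrite -ny -natrM ler_nat.
set u := _ * t => M.
have N0 : 0 <= N by rewrite ler0n.
have N3 : N ^+ 3 <= a1 * a2 * a3 * y ^+ 1983.
  rewrite (_ : _ * y ^+ 1983 = (a1 * y ^+ 661) * ((a2 * y ^+ 661) * (a3 * y ^+ 661))).
    rewrite (_ : N ^+ 3 = N * (N * N)); last by ring.
    by apply: ler_pM; rewrite ?mulr_ge0 //; apply: ler_pM.
  by rewrite (_ : 1983 = 661 + (661 + 661))%N // !exprD; ring.
have a0 : 0 < a1 * a2 * a3 by rewrite !mulr_gt0.
have M2 : (1 + u) ^+ 2 * k%:R ^+ 2 <= 2 * y ^+ 1983.
  rewrite -(ler_pM2l a0); apply: le_trans (_ : 2 * (a1 * a2 * a3 * y ^+ 1983) <= _); last by lra.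
  by apply: le_trans (_ : 2 * N ^+ 3 <= _); [move: M; lra|rewrite ler_pM2l].
have k2 : y ^+ 2000 <= 256 * k%:R ^+ 2.
  rewrite (_ : 2000 = 1000 + 1000)%N // exprD (_ : 256 * k%:R ^+ 2 = (16 * k%:R) * (16 * k%:R)); last by ring.
  by apply: ler_pM => //; apply: exprn_ge0; apply: ltW.
have M3 : (1 + u) ^+ 2 * y ^+ 2000 <= y ^+ 1984.
  apply: (@le_trans _ _ (256 * ((1 + u) ^+ 2 * k%:R ^+ 2))).
    by rewrite [X in _ <= X]mulrCA ler_wpM2l ?sqr_ge0.
  apply: (@le_trans _ _ (512 * y ^+ 1983)); first by move: M2; lra.
  by rewrite [X in _ <= X]exprS ler_wpM2r // exprn_ge0 // ltW.
have M4 : ((1 + u) * y ^+ 8) ^+ 2 <= 1 ^+ 2.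
  rewrite expr1n exprMn -exprM -(ler_pM2r (exprn_gt0 1984 y0)) mul1r -mulrA -exprD.
  exact: M3.
have M5 : (1 + u) * y ^+ 8 <= 1.
  rewrite leNgt; apply/negP => z1; move: M4; rewrite expr1n leNgt => /negP; apply.
  by apply: exprn_egt1.
have y8 : 0 < y ^+ 8 by apply: exprn_gt0.
have M6 : u <= - (1 - y ^- 8).
  by rewrite -[X in u <= - (1 - X)]mul1r -/(1 / y ^+ 8); move: M5; rewrite -ler_pdivlMr //; lra.
have d0 : 0 <= 1 - y ^- 8.
  by rewrite subr_ge0 invf_le1 // exprn_ege1.
move: M6; rewrite /u; set d := 1 - _ in d0 *.
have n1 : 0 < n%:R - 1 :> R by rewrite subr_gt0 ltr1n (leq_trans _ n512).
rewrite mulrAC ler_pdivrMr ?exprn_gt0 // => M6.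
rewrite -(ler_pM2l n1); apply: le_trans M6 _.
rewrite -subr_ge0 (_ : _ - _ = d * n%:R ^+ 2); last by ring.
by rewrite mulr_ge0 // sqr_ge0.
Qed.

(** The level-1 inequality is tested on the truncated excess itself. The scale [W] is proportional
    to its squared norm; if this norm exceeded the bound, [W] would be admissible and the norm would
    be at most half of itself. *)
Lemma sqnorm_bounded (R : realFieldType) n (y M : R) (S : {set 'S_n}) (E : rel 'I_n) :
  (0 < n)%N -> 1 <= y -> level1 n y -> (0 < #|S|)%N ->
  #|('Alt_('I_n))%g|%:R <= #|S|%:R * y ^+ 666 -> y <= M ->
  (forall i j, E i j -> `|excess R S i j| <= M) ->
  sqnorm (fun i j => if E i j then excess R S i j else 0) <= 4 * n%:R * y * M.
Proof.
move=> n0 y1 L S0 Sy yM EM; set s := fun i j => _.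
have y0 : 0 < y by apply: lt_le_trans y1.
have n0' : 0 < n%:R :> R by rewrite ltr0n.
rewrite leNgt; apply/negP => X.
pose t := sqnorm s / n%:R.
have sE : sqnorm s = n%:R * t by rewrite /t mulrC divfK // gt_eqF.
have tM : 4 * y * M < t by rewrite /t ltr_pdivlMr //; move: X; lra.
have yy : y * y <= y * M by rewrite ler_wpM2l // ltW.
have t0 : 0 < t by apply: lt_trans tM; rewrite !mulr_gt0 // (lt_le_trans y0).
pose W := t / (2 * y).
have W0 : 0 < W by rewrite divr_gt0 // mulr_gt0.
have MW : M <= W by rewrite /W ler_pdivlMr ?mulr_gt0 //; nra.
have sW i j : `|s i j| <= W.
  rewrite /s; case: ifP => Eij; last by rewrite normr0 ltW.
  exact: le_trans (EM i j Eij) MW.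
have s2 : \sum_i \sum_j s i j ^+ 2 <= n%:R * W ^+ 2.
  rewrite -/(sqnorm s) sE ler_pM2l //.
  have yt : (2 * y) ^+ 2 <= t by move: tM yy; rewrite expr2; lra.
  by rewrite /W expr_div_n ler_pdivlMr ?exprn_gt0 ?mulr_gt0 // [t ^+ 2]expr2 ler_pM2l.
have := L S s W S0 Sy W0 sW s2.
have -> : \sum_i \sum_j s i j * excess R S i j = sqnorm s.
  apply: eq_bigr => i _; apply: eq_bigr => j _; rewrite /s expr2.
  by case: ifP => _; rewrite ?mul0r.
rewrite sE -mulrA ler_pM2l // /W.
have -> : y * (t / (2 * y)) = t / 2 by field; rewrite gt_eqF.
lra.
Qed.

(** The level-1 inequality is tested on the indicator of [E]; the scale [1 + #|E| / n] dominates
    both its values and its normalised square sum. *)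
Lemma card_large_density (R : realFieldType) n (y M : R) (S : {set 'S_n}) (E : {set 'I_n * 'I_n}) :
  (0 < n)%N -> 1 <= y -> level1 n y -> (0 < #|S|)%N ->
  #|('Alt_('I_n))%g|%:R <= #|S|%:R * y ^+ 666 -> 4 * y <= M ->
  (forall u, u \in E -> M <= density R S u.1 u.2) ->
  #|E|%:R * M <= 2 * n%:R * y.
Proof.
move=> n0 y1 L S0 Sy yM EM.
have y0 : 0 < y by apply: lt_le_trans y1.
have n0' : 0 < n%:R :> R by rewrite ltr0n.
pose s i j : R := ((i, j) \in E)%:R.
pose W : R := 1 + #|E|%:R / n%:R.
have E0 : 0 <= #|E|%:R / n%:R :> R by rewrite divr_ge0 ?ler0n.
have sW i j : `|s i j| <= W.
  rewrite /s /W; case: (_ \in E); rewrite ?normr1 ?normr0; lra.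
have sumE (F : 'I_n -> 'I_n -> R) : \sum_i \sum_j s i j * F i j = \sum_(u in E) F u.1 u.2.
  rewrite pair_bigA [RHS]big_mkcond; apply: eq_bigr => -[i j] _ /=.
  by rewrite /s; case: ifP; rewrite ?mul1r ?mul0r.
have s2 : \sum_i \sum_j s i j ^+ 2 <= n%:R * W ^+ 2.
  under eq_bigr do under eq_bigr do rewrite expr2.
  rewrite sumE (eq_bigr (fun=> 1)); last by move=> [i j] uE; rewrite /s uE.
  rewrite sumr_const.
  have -> : #|E|%:R = n%:R * (#|E|%:R / n%:R) :> R by rewrite mulrC divfK // gt_eqF.
  rewrite ler_pM2l // /W; nra.
have W0 : 0 < W by rewrite /W; lra.
have := L S s W S0 Sy W0 sW s2; rewrite sumE.
have : #|E|%:R * (M - 1) <= \sum_(u in E) excess R S u.1 u.2.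
  rewrite mulr_natl -sumr_const; apply: ler_sum => u uE.
  by rewrite lerD2r EM.
have -> : n%:R * y * W = n%:R * y + y * #|E|%:R by rewrite /W; field; rewrite gt_eqF.
have : 0 <= #|E|%:R :> R by rewrite ler0n.
nra.
Qed.

Lemma exprD2 (R : pzSemiRingType) (x : R) a b d : (a + b == d)%N -> x ^+ d = x ^+ a * x ^+ b.
Proof. by move=> /eqP <-; rewrite exprD. Qed.

Lemma exprD3 (R : pzSemiRingType) (x : R) a b c d : (a + b + c == d)%N ->
  x ^+ d = x ^+ a * x ^+ b * x ^+ c.
Proof. by move=> /eqP <-; rewrite !exprD. Qed.

Section TriLower.
Variables (R : realFieldType) (n : nat).
Implicit Types (x y z : 'I_n -> 'I_n -> R).

Lemma tri_geN x y z X Y Z E : sqnorm x <= X -> sqnorm y <= Y -> sqnorm z <= Z ->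
  0 <= E -> X * Y * Z <= E ^+ 2 -> - E <= tri x y z.
Proof.
move=> xX yY zZ E0 XYZ; have : tri x y z ^+ 2 <= E ^+ 2.
  apply: le_trans (tri_sq_le x y z) _; apply: le_trans XYZ.
  have := sqnorm_ge0 x; have := sqnorm_ge0 y; have := sqnorm_ge0 z => z0 y0 x0.
  by apply: ler_pM; rewrite ?mulr_ge0 //; apply: ler_pM.
rewrite leNgt => H; rewrite leNgt; apply/negP => t; move/negP: H; apply.
have t' : E < - tri x y z by rewrite ltrNr.
by rewrite -[X in _ < X]sqrrN ltr_pXn2r // ?nnegrE // ltW // (le_lt_trans E0).
Qed.

Lemma tri_ge0 x y z : (forall i j, 0 <= x i j) -> (forall i j, 0 <= y i j) ->
  (forall i j, 0 <= z i j) -> 0 <= tri x y z.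
Proof. by move=> x0 y0 z0; do 3!(apply: sumr_ge0 => ? _); rewrite !mulr_ge0. Qed.

Lemma tri0l x y z : (forall i j, x i j = 0) -> tri x y z = 0.
Proof. by move=> x0; rewrite /tri; do 3!(rewrite big1 // => ? _); rewrite x0 !mul0r. Qed.

Lemma tri0m x y z : (forall i j, y i j = 0) -> tri x y z = 0.
Proof. by move=> y0; rewrite /tri; do 3!(rewrite big1 // => ? _); rewrite y0 mulr0 mul0r. Qed.

(** Of the 27 terms of the expansion, the 8 without an [s] are nonnegative, and 16 of the others are
    at least [- E] by Cauchy-Schwarz. The three terms with one [s] and two [v] have no such bound
    and are kept; [tri v1 x2 v3] also keeps the nonnegative terms with [v1] and [v3]. *)
Lemma tri_lower (x1 x2 x3 s1 s2 s3 b1 b2 b3 v1 v2 v3 : 'I_n -> 'I_n -> R) S B V E :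
  (forall i j, x1 i j = s1 i j + (b1 i j + v1 i j)) ->
  (forall i j, x2 i j = s2 i j + (b2 i j + v2 i j)) ->
  (forall i j, x3 i j = s3 i j + (b3 i j + v3 i j)) ->
  (forall i j, 0 <= b1 i j) -> (forall i j, 0 <= b2 i j) -> (forall i j, 0 <= b3 i j) ->
  (forall i j, 0 <= v1 i j) -> (forall i j, 0 <= v2 i j) -> (forall i j, 0 <= v3 i j) ->
  sqnorm s1 <= S -> sqnorm s2 <= S -> sqnorm s3 <= S ->
  sqnorm b1 <= B -> sqnorm b2 <= B -> sqnorm b3 <= B ->
  sqnorm v1 <= V -> sqnorm v2 <= V -> sqnorm v3 <= V ->
  0 <= E -> S * S * S <= E ^+ 2 -> S * S * B <= E ^+ 2 -> S * S * V <= E ^+ 2 ->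
  S * B * B <= E ^+ 2 -> S * B * V <= E ^+ 2 ->
  tri v1 x2 v3 + tri v1 v2 s3 + tri s1 v2 v3 <= tri x1 x2 x3 + 16 * E.
Proof.
move=> X1 X2 X3 b10 b20 b30 v10 v20 v30 S1 S2 S3 B1 B2 B3 V1 V2 V3 E0 SSS SSB SSV SBB SBV.
have SBS : S * B * S <= E ^+ 2 by rewrite mulrAC.
have BSS : B * S * S <= E ^+ 2 by rewrite -mulrA mulrC.
have SVS : S * V * S <= E ^+ 2 by rewrite mulrAC.
have VSS : V * S * S <= E ^+ 2 by rewrite -mulrA mulrC.
have BSB : B * S * B <= E ^+ 2 by rewrite [B * S]mulrC.
have BBS : B * B * S <= E ^+ 2 by rewrite mulrC mulrA.
have SVB : S * V * B <= E ^+ 2 by rewrite mulrAC.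
have BSV : B * S * V <= E ^+ 2 by rewrite [B * S]mulrC.
have VSB : V * S * B <= E ^+ 2 by rewrite [V * S]mulrC mulrAC.
have BVS : B * V * S <= E ^+ 2 by rewrite mulrC mulrA.
have VBS : V * B * S <= E ^+ 2 by rewrite mulrC [V * B]mulrC mulrA.
have t1 := tri_geN S1 S2 S3 E0 SSS.
have t2 := tri_geN S1 S2 B3 E0 SSB.
have t3 := tri_geN S1 B2 S3 E0 SBS.
have t4 := tri_geN B1 S2 S3 E0 BSS.
have t5 := tri_geN S1 S2 V3 E0 SSV.
have t6 := tri_geN S1 V2 S3 E0 SVS.
have t7 := tri_geN V1 S2 S3 E0 VSS.
have t8 := tri_geN S1 B2 B3 E0 SBB.
have t9 := tri_geN B1 S2 B3 E0 BSB.
have t10 := tri_geN B1 B2 S3 E0 BBS.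
have t11 := tri_geN S1 B2 V3 E0 SBV.
have t12 := tri_geN S1 V2 B3 E0 SVB.
have t13 := tri_geN B1 S2 V3 E0 BSV.
have t14 := tri_geN V1 S2 B3 E0 VSB.
have t15 := tri_geN B1 V2 S3 E0 BVS.
have t16 := tri_geN V1 B2 S3 E0 VBS.
have p1 := tri_ge0 b10 b20 b30.
have p2 := tri_ge0 b10 b20 v30.
have p3 := tri_ge0 b10 v20 b30.
have p4 := tri_ge0 v10 b20 b30.
have p5 := tri_ge0 b10 v20 v30.
have p6 := tri_ge0 v10 v20 b30.
rewrite (tri_ext (fun i j => erefl (v1 i j)) X2 (fun i j => erefl (v3 i j))) (tri_ext X1 X2 X3).
rewrite !(triDl, triDm, triDr).
lra.
Qed.

End TriLower.

(** * Stars *)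

Section Clean.
Variables (R : realFieldType) (n : nat) (y : R).
Hypothesis y512 : 512 <= y.
Hypothesis ny : n%:R = y ^+ 1000.
Hypothesis L1 : level1 n y.
Implicit Types (S : {set 'S_n}) (V : rel 'I_n).

Lemma y_ge1 : 1 <= y. Proof. by apply: le_trans y512; rewrite ler1n. Qed.
Lemma y_gt0 : 0 < y. Proof. exact: lt_le_trans y_ge1. Qed.

Lemma n_gt512 : (512 <= n)%N.
Proof.
rewrite -(ler_nat R) ny; apply: le_trans y512 _; rewrite exprS ler_peMr //.
  exact: ltW y_gt0.
by apply: exprn_ege1; apply: y_ge1.
Qed.

Lemma y_pow_le a b : (a <= b)%N -> y ^+ a <= y ^+ b.
Proof. by move=> ab; apply: ler_weXn2l => //; apply: y_ge1. Qed.

Lemma y_pow_absorb c a b : c <= 512 -> (a < b)%N -> c * y ^+ a <= y ^+ b.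
Proof.
move=> c5 ab; apply: (@le_trans _ _ (y ^+ a.+1)); last exact: y_pow_le.
rewrite exprS ler_wpM2r ?exprn_ge0 ?(ltW y_gt0) //; exact: le_trans c5 y512.
Qed.

(* The medium part is nonnegative, since the excess is at least -1, so that products of
   medium and star parts can be dropped from lower bounds of [tri]. *)
Definition star_part V S i j : R := if V i j && (0 < excess R S i j) then excess R S i j else 0.
Definition small_part V S i j : R :=
  if ~~ (V i j && (0 < excess R S i j)) && (`|excess R S i j| <= y) then excess R S i j else 0.
Definition medium_part V S i j : R :=
  if ~~ (V i j && (0 < excess R S i j)) && ~~ (`|excess R S i j| <= y) then excess R S i j else 0.

Lemma excess_parts V S i j :
  excess R S i j = small_part V S i j + (medium_part V S i j + star_part V S i j).
Proof.
rewrite /small_part /medium_part /star_part.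
case: (V i j && _); rewrite /= ?add0r //.
by case: (`|_| <= y); rewrite /= ?add0r !addr0.
Qed.

Lemma star_part_ge0 V S i j : 0 <= star_part V S i j.
Proof. by rewrite /star_part; case: ifP => // /andP[_ /ltW]. Qed.

Lemma excess_large S i j : ~~ (`|excess R S i j| <= y) -> 0 < excess R S i j.
Proof.
rewrite -ltNge; case: (ltP 0 (excess R S i j)) => // e0.
rewrite ler0_norm // => H; have := excess_geN1 R S i j; have := y_ge1; move: H; lra.
Qed.

Lemma medium_part_ge0 V S i j : 0 <= medium_part V S i j.
Proof. by rewrite /medium_part; case: ifP => // /andP[_ /excess_large/ltW]. Qed.

Lemma small_part_geN1 V S i j : -1 <= small_part V S i j.
Proof. by rewrite /small_part; case: ifP => _; rewrite ?excess_geN1 // lerN10. Qed.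

Lemma density_le S i j : dense y S -> density R S i j <= y ^+ 661.
Proof.
move=> dS; have S0 := dense_gt0 dS; case: dS => Ss dS.
have n0 : 0 < n%:R :> R by rewrite ltr0n (leq_trans _ n_gt512).
rewrite /density ler_pdivrMr ?ltr0n // [X in _ <= X]mulrC; apply: le_trans dS.
have n3 : (3 < #|'I_n|)%N by rewrite card_ord; apply: leq_trans n_gt512.
rewrite -natrM ler_nat -(card_even_perm1 i j n3) card_ord mulnC leq_mul2r; apply/orP; right.
apply/subset_leq_card/subsetP => p; rewrite !inE => /andP[pS ->]; rewrite andbT.
by move/subsetP: Ss => /(_ _ pS); rewrite Alt_even.
Qed.

(** The last condition says that, on average over [p] in [S], at most one [i] satisfies
    [V i (p i)]. *)
Definition clean T V S := [/\ dense y S, forall i j, ~~ V i j -> density R S i j <= y ^+ T &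
  \sum_i \sum_j (if V i j then density R S i j else 0) <= n%:R].

Lemma dense666 S : dense y S -> #|('Alt_('I_n))%g|%:R <= #|S|%:R * y ^+ 666.
Proof.
case=> _ dS; apply: le_trans dS _; rewrite ler_wpM2l ?ler0n //; exact: y_pow_le.
Qed.

Lemma n_gt0R : 0 < n%:R :> R.
Proof. by rewrite ltr0n (leq_trans _ n_gt512). Qed.

Lemma sqnorm_small V S : dense y S -> sqnorm (small_part V S) <= 4 * y ^+ 1002.
Proof.
move=> dS; have n0 : (0 < n)%N by apply: leq_trans n_gt512.
have H i j : ~~ (V i j && (0 < excess R S i j)) && (`|excess R S i j| <= y) -> `|excess R S i j| <= y.
  by case/andP.
apply: le_trans (sqnorm_bounded n0 y_ge1 L1 (dense_gt0 dS) (dense666 dS) (lexx _) H) _.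
rewrite (@exprD2 _ y 1000 2 1002 isT) -ny expr2; move: (n%:R : R) => m.
by rewrite !mulrA.
Qed.

Lemma sqnorm_medium T V S : (0 < T)%N -> clean T V S ->
  sqnorm (medium_part V S) <= 4 * y ^+ (1001 + T).
Proof.
move=> T0 [dS ST _]; have n0 : (0 < n)%N by apply: leq_trans n_gt512.
have yT : y <= y ^+ T by rewrite -{1}[y]expr1 y_pow_le.
have H i j : ~~ (V i j && (0 < excess R S i j)) && ~~ (`|excess R S i j| <= y) -> `|excess R S i j| <= y ^+ T.
  case/andP => nV big; have e0 := excess_large big.
  move: nV; rewrite e0 andbT => /ST; rewrite gtr0_norm // => d.
  by apply: le_trans d; rewrite /excess gerBl.
apply: le_trans (sqnorm_bounded n0 y_ge1 L1 (dense_gt0 dS) (dense666 dS) yT H) _.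
by rewrite exprD (@exprD2 _ y 1000 1 1001 isT) -ny expr1 !mulrA.
Qed.

Lemma sqnorm_star T V S : clean T V S -> sqnorm (star_part V S) <= y ^+ 1661.
Proof.
case=> dS _ SV; apply: (@le_trans _ _ (y ^+ 661 * n%:R)); last first.
  by rewrite ny -exprD.
apply: (@le_trans _ _ (y ^+ 661 * \sum_i \sum_j (if V i j then density R S i j else 0))); last first.
  by rewrite ler_wpM2l // exprn_ge0 // ltW // y_gt0.
rewrite mulr_sumr; apply: ler_sum => i _; rewrite mulr_sumr; apply: ler_sum => j _.
rewrite /star_part; case: (V i j) => /=; last by rewrite expr0n mulr0.
have d0 := density_ge0 R S i j; have dl := density_le i j dS.
have y0 : 0 <= y ^+ 661 by apply: exprn_ge0; apply: ltW y_gt0.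
case: ifP => e0; last by rewrite expr0n mulr_ge0.
have el : excess R S i j <= density R S i j by rewrite /excess gerBl.
by rewrite expr2; apply: ler_pM; [exact: ltW|exact: ltW|exact: le_trans el dl|].
Qed.

(** The tightest product is small, medium, star: [1002 + 1250 + 1661 = 3913], below [2 * 1958]. The
    total error [16 * y ^+ 1958] is negligible against [n ^ 2], which is [y ^+ 2000]. *)
Lemma clean_tri_le V1 V2 V3 S1 S2 S3 : no_product S1 S2 S3 ->
  clean 249 V1 S1 -> clean 249 V2 S2 -> clean 249 V3 S3 ->
  tri (star_part V1 S1) (excess R S2) (star_part V3 S3)
  + tri (star_part V1 S1) (star_part V2 S2) (small_part V3 S3)
  + tri (small_part V1 S1) (star_part V2 S2) (star_part V3 S3)
  <= - (1 - y ^- 7) * y ^+ 2000.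
Proof.
move=> np C1 C2 C3.
have d1 : dense y S1 by case: C1. have d2 : dense y S2 by case: C2. have d3 : dense y S3 by case: C3.
have M := mixing_dense y512 ny d1 d2 d3 np.
have y0 := y_gt0.
have E2 : (y ^+ 1958) ^+ 2 = y ^+ 3916 by rewrite (@exprD2 _ y 1958 1958 3916 isT) expr2.
have c64 : 64 <= 512 :> R by rewrite ler_nat.
have c16 : 16 <= 512 :> R by rewrite ler_nat.
have := @tri_lower R n _ _ _ _ _ _ _ _ _ _ _ _ (4 * y ^+ 1002) (4 * y ^+ 1250) (y ^+ 1661) (y ^+ 1958)
  (excess_parts V1 S1) (excess_parts V2 S2) (excess_parts V3 S3)
  (medium_part_ge0 V1 S1) (medium_part_ge0 V2 S2) (medium_part_ge0 V3 S3)
  (star_part_ge0 V1 S1) (star_part_ge0 V2 S2) (star_part_ge0 V3 S3)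
  (sqnorm_small V1 d1) (sqnorm_small V2 d2) (sqnorm_small V3 d3)
  (@sqnorm_medium 249 V1 S1 isT C1) (@sqnorm_medium 249 V2 S2 isT C2) (@sqnorm_medium 249 V3 S3 isT C3)
  (sqnorm_star C1) (sqnorm_star C2) (sqnorm_star C3) (exprn_ge0 _ (ltW y0)).
rewrite E2.
have pw c a b d e : c <= 512 -> (a < b)%N -> d = c * y ^+ a -> e = y ^+ b -> d <= e.
  by move=> c5 ab -> ->; apply: y_pow_absorb.
move=> /(_ _ _ _ _ _)H; apply: le_trans (H _ _ _ _ _) _.
- apply: (pw 64 3006 3916 _ _ c64 isT _ (erefl _)).
  by rewrite (@exprD3 _ y 1002 1002 1002 3006 isT); move: (y ^+ 1002) => z0; ring.
- apply: (pw 64 3254 3916 _ _ c64 isT _ (erefl _)).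
  by rewrite (@exprD3 _ y 1002 1002 1250 3254 isT); move: (y ^+ 1002) (y ^+ 1250) => z0 z1; ring.
- apply: (pw 16 3665 3916 _ _ c16 isT _ (erefl _)).
  by rewrite (@exprD3 _ y 1002 1002 1661 3665 isT); move: (y ^+ 1002) (y ^+ 1661) => z0 z1; ring.
- apply: (pw 64 3502 3916 _ _ c64 isT _ (erefl _)).
  by rewrite (@exprD3 _ y 1002 1250 1250 3502 isT); move: (y ^+ 1002) (y ^+ 1250) => z0 z1; ring.
- apply: (pw 16 3913 3916 _ _ c16 isT _ (erefl _)).
  by rewrite (@exprD3 _ y 1002 1250 1661 3913 isT); move: (y ^+ 1002) (y ^+ 1250) (y ^+ 1661) => z0 z1 z2; ring.
apply: (@le_trans _ _ (- (1 - y ^- 8) * y ^+ 2000 + y ^+ 1959)).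
  apply: lerD; last exact: (@y_pow_absorb 16 1958 1959 c16 isT).
  by rewrite (@exprD2 _ y 1000 1000 2000 isT) -ny -expr2.
have -> : - (1 - y ^- 8) * y ^+ 2000 = y ^+ 1992 - y ^+ 2000.
  rewrite (@exprD2 _ y 8 1992 2000 isT); have := gt_eqF (exprn_gt0 8 y0).
  by move: (y ^+ 8) (y ^+ 1992) => z w z0; field; rewrite z0.
have -> : - (1 - y ^- 7) * y ^+ 2000 = y ^+ 1993 - y ^+ 2000.
  rewrite (@exprD2 _ y 7 1993 2000 isT); have := gt_eqF (exprn_gt0 7 y0).
  by move: (y ^+ 7) (y ^+ 1993) => z w z0; field; rewrite z0.
have c2 : 2 <= 512 :> R by rewrite ler_nat.
have := @y_pow_absorb 2 1992 1993 c2 isT; have := @y_pow_le 1959 1992 isT.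
by move: (y ^+ 1992) (y ^+ 1993) (y ^+ 2000) (y ^+ 1959); clear=> z1 z2 z3 z4; lra.
Qed.

(** With an empty star the only critical product is small, medium, medium. Densities up to
    [y ^+ 449] are affordable there, as [1002 + 1450 + 1450 = 3902] is still below [2 * 1958], and
    the form then stays far above [- n ^ 2]. *)
Lemma exists_large_density S1 S2 S3 : no_product S1 S2 S3 ->
  dense y S1 -> dense y S2 -> dense y S3 ->
  (forall i j, density R S1 i j <= y ^+ 449) -> (forall i j, density R S2 i j <= y ^+ 449) ->
  (forall i j, density R S3 i j <= y ^+ 449) -> False.
Proof.
move=> np d1 d2 d3 l1 l2 l3.
have M := mixing_dense y512 ny d1 d2 d3 np.
have y0 := y_gt0.
pose V0 (i j : 'I_n) := false.
have cl S : dense y S -> (forall i j, density R S i j <= y ^+ 449) -> clean 449 V0 S.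
  move=> dS lS; split=> //.
  by rewrite big1 ?ler0n // => i _; rewrite big1.
have star0 S : sqnorm (star_part V0 S) <= 0.
  by rewrite /sqnorm big1 // => i _; rewrite big1 // => j _; rewrite /star_part /= expr0n.
have E2 : (y ^+ 1958) ^+ 2 = y ^+ 3916 by rewrite (@exprD2 _ y 1958 1958 3916 isT) expr2.
have := @tri_lower R n _ _ _ _ _ _ _ _ _ _ _ _ (4 * y ^+ 1002) (4 * y ^+ 1450) 0 (y ^+ 1958)
  (excess_parts V0 S1) (excess_parts V0 S2) (excess_parts V0 S3)
  (medium_part_ge0 V0 S1) (medium_part_ge0 V0 S2) (medium_part_ge0 V0 S3)
  (star_part_ge0 V0 S1) (star_part_ge0 V0 S2) (star_part_ge0 V0 S3)
  (sqnorm_small V0 d1) (sqnorm_small V0 d2) (sqnorm_small V0 d3)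
  (@sqnorm_medium 449 V0 S1 isT (cl _ d1 l1)) (@sqnorm_medium 449 V0 S2 isT (cl _ d2 l2)) (@sqnorm_medium 449 V0 S3 isT (cl _ d3 l3))
  (star0 _) (star0 _) (star0 _) (exprn_ge0 _ (ltW y0)).
have ve S i j : star_part V0 S i j = 0 by [].
rewrite E2 (tri0l _ _ (ve S1)) (tri0l _ _ (ve S1)) (tri0m _ _ (ve S2)) !add0r.
have pw c a b d e : c <= 512 -> (a < b)%N -> d = c * y ^+ a -> e = y ^+ b -> d <= e.
  by move=> c5 ab -> ->; apply: y_pow_absorb.
have c64 : 64 <= 512 :> R by rewrite ler_nat.
have p0 a : 0 <= y ^+ a by apply: exprn_ge0; apply: ltW.
move=> /(_ _ _ _ _ _) H.
have {H} H : 0 <= tri (excess R S1) (excess R S2) (excess R S3) + 16 * y ^+ 1958.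
  apply: H.
  - apply: (pw 64 3006 3916 _ _ c64 isT _ (erefl _)).
    by rewrite (@exprD3 _ y 1002 1002 1002 3006 isT); move: (y ^+ 1002) => z0; ring.
  - apply: (pw 64 3454 3916 _ _ c64 isT _ (erefl _)).
    by rewrite (@exprD3 _ y 1002 1002 1450 3454 isT); move: (y ^+ 1002) (y ^+ 1450) => z0 z1; ring.
  - by rewrite mulr0; apply: p0.
  - apply: (pw 64 3902 3916 _ _ c64 isT _ (erefl _)).
    by rewrite (@exprD3 _ y 1002 1450 1450 3902 isT); move: (y ^+ 1002) (y ^+ 1450) => z0 z1; ring.
  - by rewrite mulr0; apply: p0.
move: M; rewrite (_ : n%:R ^+ 2 = y ^+ 2000); last by rewrite (@exprD2 _ y 1000 1000 2000 isT) -ny -expr2.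
have -> : - (1 - y ^- 8) * y ^+ 2000 = y ^+ 1992 - y ^+ 2000.
  rewrite (@exprD2 _ y 8 1992 2000 isT); have := gt_eqF (exprn_gt0 8 y0).
  by move: (y ^+ 8) (y ^+ 1992) => z w z0; field; rewrite z0.
have c16 : 16 <= 512 :> R by rewrite ler_nat.
have := @y_pow_absorb 16 1958 1959 c16 isT.
have := @y_pow_absorb 16 1992 1993 c16 isT.
have := @y_pow_le 1959 1992 isT; have := @y_pow_le 1993 2000 isT.
have : 0 < y ^+ 1992 by apply: exprn_gt0.
move: H; move: (tri _ _ _) (y ^+ 1992) (y ^+ 1993) (y ^+ 2000) (y ^+ 1958) (y ^+ 1959).
by clear=> t z1 z2 z3 z4 z5; lra.
Qed.

End Clean.

Lemma sum3_opp_le (R : realFieldType) (a b c t1 t2 t3 z : R) :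
  - a <= t1 -> - b <= t2 -> - c <= t3 -> t1 + t2 + t3 <= - z -> z <= a + b + c.
Proof. by move=> *; lra. Qed.

Lemma lt_sub_of_gaps (R : realFieldType) (a b c : R) :
  0 < a -> 16 * a <= b -> 16 * b <= c -> 3 * a < c - b.
Proof. by move=> *; lra. Qed.

Lemma lt_sum3_absurd (R : realFieldType) (a b d z w : R) :
  a <= z -> b <= z -> d <= z -> 3 * z < w -> w <= a + b + d -> False.
Proof. by move=> *; lra. Qed.

Section Stars.
Variables (R : realFieldType) (n : nat) (y : R).
Hypothesis y512 : 512 <= y.
Hypothesis ny : n%:R = y ^+ 1000.
Hypothesis L1 : level1 n y.
Implicit Types (S : {set 'S_n}) (V : rel 'I_n).
Local Notation star := (star_part R).

Definition star_row V S i : R := \sum_j star V S i j.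
Definition star_col V S j : R := \sum_i star V S i j.

Lemma star_row_ge0 V S i : 0 <= star_row V S i.
Proof. by apply: sumr_ge0 => j _; apply: star_part_ge0. Qed.

Lemma star_col_ge0 V S j : 0 <= star_col V S j.
Proof. by apply: sumr_ge0 => i _; apply: star_part_ge0. Qed.

Lemma star_le_density V S i j : star V S i j <= if V i j then density R S i j else 0.
Proof.
rewrite /star_part; case: (V i j) => //=.
by case: ifP => _; rewrite ?density_ge0 // /excess gerBl.
Qed.

Lemma star_row_le V S i : star_row V S i <= \sum_j (if V i j then density R S i j else 0).
Proof. by apply: ler_sum => j _; apply: star_le_density. Qed.

Lemma star_col_le V S j : star_col V S j <= \sum_i (if V i j then density R S i j else 0).
Proof. by apply: ler_sum => i _; apply: star_le_density. Qed.

Lemma sum_star_row_le T V S : clean y T V S -> \sum_i star_row V S i <= n%:R.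
Proof.
case=> _ _; apply: le_trans.
by apply: ler_sum => i _; apply: star_row_le.
Qed.

Lemma sum_star_col V S : \sum_j star_col V S j = \sum_i star_row V S i.
Proof. exact: exchange_big. Qed.

Lemma star_le V S i j : dense y S -> star V S i j <= y ^+ 661.
Proof.
move=> dS; apply: le_trans (star_le_density _ _ _ _) _; case: ifP => _.
  exact: (density_le y512 ny).
by apply: exprn_ge0; apply: ltW; apply: y_gt0.
Qed.

Lemma tri_star13_ge V1 V3 S1 S2 S3 : - (\sum_i star_row V1 S1 i * star_row V3 S3 i) <=
  tri (star V1 S1) (excess R S2) (star V3 S3).
Proof.
rewrite -sumrN; apply: ler_sum => i _.
rewrite mulr_suml -sumrN; apply: ler_sum => j _; rewrite mulr_sumr -sumrN; apply: ler_sum => k _.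
by rewrite mulrAC -mulrN1 ler_wpM2l ?excess_geN1 // mulr_ge0 ?star_part_ge0.
Qed.

Lemma tri_star12_ge V1 V2 V3 S1 S2 S3 : - (\sum_j star_col V1 S1 j * star_row V2 S2 j) <=
  tri (star V1 S1) (star V2 S2) (small_part y V3 S3).
Proof.
rewrite [X in _ <= X]exchange_big -sumrN; apply: ler_sum => j _.
rewrite mulr_suml -sumrN; apply: ler_sum => i _; rewrite mulr_sumr -sumrN; apply: ler_sum => k _.
by rewrite -mulrN1 ler_wpM2l ?small_part_geN1 // mulr_ge0 ?star_part_ge0.
Qed.

Lemma tri_star23_ge V1 V2 V3 S1 S2 S3 : - (\sum_k star_col V2 S2 k * star_col V3 S3 k) <=
  tri (small_part y V1 S1) (star V2 S2) (star V3 S3).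
Proof.
rewrite [X in _ <= X]exchange_big [X in _ <= X](eq_bigr _ (fun j _ => exchange_big _ _ _ _ _ _)) /=.
rewrite [X in _ <= X]exchange_big -sumrN; apply: ler_sum => k _.
rewrite mulr_suml -sumrN; apply: ler_sum => j _; rewrite mulr_sumr -sumrN; apply: ler_sum => i _.
by rewrite -mulrA -mulN1r ler_wpM2r ?small_part_geN1 // mulr_ge0 ?star_part_ge0.
Qed.

(** Each of the three kept terms has only one factor of unknown sign, and it is at least -1; the
    sums over the two star factors then separate. *)
Lemma clean_star_sums V1 V2 V3 S1 S2 S3 : no_product S1 S2 S3 ->
  clean y 249 V1 S1 -> clean y 249 V2 S2 -> clean y 249 V3 S3 ->
  (1 - y ^- 7) * y ^+ 2000 <= \sum_i star_row V1 S1 i * star_row V3 S3 i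
   + \sum_j star_col V1 S1 j * star_row V2 S2 j + \sum_k star_col V2 S2 k * star_col V3 S3 k.
Proof.
move=> np C1 C2 C3; have := clean_tri_le y512 ny L1 np C1 C2 C3; rewrite mulNr.
exact: sum3_opp_le (tri_star13_ge _ _ _ _ _) (tri_star12_ge _ _ _ _ _ _) (tri_star23_ge _ _ _ _ _ _).
Qed.

Lemma sum_mul_le (I : finType) (f g : I -> R) a b : (forall i, 0 <= g i) ->
  (forall i, f i <= a) -> 0 <= a -> \sum_i g i <= b -> \sum_i f i * g i <= a * b.
Proof.
move=> g0 fa a0 gb; apply: (@le_trans _ _ (\sum_i a * g i)).
  by apply: ler_sum => i _; apply: ler_wpM2r.
by rewrite -mulr_sumr ler_wpM2l.
Qed.

Definition row_clean x S := clean y 249 (fun i _ => i == x) S.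
Definition col_clean x S := clean y 249 (fun _ j => j == x) S.

Lemma star_row0 x S i : i != x -> star_row (fun i _ => i == x) S i = 0.
Proof. by move=> /negPf ix; rewrite /star_row big1 // => j _; rewrite /star_part ix. Qed.

Lemma star_colE x S j : star_col (fun i _ => i == x) S j = star (fun i _ => i == x) S x j.
Proof.
rewrite /star_col (bigD1 x) //= big1 ?addr0 // => i /negPf ix.
by rewrite /star_part ix.
Qed.

Lemma star_rowE x S i : star_row (fun _ j => j == x) S i = star (fun _ j => j == x) S i x.
Proof.
rewrite /star_row (bigD1 x) //= big1 ?addr0 // => j /negPf jx.
by rewrite /star_part jx.
Qed.

Lemma y1661_lt : 3 * (y ^+ 661 * n%:R) < (1 - y ^- 7) * y ^+ 2000.
Proof.
have y0 := y_gt0 y512.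
have -> : (1 - y ^- 7) * y ^+ 2000 = y ^+ 2000 - y ^+ 1993.
  rewrite (@exprD2 _ y 7 1993 2000 isT); have := gt_eqF (exprn_gt0 7 y0).
  by move: (y ^+ 7) (y ^+ 1993) => z w z0; field; rewrite z0.
rewrite ny -exprD -[(661 + 1000)%N]/1661%N.
have c16 : 16 <= 512 :> R by rewrite ler_nat.
apply: lt_sub_of_gaps; first exact: exprn_gt0.
  exact: (@y_pow_absorb _ _ y512 16 1661 1993 c16 isT).
exact: (@y_pow_absorb _ _ y512 16 1993 2000 c16 isT).
Qed.

Lemma sum_star_col_row_le x S1 S2 : row_clean x S1 -> row_clean x S2 ->
  \sum_j star_col (fun i _ => i == x) S1 j * star_row (fun i _ => i == x) S2 j <= y ^+ 661 * n%:R.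
Proof.
move=> C1 C2; have d1 : dense y S1 by case: C1.
apply: sum_mul_le => [i|i||]; first exact: star_row_ge0.
- by rewrite star_colE; apply: star_le.
- exact/exprn_ge0/ltW/(y_gt0 y512).
- exact: sum_star_row_le C2.
Qed.

Lemma sum_star_col_col_le T V x S2 S3 : row_clean x S2 -> clean y T V S3 ->
  \sum_k star_col (fun i _ => i == x) S2 k * star_col V S3 k <= y ^+ 661 * n%:R.
Proof.
move=> C2 C3; have d2 : dense y S2 by case: C2.
apply: sum_mul_le => [i|i||]; first exact: star_col_ge0.
- by rewrite star_colE; apply: star_le.
- exact/exprn_ge0/ltW/(y_gt0 y512).
- by rewrite sum_star_col; apply: sum_star_row_le C3.
Qed.

(** A column of a row star has a single entry, at most [y ^+ 661], so both column sums are at most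
    [y ^+ 1661]. The row sum, which alone could be of order [n ^ 2], vanishes because the two rows
    differ. *)
Lemma star_exclusion_row x x' S1 S2 S3 : x != x' -> row_clean x S1 -> row_clean x S2 ->
  row_clean x' S3 -> ~ no_product S1 S2 S3.
Proof.
move=> xx' C1 C2 C3 np; have := clean_star_sums np C1 C2 C3.
have d1 : dense y S1 by case: C1. have d2 : dense y S2 by case: C2. have d3 : dense y S3 by case: C3.
have y0 : 0 <= y ^+ 661 by apply/exprn_ge0/ltW/(y_gt0 y512).
rewrite [X in X + _ + _](_ : _ = 0); last first.
  rewrite big1 // => i _; have [->|ix] := eqVneq i x; last by rewrite star_row0 // mul0r.
  by rewrite [X in _ * X]star_row0 // mulr0.
have BB := sum_star_col_row_le C1 C2; have DD := sum_star_col_col_le C2 C3.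
by apply: (lt_sum3_absurd _ BB DD y1661_lt); rewrite mulr_ge0 ?ler0n.
Qed.

(** Here the row sum is negligible as well: each row of a column star has a single entry. *)
Lemma star_exclusion_col x z S1 S2 S3 : row_clean x S1 -> row_clean x S2 ->
  col_clean z S3 -> ~ no_product S1 S2 S3.
Proof.
move=> C1 C2 C3 np; have := clean_star_sums np C1 C2 C3.
have d1 : dense y S1 by case: C1. have d2 : dense y S2 by case: C2. have d3 : dense y S3 by case: C3.
have y0 : 0 <= y ^+ 661 by apply/exprn_ge0/ltW/(y_gt0 y512).
set A := (X in X + _ + _).
have AA : A <= y ^+ 661 * n%:R.
  rewrite /A; under eq_bigr do rewrite mulrC.
  apply: sum_mul_le => // [i|i|]; first exact: star_row_ge0.
    by rewrite star_rowE; apply: star_le.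
  exact: sum_star_row_le C1.
have BB := sum_star_col_row_le C1 C2; have DD := sum_star_col_col_le C2 C3.
exact: (lt_sum3_absurd AA BB DD y1661_lt).
Qed.

End Stars.

(** * Extraction of a star from a product-free set *)

Lemma hits_sub n (S S' : {set 'S_n}) i j : S' \subset S -> (hits S' i j <= hits S i j)%N.
Proof.
move=> SS; apply/subset_leq_card/subsetP => p; rewrite !inE => /andP[pS ->].
by rewrite (subsetP SS).
Qed.

Lemma density_sub (R : realFieldType) n (S S' : {set 'S_n}) c i j : S' \subset S ->
  (0 < #|S'|)%N -> #|S|%:R <= c * #|S'|%:R -> density R S' i j <= c * density R S i j.
Proof.
move=> SS S'0 c1; have S0 : (0 < #|S|)%N by apply: leq_trans S'0 (subset_leq_card SS).
rewrite /density ler_pdivrMr ?ltr0n // mulrA mulrAC ler_pdivlMr ?ltr0n //.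
rewrite [X in _ <= X]mulrAC [X in _ <= X]mulrC; apply: ler_pM => //; rewrite ?mulr_ge0 ?ler0n //.
by rewrite ler_wpM2l ?ler0n // ler_nat hits_sub.
Qed.

Lemma density_eq0 (R : realFieldType) n (S : {set 'S_n}) i j :
  (forall p, p \in S -> p i != j) -> density R S i j = 0.
Proof.
move=> Sij; rewrite /density /hits (_ : [set p in S | p i == j] = set0) ?cards0 ?mulr0 ?mul0r //.
by apply/setP => p; rewrite !inE; apply/negP => /andP[/Sij/negPf ->].
Qed.

Lemma leq_card_bigcup (I T : finType) (A : {set I}) (F : I -> {set T}) :
  (#|\bigcup_(i in A) F i| <= \sum_(i in A) #|F i|)%N.
Proof.
apply: (big_ind2 (fun (X : {set T}) m => #|X| <= m)%N); rewrite ?cards0 //.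
move=> X m Y k Xm Yk; apply: leq_trans (leq_add Xm Yk).
by rewrite cardsU leq_subr.
Qed.

Lemma card_two_hits n (V L : {set 'I_n * 'I_n}) (C : {set 'S_n}) : (4 < n)%N ->
  (forall p, p \in C -> ~~ odd_perm p /\ exists u w, [/\ u \in V, w \in L, u.1 != w.1,
    p u.1 = u.2 & p w.1 = w.2]) ->
  (#|C| * (n * n.-1) <= #|V| * #|L| * #|('Alt_('I_n))%g|)%N.
Proof.
move=> n4 CP.
pose D (u w : 'I_n * 'I_n) : {set 'S_n} :=
  [set p | [&& ~~ odd_perm p, p u.1 == u.2, p w.1 == w.2 & u.1 != w.1]].
have D_le u w : (#|D u w| * (n * n.-1) <= #|('Alt_('I_n))%g|)%N.
  have [uw|uw] := eqVneq u.1 w.1.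
    rewrite (_ : D u w = set0) ?cards0 // .
    by apply/setP => p; rewrite !inE uw eqxx /= !andbF.
  have [uw2|uw2] := eqVneq u.2 w.2.
    rewrite (_ : D u w = set0) ?cards0 //.
    apply/setP => p; rewrite !inE; apply/negP => /and4P[_ /eqP p1 /eqP p2 _].
    by case/eqP: uw; apply: (@perm_inj _ p); rewrite p1 p2.
  have T4 : (4 < #|'I_n|)%N by rewrite card_ord.
  rewrite -(card_even_perm2 T4 uw uw2) card_ord leq_mul2r; apply/orP; right.
  by apply/subset_leq_card/subsetP => p; rewrite !inE => /and4P[-> -> -> _].
have CD : (#|C| <= \sum_(u in V) \sum_(w in L) #|D u w|)%N.
  have CU : C \subset \bigcup_(u in V) \bigcup_(w in L) D u w.
    apply/subsetP => p /CP[p_even [u [w [uV wL uw pu pw]]]].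
    apply/bigcupP; exists u => //; apply/bigcupP; exists w => //.
    by rewrite inE p_even pu pw !eqxx uw.
  apply: leq_trans (subset_leq_card CU) _.
  apply: leq_trans (leq_card_bigcup _ _) _.
  by apply: leq_sum => u uV; apply: leq_card_bigcup.
apply: (@leq_trans (\sum_(u in V) \sum_(w in L) #|('Alt_('I_n))%g|)).
  rewrite (leq_trans (leq_mul CD (leqnn _))) // big_distrl leq_sum //= => u uV.
  by rewrite big_distrl leq_sum.
by rewrite !sum_nat_const mulnA.
Qed.

Section Structure.
Variables (R : realFieldType) (n : nat) (y : R).
Hypothesis y512 : 512 <= y.
Hypothesis ny : n%:R = y ^+ 1000.
Hypothesis L1 : level1 n y.
Implicit Types (S A : {set 'S_n}) (V L : {set 'I_n * 'I_n}).
Local Notation N := (#|('Alt_('I_n))%g|%:R : R).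

Definition level_set S t := [set u : 'I_n * 'I_n | y ^+ t <= density R S u.1 u.2].

Lemma card_level_set S t : (2 <= t)%N -> dense y S -> #|level_set S t|%:R * y ^+ t <= 2 * n%:R * y.
Proof.
move=> t2 dS; have y1 := y_ge1 y512; have y0 := y_gt0 y512.
apply: (card_large_density _ y1 L1 (dense_gt0 dS) (dense666 y512 dS)).
- by apply: leq_trans (n_gt512 y512 ny).
- have c4 : 4 <= 512 :> R by rewrite ler_nat.
  by rewrite -{1}[y]expr1; apply: (y_pow_absorb y512 c4).
- by move=> u; rewrite inE.
Qed.

(* Two prescribed hits have probability about [1 / n ^ 2], so a few thousandths in
   the exponents leave room to spare. *)
Lemma card_double_level_hits S V t (C : {set 'S_n}) : dense y S -> (2 <= t)%N ->
  (forall p, p \in C -> ~~ odd_perm p /\ exists u w, [/\ u \in V, w \in level_set S t, u.1 != w.1,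
    p u.1 = u.2 & p w.1 = w.2]) ->
  #|C|%:R * n%:R * y ^+ t <= 4 * y * #|V|%:R * N.
Proof.
move=> dS t2 CP.
have n512 := n_gt512 y512 ny; have y0 := y_gt0 y512; have n0 := n_gt0R y512 ny.
have n4 : (4 < n)%N by apply: leq_trans n512.
have := card_two_hits n4 CP; rewrite -(ler_nat R) !natrM.
have nn : n%:R <= 2 * n.-1%:R :> R by rewrite -natrM ler_nat; move: n512; lia.
have := card_level_set t2 dS.
move: (n.-1%:R : R) nn => n1 nn.
have yt : 0 < y ^+ t by apply: exprn_gt0.
move: (#|level_set S t|%:R) (#|V|%:R) (#|C|%:R) N (ler0n R #|V|) (ler0n R #|C|) (ler0n R #|('Alt_('I_n))%g|) => l v c N0 v0 c0 N00 lt H.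
rewrite -(ler_pM2r n0).
apply: (@le_trans _ _ (2 * (c * (n%:R * n1)) * y ^+ t)).
  rewrite (_ : c * n%:R * y ^+ t * n%:R = n%:R * (c * n%:R * y ^+ t)); last by rewrite mulrC.
  rewrite (_ : 2 * (c * (n%:R * n1)) * y ^+ t = (2 * n1) * (c * n%:R * y ^+ t)); last by ring.
  by apply: ler_wpM2r => //; rewrite !mulr_ge0 // ltW.
apply: (@le_trans _ _ (2 * (v * l * N0) * y ^+ t)).
  by rewrite ler_pM2r // ler_pM2l.
rewrite (_ : 2 * (v * l * N0) * y ^+ t = 2 * v * N0 * (l * y ^+ t)); last by ring.
rewrite (_ : 4 * y * v * N0 * n%:R = 2 * v * N0 * (2 * n%:R * y)); last by ring.
by apply: ler_wpM2l => //; rewrite !mulr_ge0.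
Qed.

End Structure.

Lemma star_card_aux (R : realFieldType) (n a s : R) : 0 < n -> 0 < a ->
  n <= 6 * (n / a * s) -> a <= 6 * s.
Proof.
move=> n0 a0; rewrite (_ : 6 * (n / a * s) = n * (6 * s / a)); last by field; rewrite gt_eqF.
by rewrite -[X in X <= _]mulr1 ler_pM2l // ler_pdivlMr // mul1r.
Qed.

Lemma lt_sum3_square_absurd (R : realFieldType) (n e s1 s2 s3 : R) : 0 < n -> e <= 1 / 4 ->
  s1 <= n / 6 * n -> s2 <= n / 6 * n -> s3 <= n / 6 * n ->
  (1 - e) * (n * n) <= s1 + s2 + s3 -> False.
Proof.
move=> n0 e1 h1 h2 h3 h0; have nn : 0 < n * n by rewrite mulr_gt0.
have : e * (n * n) <= 1 / 4 * (n * n) by rewrite ler_pM2r.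
lra.
Qed.

Lemma star_count_aux (R : realFieldType) (a N n y v c z248 z448 z661 z694 : R) :
  36 * N <= a * z661 -> 0 < n -> 0 < y -> 0 <= c -> 0 <= N -> 0 < z448 -> 0 < z661 ->
  z448 * z248 = y * y * z694 -> 16 * z661 <= z694 ->
  v * z448 <= 2 * n * y -> c * n * z248 <= 4 * y * v * N -> 72 * c <= a.
Proof.
move=> aN n0 y0 c0 N0 z4 z6 E zz h2 h1.
have H1 : c * z694 <= 8 * N.
  rewrite -(ler_pM2l (_ : 0 < n * (y * y))) ?mulr_gt0 //.
  apply: (@le_trans _ _ (z448 * (4 * y * v * N))).
    rewrite (_ : n * (y * y) * (c * z694) = z448 * (c * n * z248)); first by rewrite ler_pM2l.
    rewrite (_ : z448 * (c * n * z248) = c * n * (z448 * z248)); last by ring.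
    by rewrite E; ring.
  rewrite (_ : z448 * _ = 4 * y * N * (v * z448)); last by ring.
  rewrite (_ : n * (y * y) * (8 * N) = 4 * y * N * (2 * n * y)); last by ring.
  by rewrite ler_wpM2l // !mulr_ge0 // ltW.
have H2 : c * (16 * z661) <= 8 * N by apply: le_trans H1; rewrite ler_wpM2l.
by rewrite -(ler_pM2r z6); move: H2 aN; lra.
Qed.

Section DensitySums.
Variables (R : realFieldType) (n : nat) (S : {set 'S_n}).
Implicit Types (V : rel 'I_n) (i j x : 'I_n).

Lemma density_rel V i j : (if V i j then density R S i j else 0) =
  n%:R / #|S|%:R * \sum_(p in S) (V i j && (p i == j))%:R.
Proof.
case: (V i j) => /=; last by rewrite big1 ?mulr0.
by rewrite /density hitsE mulrAC.
Qed.

Lemma sum_density_rel_row V x : \sum_j (if V x j then density R S x j else 0) =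
  n%:R / #|S|%:R * \sum_(p in S) (V x (p x))%:R.
Proof.
under eq_bigr do rewrite density_rel.
rewrite -mulr_sumr exchange_big; congr (_ * _); apply: eq_bigr => p _ /=.
rewrite (bigD1 (p x)) //= eqxx andbT big1 ?addr0 // => j jp.
by rewrite eq_sym (negPf jp) andbF.
Qed.

Lemma sum_density_rel_col V x : \sum_i (if V i x then density R S i x else 0) =
  n%:R / #|S|%:R * \sum_(p in S) (V ((p^-1)%g x) x)%:R.
Proof.
under eq_bigr do rewrite density_rel.
rewrite -mulr_sumr exchange_big; congr (_ * _); apply: eq_bigr => p _ /=.
rewrite (bigD1 ((p^-1)%g x)) //= permKV eqxx andbT big1 ?addr0 // => i ip.
rewrite (_ : (p i == x) = false) ?andbF //; apply: contraNF ip => /eqP <-.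
by rewrite permK.
Qed.

Lemma sum_density_rel V : \sum_i \sum_j (if V i j then density R S i j else 0) =
  n%:R / #|S|%:R * \sum_(p in S) \sum_i (V i (p i))%:R.
Proof.
under eq_bigr do rewrite sum_density_rel_row.
by rewrite -mulr_sumr exchange_big.
Qed.

End DensitySums.

Section StarStructure.
Variables (R : realFieldType) (n : nat) (y : R).
Hypothesis y512 : 512 <= y.
Hypothesis ny : n%:R = y ^+ 1000.
Hypothesis L1 : level1 n y.
Implicit Types (S A : {set 'S_n}) (V L : {set 'I_n * 'I_n}).
Local Notation N := (#|('Alt_('I_n))%g|%:R : R).

Lemma dense_sub S A c : A \subset ('Alt_('I_n))%g -> S \subset A ->
  c * N <= #|A|%:R * y ^+ 661 -> 0 < c -> #|A|%:R <= c * #|S|%:R -> dense y S.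
Proof.
move=> As SA cA c0 AS; split; first exact: subset_trans SA As.
rewrite -(ler_pM2l c0) mulrA; apply: le_trans cA _.
by apply: ler_wpM2r => //; apply/exprn_ge0/ltW/(y_gt0 y512).
Qed.

(** The thresholds 448 and 248 lie one power of [y] below those of [exists_large_density] and
    [clean_tri_le], which pays for passing to subsets. Their sum exceeds 661 with room, so a [V]-hit
    accompanied by an [L]-hit in another row is rare; without such pairs the [V]-hit is unique. The
    factor 18 is 3 for removing [B] and [C], times 6 for selecting a row or column. *)
Lemma star_structure A : A \subset ('Alt_('I_n))%g -> no_product A A A ->
  36 * N <= #|A|%:R * y ^+ 661 ->
  exists (S : {set 'S_n}) (x : 'I_n), [/\ S \subset A, #|A|%:R <= 18 * #|S|%:R :> R &
    row_clean y x S \/ col_clean y x S].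
Proof.
move=> As np A36.
have c2 : 2 <= 512 :> R by rewrite ler_nat.
have c16 : 16 <= 512 :> R by rewrite ler_nat.
have y0 := y_gt0 y512; have n512 := n_gt512 y512 ny; have n0 := n_gt0R y512 ny.
have N0 : 0 < N by rewrite ltr0n Alt_gt0.
have a0 : 0 < #|A|%:R :> R.
  rewrite lt_neqAle ler0n andbT eq_sym; apply: contraTneq A36 => ->.
  by rewrite mul0r -ltNge mulr_gt0.
have A0 : (0 < #|A|)%N by rewrite -(ltr0n R).
have dA : dense y A.
  by apply: (dense_sub As (subxx _) A36) => //; rewrite ler_peMl ?ler1n ?ltW.
pose V := level_set y A 448; pose L := level_set y A 248.
have VL u : u \in V -> u \in L.
  by rewrite !inE; apply: le_trans; apply: y_pow_le.
pose hitV (p : 'S_n) := [exists i, (i, p i) \in V].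
pose B := [set p in A | ~~ hitV p].
pose C := [set p in A | [exists u in V, exists w in L, [&& u.1 != w.1, p u.1 == u.2 & p w.1 == w.2]]].
have BA : B \subset A by apply/subsetP => p; rewrite inE => /andP[].
have Bsmall : 2 * #|B|%:R <= #|A|%:R :> R.
  rewrite leNgt; apply/negP => BB.
  have dB : dense y B by apply: (dense_sub As BA (_ : 2 * N <= _)) => //; [move: A36 N0; lra|exact: ltW].
  have npB : no_product B B B.
    by move=> p q pB qB; apply: contra (np p q (subsetP BA _ pB) (subsetP BA _ qB)); apply: subsetP.
  have dens i j : density R B i j <= y ^+ 449.
    have [ijV|ijV] := boolP ((i, j) \in V).
      rewrite density_eq0 ?exprn_ge0 ?(ltW y0) // => p; rewrite inE => /andP[_].
      by apply: contraNneq => pij; apply/existsP; exists i; rewrite pij.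
    apply: (le_trans _ (@y_pow_absorb _ _ y512 2 448 449 c2 isT)).
    have B0 : (0 < #|B|)%N by apply: dense_gt0 dB.
    apply: le_trans (density_sub i j BA B0 (ltW BB)) _.
    by rewrite ler_pM2l //; apply: ltW; rewrite inE -ltNge in ijV.
  exact: (@exists_large_density R n y y512 ny L1 B B B npB dB dB dB dens dens dens).
have VP p : p \in A -> p \notin B -> exists i, (i, p i) \in V.
  by rewrite inE => -> /negPn/existsP.
have Csmall : 72 * #|C|%:R <= #|A|%:R :> R.
  have CP p : p \in C -> ~~ odd_perm p /\ exists u w, [/\ u \in V, w \in L, u.1 != w.1,
      p u.1 = u.2 & p w.1 = w.2].
    rewrite inE => /andP[pA /exists_inP[u uV /exists_inP[w wL /and3P[uw /eqP pu /eqP pw]]]].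
    split; first by rewrite -Alt_even; apply: (subsetP As).
    by exists u, w.
  have h1 := card_double_level_hits y512 ny L1 dA (isT : (1 < 248)%N) CP.
  have h2 := card_level_set y512 ny L1 (isT : (1 < 448)%N) dA.
  have E : y ^+ 448 * y ^+ 248 = y * y * y ^+ 694.
    by rewrite -(@exprD2 _ y 448 248 696 isT) -[y * y]expr2 -(@exprD2 _ y 2 694 696 isT).
  exact: (star_count_aux A36 n0 y0 (ler0n _ _) (ltW N0) (exprn_gt0 _ y0) (exprn_gt0 _ y0) E
    (@y_pow_absorb _ _ y512 16 661 694 c16 isT) h2 h1).
pose A' := A :\: (B :|: C).
have A'A : A' \subset A by apply: subsetDl.
have A'large : #|A|%:R <= 3 * #|A'|%:R :> R.
  have : (#|A| <= #|A'| + (#|B| + #|C|))%N.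
    rewrite -(cardsID (B :|: C) A) addnC leq_add2l.
    apply: leq_trans (subset_leq_card (subsetIr _ _)) _.
    by rewrite cardsU leq_subr.
  rewrite -(ler_nat R) !natrD; move: Bsmall Csmall a0; lra.
have A'0 : (0 < #|A'|)%N by rewrite -(ltr0n R); move: A'large a0; lra.
have A'P p : p \in A' -> exists2 i, (i, p i) \in V & forall k, (k, p k) \in L -> k = i.
  rewrite !inE negb_or => /andP[/andP[pB pC] pA].
  have [i iV] : exists i, (i, p i) \in V by apply: VP; rewrite // inE.
  exists i => // k kL; apply/eqP; apply: contraNT pC => ki; rewrite pA /=.
  by apply/exists_inP; exists (i, p i) => //; apply/exists_inP; exists (k, p k) => //=;
    rewrite eq_sym ki !eqxx.
have dA' : dense y A'.
  by apply: (dense_sub As A'A (_ : 3 * N <= _)) => //; move: A36 N0; lra.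
have npA' : no_product A' A' A'.
  by move=> p q pA qA; apply: contra (np p q (subsetP A'A _ pA) (subsetP A'A _ qA)); apply: subsetP.
have densL S (c : R) i j : S \subset A -> (0 < #|S|)%N -> #|A|%:R <= c * #|S|%:R -> 0 < c -> c <= 512 ->
    (i, j) \notin L -> density R S i j <= y ^+ 249.
  move=> SA S0 cS c0 c5 ijL.
  apply: (le_trans _ (@y_pow_absorb _ _ y512 c 248 249 c5 isT)).
  apply: le_trans (density_sub i j SA S0 cS) _.
  by rewrite ler_pM2l //; apply: ltW; rewrite inE -ltNge in ijL.
have y249 : 0 <= y ^+ 249 by apply/exprn_ge0/ltW.
have CA' : clean y 249 (fun i j => (i, j) \in V) A'.
  split=> //.
    move=> i j ijV; have [ijL|ijL] := boolP ((i, j) \in L); last first.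
      by apply: (densL A' 3) => //; rewrite ler_nat.
    rewrite density_eq0 // => p /A'P[k kV kL]; apply: contraNneq ijV => pij.
    by rewrite -pij (kL i) // pij.
  rewrite sum_density_rel -[X in _ <= X]mulr1 -mulrA ler_wpM2l ?ler0n // mulrC.
  rewrite ler_pdivrMr ?ltr0n // mul1r -sumr_const; apply: ler_sum => p /A'P[k kV kL].
  rewrite (bigD1 k) //= kV big1 ?addr0 // => i; case: (boolP (_ \in V)) => //= iV.
  by rewrite (kL i) ?eqxx // VL.
(* If all row and column masses were below [n / 6], the three sums of [clean_star_sums] would total
   at most [n ^ 2 / 2]. *)
have [x [xr|xc]] : exists x, n%:R <= 6 * star_row R (fun i j => (i, j) \in V) A' x \/
    n%:R <= 6 * star_col R (fun i j => (i, j) \in V) A' x.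
  have [/existsP[x /orP xP]|] := boolP [exists x, (n%:R <= 6 * star_row R (fun i j => (i, j) \in V) A' x)
    || (n%:R <= 6 * star_col R (fun i j => (i, j) \in V) A' x)]; first by exists x.
  rewrite negb_exists => /forallP nx.
  set r := star_row R _ A' in nx; set c := star_col R _ A' in nx.
  have r_le i : r i <= n%:R / 6 by have := nx i; rewrite negb_or -!ltNge => /andP[+ _]; lra.
  have c_le i : c i <= n%:R / 6 by have := nx i; rewrite negb_or -!ltNge => /andP[_]; lra.
  have r0 i : 0 <= r i by apply: star_row_ge0.
  have c0 i : 0 <= c i by apply: star_col_ge0.
  have rn : \sum_i r i <= n%:R := sum_star_row_le CA'.
  have cn : \sum_i c i <= n%:R by rewrite /c sum_star_col.
  have n6 : 0 <= n%:R / 6 :> R by rewrite divr_ge0 // ltW.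
  have := clean_star_sums y512 ny L1 npA' CA' CA' CA'; rewrite -/r -/c.
  have h1 := sum_mul_le r0 r_le n6 rn; have h2 := sum_mul_le r0 c_le n6 rn.
  have h3 := sum_mul_le c0 c_le n6 cn.
  have y7 : y ^- 7 <= 1 / 4.
    rewrite -[y ^- 7]mul1r; apply: ler_pM => //; rewrite ?invr_ge0 ?exprn_ge0 ?(ltW y0) // lef_pV2 ?posrE ?exprn_gt0 //.
    have c4 : 4 <= 512 :> R by rewrite ler_nat.
    by have := @y_pow_absorb _ _ y512 4 0 7 c4 isT; rewrite expr0 mulr1.
  rewrite (@exprD2 _ y 1000 1000 2000 isT) -ny => h0; exfalso.
  exact: (lt_sum3_square_absurd n0 y7 h1 h2 h3 h0).
- pose S := [set p in A' | (x, p x) \in V].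
  have SA' : S \subset A' by apply/subsetP => p; rewrite inE => /andP[].
  have Sl : #|A'|%:R <= 6 * #|S|%:R :> R.
    have := le_trans xr (ler_wpM2l _ (star_row_le R (fun i j => (i, j) \in V) A' x)).
    rewrite (@sum_density_rel_row R n A' (fun i j => (i, j) \in V)) sum_natr_bool -/S.
    by move=> /(_ (ler0n _ _)); apply: star_card_aux; rewrite // ltr0n.
  have SA := subset_trans SA' A'A.
  have Sl18 : #|A|%:R <= 18 * #|S|%:R :> R by move: A'large Sl; lra.
  have dS : dense y S by apply: (dense_sub As SA (_ : 18 * N <= _)) => //; move: A36 N0; lra.
  (* Every [p] in [S] has its only [L]-hit in row [x], so the positions of [L] outside this row have
     density 0. *)
  exists S, x; split=> //; left; split=> //.
    move=> i j ix; have [ijL|ijL] := boolP ((i, j) \in L); last first.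
      by apply: (densL S 18) => //; rewrite ?ler_nat // (dense_gt0 dS).
    rewrite density_eq0 // => p; rewrite inE => /andP[/A'P[k kV kL] xV]; apply: contraNneq ix => pij.
    by rewrite (kL i) ?pij // (kL x) // VL.
  rewrite (bigD1 x) //= eqxx [X in _ + X]big1 ?addr0; last by move=> i /negPf ->; rewrite big1.
  by rewrite sum_density_row // (dense_gt0 dS).
- pose S := [set p in A' | ((p^-1)%g x, x) \in V].
  have SA' : S \subset A' by apply/subsetP => p; rewrite inE => /andP[].
  have Sl : #|A'|%:R <= 6 * #|S|%:R :> R.
    have := le_trans xc (ler_wpM2l _ (star_col_le R (fun i j => (i, j) \in V) A' x)).
    rewrite (@sum_density_rel_col R n A' (fun i j => (i, j) \in V)) sum_natr_bool -/S.
    by move=> /(_ (ler0n _ _)); apply: star_card_aux; rewrite // ltr0n.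
  have SA := subset_trans SA' A'A.
  have Sl18 : #|A|%:R <= 18 * #|S|%:R :> R by move: A'large Sl; lra.
  have dS : dense y S by apply: (dense_sub As SA (_ : 18 * N <= _)) => //; move: A36 N0; lra.
  exists S, x; split=> //; right; split=> //.
    move=> i j jx; have [ijL|ijL] := boolP ((i, j) \in L); last first.
      by apply: (densL S 18) => //; rewrite ?ler_nat // (dense_gt0 dS).
    rewrite density_eq0 // => p; rewrite inE => /andP[/A'P[k kV kL] xV]; apply: contraNneq jx => pij.
    have -> : j = p k by rewrite -pij (kL i) ?pij.
    by rewrite -(kL ((p^-1)%g x)) ?permKV // VL.
  rewrite exchange_big (bigD1 x) //= eqxx [X in _ + X]big1 ?addr0; last by move=> j /negPf ->; rewrite big1.
  by rewrite sum_density_col // (dense_gt0 dS).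
Qed.
End StarStructure.

Lemma row_tri_aux (R : realFieldType) (t b12 b23 t12 t23 u w z : R) :
  t + t12 + t23 <= w - z -> b12 <= u -> b23 <= u -> - b12 <= t12 -> - b23 <= t23 ->
  2 * u <= w -> t <= 2 * w - z.
Proof. by move=> *; lra. Qed.

Lemma row_energy_aux (R : realFieldType) (t q v w z : R) :
  - (2 * q * v) <= t -> t <= 2 * w - z -> 16 * w <= z -> 0 < w -> z <= 4 * q * v.
Proof. by move=> *; lra. Qed.

Lemma large_row_aux (R : realFieldType) (q u v : R) :
  v <= 4 * q -> q <= u -> 16 * u <= v -> 0 < u -> False.
Proof. by move=> *; lra. Qed.

Lemma cancel_aux (R : realFieldType) (a b w z : R) : a - b <= w - z -> b <= z -> a <= w.
Proof. by move=> *; lra. Qed.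

(** * Row stars *)

Section RowStars.
Variables (R : realFieldType) (n : nat) (y : R).
Hypothesis y512 : 512 <= y.
Hypothesis ny : n%:R = y ^+ 1000.
Hypothesis L1 : level1 n y.
Implicit Types (S A : {set 'S_n}).
Variable x : 'I_n.
Local Notation V := (fun i _ : 'I_n => i == x).
Local Notation star := (star_part R V).

Lemma row_tri_le S1 S2 S3 : row_clean y x S1 -> row_clean y x S2 -> row_clean y x S3 ->
  no_product S1 S2 S3 ->
  tri (star S1) (excess R S2) (star S3) <= 2 * y ^+ 1993 - y ^+ 2000.
Proof.
move=> C1 C2 C3 np; have y0 := y_gt0 y512.
have H := clean_tri_le y512 ny L1 np C1 C2 C3.
have b12 := sum_star_col_row_le y512 ny C1 C2.
have b23 := sum_star_col_col_le y512 ny C2 C3.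
have t12 := tri_star12_ge y V V V S1 S2 S3.
have t23 := tri_star23_ge y V V V S1 S2 S3.
have E : - (1 - y ^- 7) * y ^+ 2000 = y ^+ 1993 - y ^+ 2000.
  rewrite (@exprD2 _ y 7 1993 2000 isT); have := gt_eqF (exprn_gt0 7 y0).
  by move: (y ^+ 7) (y ^+ 1993) => z w z0; field; rewrite z0.
have c2 : 2 <= 512 :> R by rewrite ler_nat.
have c16 : 16 <= 512 :> R by rewrite ler_nat.
have F := @y_pow_absorb _ _ y512 2 1661 1993 c2 isT.
rewrite E in H; rewrite ny -(@exprD2 _ y 661 1000 1661 isT) in b12 b23.
exact: (row_tri_aux H b12 b23 t12 t23 F).
Qed.

Lemma star_part_row S i j : i != x -> star S i j = 0.
Proof. by move=> /negPf ix; rewrite /star_part ix. Qed.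

(** Replacing the middle excess by its small part only lowers the form, since the other parts are
    nonnegative. The squared norm of that part is at most [4 * y ^+ 1002], so Cauchy-Schwarz forces
    the star to be concentrated; [1499 = 2000 - 501]. *)
Lemma row_star_sqnorm_ge S1 S2 : row_clean y x S1 -> row_clean y x S2 ->
  no_product S1 S2 S1 -> y ^+ 1499 <= 4 * sqnorm (star S1).
Proof.
move=> C1 C2 np; have y0 := y_gt0 y512.
have H := row_tri_le C1 C2 C1 np.
have d2 : dense y S2 by case: C2.
set q := sqnorm _; have q0 : 0 <= q := sqnorm_ge0 _.
have lb : - (2 * q * y ^+ 501) <= tri (star S1) (small_part y V S2) (star S1).
  apply: (tri_geN (lexx _) (sqnorm_small y512 ny L1 V d2) (lexx _)).
    by apply: mulr_ge0; [exact: mulr_ge0|apply/exprn_ge0/ltW].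
  rewrite -/q (@exprD2 _ y 501 501 1002 isT) expr2.
  by rewrite le_eqVlt; apply/orP; left; apply/eqP; move: (y ^+ 501) => z; ring.
have mono : tri (star S1) (small_part y V S2) (star S1) <= tri (star S1) (excess R S2) (star S1).
  do 3!(apply: ler_sum => ? _); rewrite ler_wpM2r ?star_part_ge0 // ler_wpM2l ?star_part_ge0 //.
  by rewrite (excess_parts y V S2) lerDl addr_ge0 ?medium_part_ge0 ?star_part_ge0.
have c16 : 16 <= 512 :> R by rewrite ler_nat.
have F := @y_pow_absorb _ _ y512 16 1993 2000 c16 isT.
rewrite -(ler_pM2r (exprn_gt0 501 y0)) -(@exprD2 _ y 1499 501 2000 isT).
have p0 : 0 < y ^+ 1993 by apply: exprn_gt0.
exact: (row_energy_aux (le_trans lb mono) H F p0).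
Qed.

(** The -1 inside the excess contributes at least [- n ^ 2], which already exhausts the main term of
    [row_tri_le]. Little is left for the density: [S2] seldom sends an image of large weight for
    [S1] to one of large weight for [S3]. *)
Lemma row_weighted_le S1 S2 S3 : row_clean y x S1 -> row_clean y x S2 -> row_clean y x S3 ->
  no_product S1 S2 S3 ->
  \sum_j \sum_k star S1 x j * star S3 x k * density R S2 j k <= 2 * y ^+ 1993.
Proof.
move=> C1 C2 C3 np; have H := row_tri_le C1 C2 C3 np.
have r_le S : row_clean y x S -> \sum_j star S x j <= n%:R.
  move=> C; apply: le_trans (sum_star_row_le C).
  rewrite [X in _ <= X](bigD1 x) //= lerDl; apply: sumr_ge0 => i _; exact: star_row_ge0.
have nn : (\sum_j star S1 x j) * (\sum_k star S3 x k) <= y ^+ 2000.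
  rewrite (@exprD2 _ y 1000 1000 2000 isT) -ny; apply: ler_pM; try exact: r_le.
    by apply: sumr_ge0 => j _; apply: star_part_ge0.
  by apply: sumr_ge0 => j _; apply: star_part_ge0.
have E : tri (star S1) (excess R S2) (star S3) =
    \sum_j \sum_k star S1 x j * star S3 x k * density R S2 j k
    - (\sum_j star S1 x j) * (\sum_k star S3 x k).
  rewrite /tri (bigD1 x) //= [X in _ + X]big1 ?addr0; last first.
    by move=> i ix; do 2!(rewrite big1 // => ? _); rewrite star_part_row // !mul0r.
  rewrite mulr_suml -sumrB; apply: eq_bigr => j _.
  rewrite mulr_sumr -sumrB; apply: eq_bigr => k _.
  by rewrite /excess; ring.
by rewrite E in H; apply: (cancel_aux H nn).
Qed.

Lemma row_star_sqnorm_le S M : row_clean y x S -> 0 <= M ->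
  (forall j, density R S x j <= M) -> sqnorm (star S) <= M * n%:R.
Proof.
move=> C M0 d_le.
rewrite /sqnorm (bigD1 x) //= [X in _ + X]big1 ?addr0; last first.
  by move=> i ix; rewrite big1 // => j _; rewrite star_part_row // expr0n.
under eq_bigr do rewrite expr2.
apply: sum_mul_le => [j|j||] //.
- exact: star_part_ge0.
- by apply: le_trans (star_le_density _ _ _ _ _) _; rewrite eqxx.
- apply: le_trans (sum_star_row_le C).
  rewrite [X in _ <= X](bigD1 x) //= lerDl; apply: sumr_ge0 => i _; exact: star_row_ge0.
Qed.

(** The star has total mass at most [n], so densities bounded by [y ^+ 498] would give a squared
    norm of at most [y ^+ 1498], too small for [row_star_sqnorm_ge]. *)
Lemma exists_large_row_density S : row_clean y x S -> no_product S S S ->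
  exists j, y ^+ 498 < density R S x j.
Proof.
move=> C np; have y0 := y_gt0 y512; have q := row_star_sqnorm_ge C C np.
have [/existsP//|] := boolP [exists j, y ^+ 498 < density R S x j].
rewrite negb_exists => /forallP nx; exfalso.
have d_le j : density R S x j <= y ^+ 498 by rewrite leNgt.
have q_le := row_star_sqnorm_le C (exprn_ge0 498 (ltW y0)) d_le.
rewrite ny -(@exprD2 _ y 498 1000 1498 isT) in q_le.
have c16 : 16 <= 512 :> R by rewrite ler_nat.
have F := @y_pow_absorb _ _ y512 16 1498 1499 c16 isT.
exact: (large_row_aux q q_le F (exprn_gt0 _ y0)).
Qed.

End RowStars.

Lemma card_row_fibres n (A : {set 'S_n}) (x : 'I_n) (I : {set 'I_n}) :
  #|[set p in A | p x \in I]| = (\sum_(j in I) hits A x j)%N.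
Proof.
rewrite -sum1_card (partition_big (fun p : 'S_n => p x) (mem I)) /=; last first.
  by move=> p; rewrite inE => /andP[].
apply: eq_bigr => j jI; rewrite sum1dep_card; apply: eq_card => p; rewrite !inE.
by case: eqP => [->|_]; rewrite ?jI !(andbT, andbF).
Qed.

Lemma hits_removed_aux (R : realFieldType) (n h c N y z248 z z164 : R) :
  0 < n -> 0 < z -> 0 <= h -> 0 < y -> c * n * z248 <= 4 * y * N -> N < n * h * z -> 8 * z164 <= z248 ->
  z * y <= z164 -> 0 <= c -> 2 * c <= h.
Proof.
move=> n0 z0 h0 y0 h1 h2 h3 h4 c0; have zy : 0 < z * y by rewrite mulr_gt0.
rewrite -(ler_pM2l (_ : 0 < 4 * (n * (z * y)))) ?mulr_gt0 //.
apply: (@le_trans _ _ (c * n * z248)).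
  have -> : 4 * (n * (z * y)) * (2 * c) = c * n * (8 * (z * y)) by ring.
  rewrite ler_wpM2l ?mulr_ge0 ?(ltW n0) //; apply: le_trans h3; by rewrite ler_pM2l.
apply: le_trans h1 _; have -> : 4 * (n * (z * y)) * h = 4 * y * (n * h * z) by ring.
by rewrite ler_wpM2l ?mulr_ge0 ?ltW.
Qed.

Lemma class_density_aux (R : realFieldType) (n h h' s N z1 zc z498 z499 d : R) :
  0 < n -> 0 < s -> 0 < z1 -> 0 < zc -> h <= 2 * h' -> N < n * h * z1 -> d = n * h' / s ->
  s * (zc * z499) <= 4 * N -> zc * z499 = z1 * z498 -> z498 <= 8 * d.
Proof.
move=> n0 s0 z10 zc0 hh Nh -> sN E.
rewrite -(ler_pM2l (mulr_gt0 s0 z10)) -mulrA -E; apply: le_trans sN _.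
have -> : s * z1 * (8 * (n * h' / s)) = 8 * (n * h' * z1) by field; rewrite gt_eqF.
have : n * h * z1 <= n * (2 * h') * z1 by rewrite ler_pM2r // ler_pM2l.
by move: Nh; rewrite (_ : n * (2 * h') * z1 = 2 * (n * h' * z1)); [lra|ring].
Qed.

Lemma half_aux (R : realFieldType) (h s c : R) : h <= s + c -> 2 * c <= h -> h <= 2 * s.
Proof. by move=> *; lra. Qed.

Lemma star_density_aux (R : realFieldType) (d z w : R) :
  z <= 8 * d -> 16 * w <= z -> 1 <= w -> w <= d - 1.
Proof. by move=> *; lra. Qed.

Lemma class_size_aux (R : realFieldType) (n s zc N q z499 z1499 : R) :
  0 < n -> 0 < s -> 0 < zc -> z1499 <= 4 * q -> q <= N / (s * zc) * n ->
  z499 * n = z1499 -> s * (zc * z499) <= 4 * N.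
Proof.
move=> n0 s0 zc0 h1 h2 E; rewrite -(ler_pM2r n0).
have -> : 4 * N * n = s * zc * (4 * (N / (s * zc) * n)) by field; rewrite !gt_eqF.
have -> : s * (zc * z499) * n = s * zc * (z499 * n) by ring.
rewrite E ler_pM2l ?mulr_gt0 //; apply: le_trans h1 _.
by rewrite ler_pM2l.
Qed.

(** * Images of comparable frequency *)

Section PositionClasses.
Variables (R : realFieldType) (n : nat) (y : R).
Hypothesis y512 : 512 <= y.
Hypothesis ny : n%:R = y ^+ 1000.
Hypothesis L1 : level1 n y.
Implicit Types (S A : {set 'S_n}).
Local Notation N := (#|('Alt_('I_n))%g|%:R : R).
Local Notation star x := (star_part R (fun i _ : 'I_n => i == x)).

(* Dyadic-style classes, with ratio [y], of the images of [x] by their frequency in [A];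
   frequencies below [y ^- 163] are left to [rare_images]. *)
Definition position_class A x c : {set 'I_n} :=
  [set j | [&& j != x, N < n%:R * (hits A x j)%:R * y ^+ c.+1 & n%:R * (hits A x j)%:R * y ^+ c <= N]].

Definition class_fibre A x c := [set p in A | p x \in position_class A x c].

(** The factor 2 allows [class_clean] to remove up to half of the fibre. *)
Definition good_class A x c := 2 * N <= #|class_fibre A x c|%:R * y ^+ 661.

(** For [j] in the class, a hit at [(x, j)] has frequency above [y ^- 163 / n], whereas a hit there
    with an [L]-hit in another row has frequency of order [y ^- 247 / n]. Removing the latter keeps
    at least half of the hits at every single [j]. *)
Lemma class_clean A x c : A \subset ('Alt_('I_n))%g -> (c < 163)%N -> good_class A x c ->
  exists S, [/\ S \subset class_fibre A x c, row_clean y x S &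
    forall j, j \in position_class A x c -> (hits A x j)%:R <= 2 * (hits S x j)%:R :> R].
Proof.
move=> As c163 gc; have y0 := y_gt0 y512; have n0 := n_gt0R y512 ny.
have N0 : 0 < N by rewrite ltr0n Alt_gt0.
set A' := class_fibre A x c in gc.
have A'A : A' \subset A by apply/subsetP => p; rewrite inE => /andP[].
have A's := subset_trans A'A As.
have dA' : dense y A' by split=> //; apply: le_trans gc; rewrite ler_peMl ?ltW // ltr1n.
pose L := level_set y A' 248.
pose bad (p : 'S_n) := [exists i, (i != x) && ((i, p i) \in L)].
pose S := [set p in A' | ~~ bad p].
have SA' : S \subset A' by apply/subsetP => p; rewrite inE => /andP[].
have hS j : j \in position_class A x c -> (hits A x j)%:R <= 2 * (hits S x j)%:R :> R.
  move=> jI; pose C := [set p in A' | bad p && (p x == j)].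
  have CP p : p \in C -> ~~ odd_perm p /\ exists u w, [/\ u \in [set (x, j)], w \in L, u.1 != w.1,
      p u.1 = u.2 & p w.1 = w.2].
    rewrite inE => /and3P[pA /existsP[i /andP[ix iL]] /eqP px].
    split; first by rewrite -Alt_even; apply: (subsetP A's).
    by exists (x, j), (i, p i); rewrite inE /= eq_sym.
  have hC := card_double_level_hits y512 ny L1 dA' (isT : (1 < 248)%N) CP.
  have hA : (hits A x j <= hits S x j + #|C|)%N.
    apply: leq_trans (leq_card_setU _ _); apply/subset_leq_card/subsetP => p.
    rewrite !inE => /andP[pA /eqP px]; rewrite pA px eqxx.
    by rewrite inE in jI; rewrite jI /= orbC andbT; case: (bad p).
  have jN : N < n%:R * (hits A x j)%:R * y ^+ c.+1 by move: jI; rewrite inE => /and3P[].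
  have c8 : 8 <= 512 :> R by rewrite ler_nat.
  have zy : y ^+ c.+1 * y <= y ^+ 164 by rewrite -exprSr y_pow_le.
  rewrite cards1 mulr1 in hC.
  have c2 : 2 * #|C|%:R <= (hits A x j)%:R :> R.
    exact: (hits_removed_aux n0 (exprn_gt0 c.+1 y0) (ler0n _ _) y0 hC jN
      (@y_pow_absorb _ _ y512 8 164 248 c8 isT) zy (ler0n _ _)).
  by move: hA; rewrite -(ler_nat R) natrD => hA; apply: (half_aux hA c2).
have A'S : #|A'|%:R <= 2 * #|S|%:R :> R.
  have -> : S = [set p in S | p x \in position_class A x c].
    by apply/setP => p; rewrite !inE; case: (p \in A); rewrite ?andbF //=; case: [&& _, _ & _]; rewrite ?andbF ?andbT.
  rewrite /A' /class_fibre !card_row_fibres !natr_sum mulr_sumr; exact: ler_sum.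
exists S; have dS : dense y S.
  split; first exact: subset_trans SA' A's.
  rewrite -(ler_pM2l (_ : 0 < 2)) // mulrA; apply: le_trans gc _.
  by rewrite ler_wpM2r // exprn_ge0 // ltW.
have S0 := dense_gt0 dS.
split=> //; split=> //.
  move=> i j ix; have [ijL|ijL] := boolP ((i, j) \in L).
    rewrite density_eq0 ?exprn_ge0 ?(ltW y0) // => p; rewrite inE => /andP[_].
    by apply: contraNneq => pij; apply/existsP; exists i; rewrite ix pij.
  have c2 : 2 <= 512 :> R by rewrite ler_nat.
  apply: (le_trans _ (@y_pow_absorb _ _ y512 2 248 249 c2 isT)).
  apply: le_trans (density_sub i j SA' S0 A'S) _.
  by rewrite ler_pM2l //; apply: ltW; rewrite inE -ltNge in ijL.
rewrite (bigD1 x) //= eqxx [X in _ + X]big1 ?addr0; last by move=> i /negPf ->; rewrite big1.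
by rewrite sum_density_row.
Qed.

(** Within a class the densities of [S1] agree up to a factor of about [2 * y], so the lower bound
    on the squared norm, a statement about averages, becomes pointwise: the upper bound common to
    the class is at least [y ^+ 499 / 4], hence every density is at least [y ^+ 498 / 8]. *)
Lemma class_star A S x c : A \subset ('Alt_('I_n))%g -> no_product A A A ->
  S \subset A -> row_clean y x S -> (c < 163)%N -> good_class A x c ->
  exists S1, [/\ S1 \subset A, row_clean y x S1 &
    forall j, j \in position_class A x c -> y ^+ 497 <= star x S1 x j].
Proof.
move=> As np SA CS c163 gc; have y0 := y_gt0 y512; have n0 := n_gt0R y512 ny.
have [S1 [S1F C1 hS1]] := class_clean As c163 gc.
have S1A : S1 \subset A by apply: subset_trans S1F _; apply/subsetP => p; rewrite inE => /andP[].
exists S1; split=> // j jI.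
have d1 : dense y S1 by case: C1.
have S10 : 0 < #|S1|%:R :> R by rewrite ltr0n; apply: dense_gt0 d1.
have np1 : no_product S1 S S1.
  move=> a b aS bS; apply: contra (np a b (subsetP S1A _ aS) (subsetP SA _ bS)).
  exact: subsetP.
have q := row_star_sqnorm_ge y512 ny L1 C1 CS np1.
have yc := exprn_gt0 c y0.
have M0 : 0 < #|S1|%:R * y ^+ c by rewrite mulr_gt0.
have d_le k : density R S1 x k <= N / (#|S1|%:R * y ^+ c).
  have [kI|kI] := boolP (k \in position_class A x c); last first.
    rewrite density_eq0 ?divr_ge0 ?(ltW M0) // => p /(subsetP S1F); rewrite inE => /andP[_].
    by apply: contraTneq => ->.
  rewrite /density ler_pdivlMr // mulrA divfK ?gt_eqF //.
  move: kI; rewrite inE => /and3P[_ _]; apply: le_trans.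
  by rewrite ler_pM2r // ler_pM2l // ler_nat hits_sub.
have q_le := row_star_sqnorm_le C1 (divr_ge0 (ler0n R _) (ltW M0)) d_le.
have jN : N < n%:R * (hits A x j)%:R * y ^+ c.+1 by move: jI; rewrite inE => /and3P[].
have sN : #|S1|%:R * (y ^+ c * y ^+ 499) <= 4 * N.
  apply: (class_size_aux n0 S10 yc q q_le).
  by rewrite ny -(@exprD2 _ y 499 1000 1499 isT).
have E : y ^+ c * y ^+ 499 = y ^+ c.+1 * y ^+ 498.
  by rewrite -!exprD addSnnS.
have d498 := class_density_aux n0 S10 (exprn_gt0 c.+1 y0) yc (hS1 j jI) jN (erefl _) sN E.
have c16 : 16 <= 512 :> R by rewrite ler_nat.
have := star_density_aux d498 (@y_pow_absorb _ _ y512 16 497 498 c16 isT) (exprn_ege1 497 (y_ge1 y512)).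
rewrite -[_ / _ - 1]/(excess R S1 x j) /star_part eqxx /= => h.
by rewrite ifT // (lt_le_trans _ h) // exprn_gt0.
Qed.

End PositionClasses.

Lemma no_product_sub n (A A1 A2 A3 : {set 'S_n}) : no_product A A A ->
  A1 \subset A -> A2 \subset A -> A3 \subset A -> no_product A1 A2 A3.
Proof.
move=> np S1 S2 S3 a b aS bS; apply: contra (np a b (subsetP S1 _ aS) (subsetP S2 _ bS)).
exact: subsetP.
Qed.

Lemma small_density_aux (R : realFieldType) (n h s N z163 z498 z661 : R) :
  0 < s -> 0 < z163 -> n * h * z163 <= N -> N <= s * z661 -> z661 = z163 * z498 ->
  n * h / s <= z498.
Proof.
move=> s0 z0 h1 h2 E; rewrite ler_pdivrMr // -(ler_pM2r z0); apply: le_trans h1 _.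
by rewrite (_ : z498 * s * z163 = s * z661) // E; ring.
Qed.

Lemma sum_set_le (R : numDomainType) (I : finType) (P : {set I}) (f : I -> R) c :
  0 <= c -> (forall i, i \in P -> f i <= c) -> \sum_(i in P) f i <= #|I|%:R * c.
Proof.
move=> c0 fc; apply: le_trans (ler_sum _ fc) _; rewrite sumr_const -[X in X <= _]mulr_natl.
by rewrite ler_wpM2r // ler_nat max_card.
Qed.

Lemma union_bound_aux (R : realFieldType) (N y a x0 r b l z660 z661 : R) : 0 < N -> 0 < y ->
  a <= x0 + r + b + l -> x0 * z661 <= N -> r * z661 <= 36 * N -> b * z661 <= 163 * (2 * N) ->
  l * z661 <= 163 * (163 * (36 * N)) -> 0 < z661 -> 1000 * 1000 <= y -> z661 = y * z660 -> a * z660 < N.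
Proof.
move=> N0 y0 h h1 h2 h3 h4 z0 y6 E; rewrite -(ltr_pM2l y0).
have -> : y * (a * z660) = a * z661 by rewrite E; ring.
apply: (@lt_le_trans _ _ (1000 * 1000 * N)); last by rewrite ler_pM2r.
have : a * z661 <= (x0 + r + b + l) * z661 by rewrite ler_pM2r.
by move: h1 h2 h3 h4 N0; clear; lra.
Qed.

(** * The part of the set outside the row family *)

Section FinalRow.
Variables (R : realFieldType) (n : nat) (y : R).
Hypothesis y512 : 512 <= y.
Hypothesis ny : n%:R = y ^+ 1000.
Hypothesis L1 : level1 n y.
Local Notation N := (#|('Alt_('I_n))%g|%:R : R).
Variables (A S : {set 'S_n}) (x : 'I_n).
Hypothesis As : A \subset ('Alt_('I_n))%g.
Hypothesis np : no_product A A A.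
Hypothesis SA : S \subset A.
Hypothesis CS : row_clean y x S.

(** A star in another row or in a column would contradict an exclusion lemma, with the given star
    [S] in the first two places. *)
Lemma star_structure_row (B : {set 'S_n}) : B \subset A ->
  36 * N <= #|B|%:R * y ^+ 661 -> exists2 S2 : {set 'S_n}, S2 \subset B & row_clean y x S2.
Proof.
move=> BA B36.
have [S2 [x2 [S2B _ C]]] := star_structure y512 ny L1 (subset_trans BA As) (no_product_sub np BA BA BA) B36.
have npS := no_product_sub np SA SA (subset_trans S2B BA).
exists S2 => //; case: C => C; last by case: (star_exclusion_col y512 ny L1 CS CS C npS).
have [->//|xx] := eqVneq x x2.
by case: (star_exclusion_row y512 ny L1 xx CS CS C npS).
Qed.

Definition rare_images := [set p in A | n%:R * (hits A x (p x))%:R * y ^+ 163 <= N].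

(** In a subset of measure at least [y ^- 661], a rare image has density at most [y ^+ 498], too
    small for [exists_large_row_density]. This determines the cutoff [163 = 661 - 498]. *)
Lemma rare_images_small : #|rare_images|%:R * y ^+ 661 < 36 * N.
Proof.
rewrite ltNge; apply/negP => B36; have y0 := y_gt0 y512.
have BA : rare_images \subset A by apply/subsetP => p; rewrite inE => /andP[].
have [S2 S2B C2] := star_structure_row BA B36.
have S2A := subset_trans S2B BA.
have [j] := exists_large_row_density y512 ny L1 C2 (no_product_sub np S2A S2A S2A).
have d2 : dense y S2 by case: C2.
have S20 : 0 < #|S2|%:R :> R by rewrite ltr0n; apply: dense_gt0 d2.
apply/negP; rewrite -leNgt.
have [/exists_inP[p pS /eqP px]|] := boolP [exists p in S2, p x == j]; last first.
  rewrite negb_exists_in => /forall_inP H.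
  by rewrite density_eq0 ?exprn_ge0 ?ltW.
have := subsetP S2B _ pS; rewrite inE px => /andP[_ h].
have hh : n%:R * (hits S2 x j)%:R * y ^+ 163 <= N.
  apply: le_trans h; rewrite ler_wpM2r ?exprn_ge0 ?(ltW y0) // ler_wpM2l ?ler0n //.
  by rewrite ler_nat hits_sub.
case: d2 => _ d2.
exact: (small_density_aux S20 (exprn_gt0 163 y0) hh d2 (@exprD2 _ y 163 498 661 isT)).
Qed.

Definition class_links c c' :=
  [set p in A | [exists j in position_class y A x c, p j \in position_class y A x c']].

(** Every [p] of a star found among the links sends some [j] of class [c] into class [c'], so the
    densities at such pairs sum to at least [n]. With star weights of at least [y ^+ 497] on both
    sides this gives [y ^+ 1994], above the bound of [row_weighted_le]. *)
Lemma class_links_small c c' : (c < 163)%N -> (c' < 163)%N -> good_class y A x c -> good_class y A x c' ->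
  #|class_links c c'|%:R * y ^+ 661 < 36 * N.
Proof.
move=> c163 c163' gc gc'; rewrite ltNge; apply/negP => B36.
have y0 := y_gt0 y512; have n0 := n_gt0R y512 ny.
have BA : class_links c c' \subset A by apply/subsetP => p; rewrite inE => /andP[].
have [S2 S2B C2] := star_structure_row BA B36.
have S2A := subset_trans S2B BA.
have [S1 [S1A C1 h1]] := class_star y512 ny L1 As np SA CS c163 gc.
have [S3 [S3A C3 h3]] := class_star y512 ny L1 As np SA CS c163' gc'.
have := row_weighted_le y512 ny L1 C1 C2 C3 (no_product_sub np S1A S2A S3A).
apply/negP; rewrite -ltNge.
have c2 : 2 <= 512 :> R by rewrite ler_nat.
have c3 : 2 < 512 :> R by rewrite ltr_nat.
apply: (@lt_le_trans _ _ (y ^+ 1994)).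
  rewrite (@exprD2 _ y 1 1993 1994 isT) expr1 ltr_pM2r ?exprn_gt0 //.
  exact: lt_le_trans c3 y512.
pose V j k := (j \in position_class y A x c) && (k \in position_class y A x c').
have d2 : dense y S2 by case: C2.
have S20 : 0 < #|S2|%:R :> R by rewrite ltr0n; apply: dense_gt0 d2.
have nV : n%:R <= \sum_j \sum_k (if V j k then density R S2 j k else 0).
  rewrite (@sum_density_rel R n S2 V) mulrAC ler_pdivlMr // ler_pM2l //.
  rewrite -sumr_const; apply: ler_sum => p /(subsetP S2B); rewrite inE => /andP[_ /exists_inP[j jI pI]].
  by rewrite (bigD1 j) //= /V jI pI lerDl sumr_ge0.
rewrite (@exprD2 _ y 994 1000 1994 isT) -ny.
apply: le_trans (ler_wpM2l _ nV) _; first exact/exprn_ge0/ltW.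
rewrite mulr_sumr; apply: ler_sum => j _; rewrite mulr_sumr; apply: ler_sum => k _.
have d0 := density_ge0 R S2 j k.
rewrite /V; case: (boolP (j \in _)) => [jI|_] /=; last first.
  by rewrite mulr0; apply: mulr_ge0 => //; apply: mulr_ge0; apply: star_part_ge0.
case: (boolP (k \in _)) => [kI|_] /=; last first.
  by rewrite mulr0; apply: mulr_ge0 => //; apply: mulr_ge0; apply: star_part_ge0.
apply: ler_wpM2r => //; rewrite (@exprD2 _ y 497 497 994 isT).
have p0 : 0 <= y ^+ 497 by apply/exprn_ge0/ltW.
by apply: ler_pM => //; [apply: h1|apply: h3].
Qed.

Lemma exists_class j : j != x -> (0 < hits A x j)%N ->
  N < n%:R * (hits A x j)%:R * y ^+ 163 -> exists c : 'I_163, j \in position_class y A x c.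
Proof.
move=> jx h0 big; have n512 := n_gt512 y512 ny.
have b0 : n%:R * (hits A x j)%:R * y ^+ 0 <= N.
  rewrite expr0 mulr1 -natrM ler_nat.
  have n3 : (3 < #|'I_n|)%N by rewrite card_ord; apply: leq_trans n512.
  rewrite -(card_even_perm1 x j n3) card_ord mulnC leq_mul2r; apply/orP; right.
  apply/subset_leq_card/subsetP => p; rewrite !inE => /andP[pS ->]; rewrite andbT.
  by move/subsetP: As => /(_ _ pS); rewrite Alt_even.
pose P c := N < n%:R * (hits A x j)%:R * y ^+ c.
have exP : exists c, P c by exists 163.
(* The class is the predecessor of the least exponent satisfying [P]; exponent 0 fails because a
   position receives at most the fraction [1 / n] of the even permutations. *)
case: (ex_minnP exP) => -[|c] Pc cmin; first by move: Pc; rewrite /P ltNge b0.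
have c163 : (c < 163)%N by apply: cmin.
exists (Ordinal c163); rewrite inE jx /=; apply/andP; split=> //.
by rewrite leNgt; apply/negP => /cmin; rewrite ltnn.
Qed.

(** The image [x] itself is excluded from the classes, since [Fset x I] is empty as soon as [x]
    belongs to [I]. *)
Lemma card_fixing : #|[set p in A | p x == x]|%:R * y ^+ 661 <= N.
Proof.
have n512 := n_gt512 y512 ny.
apply: (@le_trans _ _ (#|[set p in A | p x == x]|%:R * n%:R)).
  by rewrite ny ler_wpM2l ?ler0n // y_pow_le.
rewrite -natrM ler_nat.
have n3 : (3 < #|'I_n|)%N by rewrite card_ord; apply: leq_trans n512.
rewrite -(card_even_perm1 x x n3) card_ord leq_mul2r; apply/orP; right.
apply/subset_leq_card/subsetP => p; rewrite !inE => /andP[pS ->]; rewrite andbT.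
by move/subsetP: As => /(_ _ pS); rewrite Alt_even.
Qed.

(** The exceptional permutations fix [x], have a rare image of [x], fall in a class that is not
    good, or link two good classes. Their total is at most [1 + 36 + 163 * 2 + 163 * 163 * 36 =
    956847] times [N * y ^- 661], whence the requirement [1000 * 1000 <= y] to return to the
    exponent 660. *)
Lemma row_star_conclusion : 1000 * 1000 <= y ->
  exists I : {set 'I_n}, #|A :\: Fset x I|%:R * y ^+ 660 < N.
Proof.
move=> y6; have y0 := y_gt0 y512.
have N0 : 0 < N by rewrite ltr0n Alt_gt0.
have z0 : 0 < y ^+ 661 by apply: exprn_gt0.
pose G := [set c : 'I_163 | good_class y A x c].
exists (\bigcup_(c in G) position_class y A x c); set I := \bigcup_(c in G) _.
have cover : A :\: Fset x I \subset [set p in A | p x == x] :|: rare_images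
    :|: \bigcup_(c in ~: G) class_fibre y A x c :|: \bigcup_(c in G) \bigcup_(c' in G) class_links c c'.
  apply/subsetP => p; rewrite !in_setU => /setDP[pA pF].
  have [px|px] := boolP (p x == x); first by rewrite !inE pA px.
  have [pr|pr] := boolP (p \in rare_images); first by rewrite !orbT.
  have [c pc] : exists c : 'I_163, p x \in position_class y A x c.
    apply: exists_class => //; last by move: pr; rewrite inE pA /= -ltNge.
    by rewrite /hits card_gt0; apply/set0Pn; exists p; rewrite inE pA eqxx.
  have [cG|cG] := boolP (c \in G); last first.
    apply/orP; left; apply/orP; right; apply/bigcupP; exists c; first by rewrite inE.
    by rewrite inE pA.
  have pI : p x \in I by apply/bigcupP; exists c.
  apply/orP; right; move: pF; rewrite inE pI (subsetP As _ pA) /= => /pred0Pn[k /= /andP[/imsetP[j jI ->] pjI]].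
  move/bigcupP: jI => [c1 c1G jc1]; move/bigcupP: pjI => [c2 c2G jc2].
  apply/bigcupP; exists c1 => //; apply/bigcupP; exists c2 => //.
  by rewrite inE pA; apply/exists_inP; exists j.
have card_cover : #|A :\: Fset x I|%:R <= #|[set p in A | p x == x]|%:R + #|rare_images|%:R
    + \sum_(c in ~: G) #|class_fibre y A x c|%:R
    + \sum_(c in G) \sum_(c' in G) #|class_links c c'|%:R :> R.
  have h1 := leq_card_bigcup (~: G) (fun c : 'I_163 => class_fibre y A x c).
  have h2 := leq_card_bigcup G (fun c => \bigcup_(c' in G) class_links c c').
  have h3 : (\sum_(c in G) #|\bigcup_(c' in G) class_links c c'| <= \sum_(c in G) \sum_(c' in G) #|class_links c c'|)%N.
    by apply: leq_sum => c _; apply: leq_card_bigcup.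
  under [X in _ <= _ + X]eq_bigr do rewrite -natr_sum.
  rewrite -!natr_sum -!natrD ler_nat.
  apply: leq_trans (subset_leq_card cover) _.
  apply: leq_trans (leq_card_setU _ _) _; apply: leq_add; last exact: leq_trans h2 h3.
  apply: leq_trans (leq_card_setU _ _) _; apply: leq_add => //.
  exact: leq_card_setU.
have bad_le : (\sum_(c in ~: G) #|class_fibre y A x c|%:R) * y ^+ 661 <= 163 * (2 * N).
  rewrite mulr_suml -[X in X%:R * _](card_ord 163); apply: sum_set_le => [|c]; first by rewrite mulr_ge0 ?ltW.
  by rewrite !inE -ltNge => /ltW.
have link_le : (\sum_(c in G) \sum_(c' in G) #|class_links c c'|%:R) * y ^+ 661 <= 163 * (163 * (36 * N)).
  have p36 : 0 <= 36 * N by rewrite mulr_ge0 ?ltW.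
  rewrite mulr_suml -[X in X%:R * _](card_ord 163); apply: sum_set_le => [|c]; first by rewrite mulr_ge0.
  rewrite inE => gc; rewrite mulr_suml -[X in X%:R * _](card_ord 163); apply: sum_set_le => // c'.
  by rewrite inE => gc'; apply/ltW/class_links_small.
exact: (union_bound_aux N0 y0 card_cover card_fixing (ltW rare_images_small) bad_le link_le z0 y6
  (@exprD2 _ y 1 660 661 isT)).
Qed.

End FinalRow.

(** * The theorem *)

Section Inversion.
Variables (R : realFieldType) (n : nat).
Implicit Types (A S : {set 'S_n}).

Lemma hitsV S i j : hits S^-1%g i j = hits S j i.
Proof.
rewrite /hits -(card_imset _ invg_inj); apply: eq_card => p; rewrite inE.
apply/imsetP/andP => [[q + ->]|[pS /eqP pj]].
  by rewrite inE mem_invg => /andP[-> /eqP <-]; rewrite permK.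
by exists (p^-1)%g; rewrite ?invgK // inE mem_invg invgK pS -pj permK eqxx.
Qed.

Lemma densityV S i j : density R S^-1%g i j = density R S j i.
Proof. by rewrite /density hitsV card_invg. Qed.

Lemma invg_subset_Alt A : A \subset ('Alt_('I_n))%g -> A^-1%g \subset ('Alt_('I_n))%g.
Proof. by move=> As; apply/subsetP => p; rewrite mem_invg => /(subsetP As); rewrite groupV. Qed.

Lemma no_productV A : no_product A A A -> no_product A^-1%g A^-1%g A^-1%g.
Proof. by move=> np a b; rewrite !mem_invg invMg => aA bA; apply: np. Qed.

Lemma col_cleanV (y : R) x S : col_clean y x S -> row_clean y x S^-1%g.
Proof.
case=> -[Ss dS] cS sS; split; first by split; rewrite ?invg_subset_Alt // card_invg.
  by move=> i j ix; rewrite densityV; apply: cS.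
rewrite exchange_big; under eq_bigr do under eq_bigr do rewrite densityV.
exact: sS.
Qed.

End Inversion.

Lemma product_free_star (R : realFieldType) n (y : R) (A : {set 'S_n}) :
  1000 * 1000 <= y -> n%:R = y ^+ 1000 -> level1 n y ->
  A \subset ('Alt_('I_n))%g -> no_product A A A ->
  #|('Alt_('I_n))%g|%:R <= #|A|%:R * y ^+ 660 ->
  exists (x : 'I_n) (I : {set 'I_n}),
    #|A :\: Fset x I|%:R * y ^+ 660 < #|('Alt_('I_n))%g|%:R \/
    #|A^-1%g :\: Fset x I|%:R * y ^+ 660 < #|('Alt_('I_n))%g|%:R.
Proof.
move=> y6 ny L1 As np dA; have y512 : 512 <= y by lra.
have A36 : 36 * #|('Alt_('I_n))%g|%:R <= #|A|%:R * y ^+ 661.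
  rewrite (@exprD2 _ y 1 660 661 isT) expr1 mulrCA; apply: ler_pM => //; lra.
have [S [x [SA _ [C|C]]]] := star_structure y512 ny L1 As np A36.
  have [I hI] := row_star_conclusion y512 ny L1 As np SA C y6.
  by exists x, I; left.
have SAV : S^-1%g \subset A^-1%g by rewrite invSg.
have [I hI] := row_star_conclusion y512 ny L1 (invg_subset_Alt As) (no_productV np) SAV (col_cleanV C) y6.
by exists x, I; right.
Qed.

(** The root turns every real exponent into a natural power of [y], with 660 for 66/100. *)
Lemma thousandth_root (R : realType) n (y := n%:R `^ (1 / 1000) : R) : (0 < n)%N ->
  n%:R = y ^+ 1000 /\ n%:R `^ (- (66 / 100)) = (y ^+ 660)^-1.
Proof.
move=> n0; have n0R : 0 <= n%:R :> R by rewrite ler0n.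
have y0 : 0 <= y by apply: powR_ge0.
rewrite -!powR_mulrn // -!powRrM powRN; split.
  by rewrite (_ : 1 / 1000 * 1000 = 1) ?powRr1 //; field.
by congr (_ `^ _)^-1; field.
Qed.

Theorem theorem1p2 (R : realType) :
  exists N : nat, forall n : nat, (N <= n)%N ->
  forall A : {set 'S_n}, A \subset ('Alt_('I_n))%g -> product_free A ->
  n%:R `^ (- (66 / 100)) <= mu R A ->
  exists (x : 'I_n) (I : {set 'I_n}),
    mu R (A :\: Fset x I) < n%:R `^ (- (66 / 100)) \/
    mu R (A^-1%g :\: Fset x I) < n%:R `^ (- (66 / 100)).
Proof.
have [Y0 Y0P] := level1_bound R.
pose Y := Num.max Y0 (1000 * 1000).
(* The Archimedean bound puts [n] above [Y ^+ 1000], hence [y] above both the level-1 constant and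
   [1000 * 1000]. *)
exists (maxn 2 (Num.bound (Y ^+ 1000))) => n; rewrite geq_max => /andP[n2 nY] A As pf.
have [ny ->] := thousandth_root R (ltnW n2); move: ny; set y := _ `^ _ => ny.
have y0 : 0 <= y by apply: powR_ge0.
have Yy : Y <= y.
  have Y0' : 0 <= Y by rewrite le_max (_ : 0 <= 1000 * 1000) ?orbT //; lra.
  rewrite -(@ler_pXn2r _ 1000) ?nnegrE // -ny; apply: ltW.
  by apply: lt_le_trans (archi_boundP (exprn_ge0 _ Y0')) _; rewrite ler_nat.
have y6 : 1000 * 1000 <= y by apply: le_trans Yy; rewrite le_max lexx orbT.
have L1 : level1 n y.
  apply: Y0P => //; first by lra.
  by apply: le_trans Yy; rewrite le_max lexx.
have yp : 0 < y ^+ 660 by apply: exprn_gt0; lra.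
have N0 : 0 < #|('Alt_('I_n))%g|%:R :> R by rewrite ltr0n Alt_gt0.
have np : no_product A A A.
  by move=> a b aA bA; apply/negP => abA; apply: pf; exists a, b, (a * b)%g.
have mu_lt (B : {set 'S_n}) : (mu R B < (y ^+ 660)^-1) = (#|B|%:R * y ^+ 660 < #|('Alt_('I_n))%g|%:R).
  by rewrite /mu ltr_pdivrMr // mulrC ltr_pdivlMr.
rewrite leNgt mu_lt -leNgt => dA.
have [x [I xI]] := product_free_star y6 ny L1 As np dA.
by exists x, I; rewrite !mu_lt.
Qed.
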